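(* Suppose that Assumption (Traps), stated in the context, holds and that $\mathbb{E}[c_0^\alpha]<\infty$ or $\mathbb{E}[1/c_0^\alpha]<\infty$. Then the distribution of $(c_{-1},1/c_0)$, conditionally on $\rho_0>t$, converges as $t\to+\infty$ to that of the random variable \[ (1-B)\cdot(\bar c_{-1},+\infty)+B\cdot(+\infty,1/\bar c_0) \] (i.e. equal to $(\bar c_{-1},+\infty)$ on $\{B=0\}$ and to $(+\infty,1/\bar c_0)$ on $\{B=1\}$), where $B$ is a Bernoulli random variable independent of $\bar c_{-1},1/\bar c_0$, with parameter $q=P(B=1)\in[0,1]$. If $\mathbb{E}[1/c_0^\alpha]=+\infty$, then $q=0$; if $\mathbb{E}[c_0^\alpha]=+\infty$, then $q=1$; if $\mathbb{E}[c_0^\alpha]<+\infty$ and $\mathbb{E}[1/c_0^\alpha]<+\infty$ ($\alpha=\alpha_\infty=\alpha_0$), then \[ q=\lim_{t\to+\infty}\frac{\mathbb{E}[c_0^\alpha]\,L_0(t)}{\mathbb{E}[c_0^\alpha]\,L_0(t)+\mathbb{E}[1/c_0^\alpha]\,L_\infty(t)}, \] this limit being assumed to exist (to avoid working with subsequences).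
   Context: $\{c_x\}_{x\in\mathbb{Z}}$ are i.i.d. strictly positive random variables under $\mathbb{P}$ (expectation $\mathbb{E}$), $\lambda>0$ is fixed and $\rho_0:=e^{-\lambda}c_{-1}/c_0$. Assumption (Traps). There are slowly varying functions $L_\infty,L_0$ and $\alpha_\infty,\alpha_0>0$ such that for $t>1$ and $\varepsilon<1$, $\mathbb{P}(c_0>t)=L_\infty(t)t^{-\alpha_\infty}$ and $\mathbb{P}(c_0<\varepsilon)=L_0(1/\varepsilon)\varepsilon^{\alpha_0}$, with $\alpha:=\min\{\alpha_0,\alpha_\infty\}<1$. If $\alpha_0=\alpha_\infty$, assume additionally that $v\mapsto L_\infty(e^v)$ and $v\mapsto L_0(e^v)$ are regularly varying with respective indices $\gamma_\infty\neq-1$, $\gamma_0\neq-1$. If $\mathbb{E}[c_0^\alpha]<+\infty$, $\bar c_{-1}$ is a random variable with c.d.f. $F_{\bar c_{-1}}(u)=\frac{1}{\mathbb{E}[c_{-1}^\alpha]}\mathbb{E}[c_{-1}^\alpha\mathbf 1_{\{c_{-1}\le u\}}]$. If $\mathbb{E}[1/c_0^\alpha]<+\infty$, $1/\bar c_0$ is a random variable with c.d.f. $F_{1/\bar c_0}(u)=\frac{1}{\mathbb{E}[1/c_0^\alpha]}\mathbb{E}[1/c_0^\alpha\,\mathbf 1_{\{1/c_0\le u\}}]$. Convergence of distributions is weak convergence on $(0,+\infty]^2$.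
   Formalization: The printed formula for q gives P(B=0), not P(B=1); the numerator is corrected to E[1/c_0^α]L_∞(t), with the same denominator. The parenthetical α=α_∞=α_0 is taken as a condition of this third case. *)

(* Defs.v *)
From HB Require Import structures.
From mathcomp Require Import all_boot all_order all_algebra finmap.
From mathcomp Require Import all_classical all_reals all_analysis.
From mathcomp Require Import measurable_realfun.

Set Implicit Arguments.
Unset Strict Implicit.
Unset Printing Implicit Defensive.

Import Order.TTheory GRing.Theory Num.Theory.
Import numFieldNormedType.Exports.

Local Open Scope classical_set_scope.
Local Open Scope ring_scope.

(* f is only required to be positive and measurable near +oo, as is usual for
   functions of regular variation at infinity. *)
Definition regularly_varying (R : realType) (gamma : R) (f : R -> R) : Prop :=
  (exists X : R, measurable_fun `[X, +oo[ f /\ forall x, X <= x -> 0 < f x) /\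
  forall a : R, 0 < a -> f (a * x) / f x @[x --> +oo] --> a `^ gamma.

Definition slowly_varying (R : realType) (f : R -> R) : Prop :=
  regularly_varying 0 f.

Definition independent_family (R : realType) (d : measure_display)
    (T : measurableType d) (P : probability T R) (I : choiceType)
    (X : I -> {RV P >-> R}) : Prop :=
  forall (J : {fset I}) (A : I -> set R), (forall i, measurable (A i)) ->
    P (\bigcap_(i in [set` J]) (X i @^-1` A i)) =
    (\prod_(i <- J) P (X i @^-1` A i))%E.

Definition identically_distributed (R : realType) (d : measure_display)
    (T : measurableType d) (P : probability T R) (I : choiceType)
    (X : I -> {RV P >-> R}) : Prop :=
  forall (i j : I) (A : set R), measurable A ->
    distribution P (X i) A = distribution P (X j) A.

Definition independent_pair (R : realType) (d d1 d2 : measure_display)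
    (T : measurableType d) (T1 : measurableType d1) (T2 : measurableType d2)
    (P : probability T R) (X : T -> T1) (Y : T -> T2) : Prop :=
  forall (A : set T1) (B : set T2), measurable A -> measurable B ->
    P (X @^-1` A `&` Y @^-1` B) = (P (X @^-1` A) * P (Y @^-1` B))%E.

Definition trap_index (R : realType) (aoo a0 : R) : R := Num.min a0 aoo.

Record traps (R : realType) (d : measure_display) (T : measurableType d)
    (P : probability T R) (c0 : T -> R) (Loo L0 : R -> R) (aoo a0 : R) : Prop :=
  Traps {
    traps_Loo : slowly_varying Loo ;
    traps_L0 : slowly_varying L0 ;
    traps_aoo : 0 < aoo ;
    traps_a0 : 0 < a0 ;
    traps_tailoo : forall t : R, 1 < t ->
      P [set w | t < c0 w] = (Loo t * t `^ (- aoo))%:E ;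
    traps_tail0 : forall e : R, 0 < e -> e < 1 ->
      P [set w | c0 w < e] = (L0 e^-1 * e `^ a0)%:E ;
    traps_lt1 : trap_index aoo a0 < 1 ;
    traps_eq : a0 = aoo ->
      exists goo g0 : R,
        [/\ goo != -1, g0 != -1,
            regularly_varying goo (fun v => Loo (expR v)) &
            regularly_varying g0 (fun v => L0 (expR v))]
  }.

Definition moment (R : realType) (d : measure_display) (T : measurableType d)
    (P : probability T R) (alpha : R) (Y : T -> R) : \bar R :=
  ('E_P[fun w => (Y w `^ alpha)%R])%E.

Definition size_biased (R : realType) (d d' : measure_display)
    (T : measurableType d) (T' : measurableType d')
    (P : probability T R) (P' : probability T' R)
    (alpha : R) (Y : T -> R) (X : {RV P' >-> R}) : Prop :=
  forall u : R,
    cdf X u = (((fine (moment P alpha Y))^-1)%:E *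
      'E_P[fun w => (Y w `^ alpha * \1_[set w | Y w <= u] w)%R])%E.

Definition conditional (R : realType) (d : measure_display)
    (T : measurableType d) (P : probability T R) (H : set T) :
    set T -> \bar R :=
  fun A => (P (A `&` H) * ((fine (P H))^-1)%:E)%E.

(* (0, +oo]^2, with the topology induced by the extended real line. *)
Definition quadrant (R : realType) : set (\bar R * \bar R) :=
  [set p | (0 < p.1)%E /\ (0 < p.2)%E].

Definition weak_cvg_quadrant (R : realType)
    (mu : R -> set (\bar R * \bar R) -> \bar R)
    (nu : set (\bar R * \bar R) -> \bar R) : Prop :=
  forall f : \bar R * \bar R -> R,
    {within @quadrant R, continuous f} ->
    [bounded f x | x in @quadrant R] ->
    (\int[mu t]_(x in @quadrant R) (f x)%:E)%E @[t --> +oo] -->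
    (\int[nu]_(x in @quadrant R) (f x)%:E)%E.

Definition rho0 (R : realType) (T : Type) (lambda : R) (c : int -> T -> R)
    (w : T) : R :=
  expR (- lambda) * c (-1) w / c 0 w.

(* The law of (c_{-1}, 1/c_0) conditionally on rho_0 > t. *)
Definition cond_law (R : realType) (d : measure_display)
    (T : measurableType d) (P : probability T R) (lambda : R)
    (c : int -> {RV P >-> R}) (t : R) : set (\bar R * \bar R) -> \bar R :=
  pushforward (conditional P [set w | t < rho0 lambda (fun x => c x) w])
    (fun w => ((c (-1) w)%:E, ((c 0 w)^-1)%:E)).

(* (1 - B) (cbar, +oo) + B (+oo, ibar), with the convention 0 * (+oo) = 0. *)
Definition mixture (R : realType) (T : Type) (B : T -> bool)
    (cbar ibar : T -> R) (w : T) : \bar R * \bar R :=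
  if B w then (+oo%E, (ibar w)%:E) else ((cbar w)%:E, +oo%E).

(* With Ec = E[c_0 ^ alpha] and Ei = E[1 / c_0 ^ alpha], the asymptotic weight
   of the event {c_{-1} is large}, i.e. of {B = 1}, given rho_0 > t when
   a0 = aoo = alpha: up to the common factor (e ^ lambda t) ^ - alpha, the event
   {rho_0 > t, c_{-1} large} has probability Ei * Loo t and the event
   {rho_0 > t, 1 / c_0 large} has probability Ec * L0 t.  Hence Ei * Loo t, and
   not Ec * L0 t, is the numerator for P(B = 1). *)
Definition weight (R : realType) (Ec Ei : R) (Loo L0 : R -> R) (t : R) : R :=
  Ei * Loo t / (Ec * L0 t + Ei * Loo t).

(* Main.v *)
Require Import Defs.
From HB Require Import structures.
From mathcomp Require Import all_boot all_order all_algebra finmap.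
From mathcomp Require Import all_classical all_reals all_analysis.
From mathcomp Require Import measurable_realfun ring lra.

Import Order.TTheory GRing.Theory Num.Theory.
Import numFieldNormedType.Exports.

Local Open Scope classical_set_scope.
Local Open Scope ring_scope.

(* Write mu and nu for the laws of X = c_{-1} and Y = 1/c_0, with tails of index
   alpha.  Three regions of {XY > s} matter.  Where X <= K, dominated
   convergence applies to E[F(X, Y); X <= K, XY > s] divided by the tail of Y,
   because P(Y > s/x) / P(Y > s) tends to x^alpha; this yields the size-biased
   law of X, with Y sent to +oo.  The region Y <= K is symmetric.  What remains is
   that P(X > K, Y > K, XY > s) / P(XY > s) is small for large K, as s -> +oo.
   Covering this event by a staircase of rectangles reduces this to a bound on the
   sums over k <= i <= v/2 of l_mu(i) l_nu(v - i - 1), where v = ln s and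
   l(v) = e^(alpha v) P(. > e^v).  When the indices differ, the corresponding sums
   are geometric.  When they are equal, these l are regularly varying, of index
   different from -1: a finite moment of order alpha means that l is summable,
   hence v l(v) -> 0, while an infinite one forces the index to be > -1, so that by
   Karamata the partial sums of l up to v are O(v l(v)).  Each case follows by
   comparing l at points of [v/4, 4v]. *)

(** * Regularly varying functions *)

(** Pointwise convergence of l(av)/l(v) for each a does not by itself bound l on a window [v/4, 4v].
    What saves the comparison is one-sided: a tail is nonincreasing, so l grows by a factor at most
    e^(alpha h) over a step h, and this is enough for a Baire argument. The logarithmic scale is
    natural for two reasons. It turns the product into a sum, hence the convolution form of the
    staircase bound. It is also where slow variation of the tail becomes quantitative: [L (expR v)]
    has an index, and -1 is the border between summable and non-summable l. The staircase has steps
    of ratio e, so it loses a factor e^(2 alpha), which is harmless because the sums only have to be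
    small. The normalisation N is E[X^alpha] P(Y > s) + E[Y^alpha] P(X > s), or the dominant one of
    these two terms, so that P(XY > s) / N(s) tends to 1. The conditional law is then a quotient of
    two instances of the same limit, one for F and one for the constant 1. *)

Lemma near_pinfty_geP (R : realType) (Q : R -> Prop) :
  (\forall v \near +oo, Q v) <-> exists V : R, forall v : R, V <= v -> Q v.
Proof.
split=> [[M [_ MQ]]|[V VQ]].
  by exists (M + 1) => v Mv; apply: MQ; rewrite (lt_le_trans _ Mv)// ltrDl.
by exists V; split; [exact: num_real | move=> v /ltW; exact: VQ].
Qed.

Section slowly_increasing.
Context {R : realType} (l : R -> R) (alpha g V0 : R).
Hypothesis V0_ge0 : 0 <= V0.
Hypothesis l_gt0 : forall v : R, V0 <= v -> 0 < l v.
Hypothesis l_inc : forall w h : R, V0 <= w -> 0 <= h ->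
  l (w + h) <= expR (alpha * h) * l w.
Hypothesis l_rv : forall a : R, 0 < a -> l (a * v) / l v @[v --> +oo] --> a `^ g.

Lemma rv_ratio_near (a : R) : 0 < a -> forall e : R, 0 < e -> exists V : R, forall v : R, V <= v ->
  0 < l v /\ (a `^ g - e) * l v <= l (a * v) <= (a `^ g + e) * l v.
Proof.
move=> a0 e e0.
have /cvgrPdist_le/(_ _ e0) /near_pinfty_geP[V HV] := l_rv a a0.
exists (Num.max V V0) => v; rewrite ge_max => /andP[Vv V0v].
have lv := l_gt0 v V0v; split => //.
have := HV v Vv; rewrite ler_distlC => /andP[h1 h2].
by apply/andP; split; [rewrite -ler_pdivlMr//; lra|rewrite -ler_pdivrMr//; lra].
Qed.

(* The places where the ratio l (e^x v) / l v is large for some large v. *)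
Let E (n : nat) : set R := [set x | exists v : R, [/\ n%:R <= v, V0 <= v,
  V0 < expR x * v & n%:R * l v < l (expR x * v)]].

(** For fixed v, moving the argument down from [expR x * v] to [expR y * v] costs [l] at most a
    factor close to 1 when y is close to x. A strict inequality at x therefore persists on an
    interval to its left; [l_inc] gives no such control on the right. *)
Let E_left n x : E n x -> exists2 e : R, 0 < e & forall y : R, x - e < y < x -> E n y.
Proof.
move=> [v [nv V0v V0xv nl]].
(* For y <= x this is a lower bound for [l (expR y * v)] by [l_inc], and it is continuous in y,
   which [l] need not be. *)
pose phi y := expR (- (alpha * ((expR x - expR y) * v))) * l (expR x * v).
have phi_cont : {for x, continuous phi}.
  move=> /=; rewrite /phi; apply: cvgM; last exact: cvg_cst.
  apply: continuous_comp; last exact: continuous_expR.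
  apply: cvgN; apply: cvgM; first exact: cvg_cst.
  apply: cvgM; last exact: cvg_cst.
  by apply: cvgB; [exact: cvg_cst|exact: continuous_expR].
have phix : phi x = l (expR x * v) by rewrite /phi subrr mul0r mulr0 oppr0 expR0 mul1r.
have H1 : \forall y \near x, n%:R * l v < phi y.
  by move: nl; rewrite -phix => nl; exact: (@cvgr_gt R R (nbhs x) _ phi (phi x) phi_cont _ nl).
have H2 : \forall y \near x, V0 < expR y * v.
  have c2 : expR y * v @[y --> x] --> expR x * v.
    by apply: cvgM; [exact: continuous_expR|exact: cvg_cst].
  exact: (@cvgr_gt R R (nbhs x) _ _ _ c2).
have : \forall y \near x, n%:R * l v < phi y /\ V0 < expR y * v.
  exact: filterI.
move=> /nbhs_ballP[e /= e0 He].
exists e => // y /andP[y1 y2].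
have [|Hy1 Hy2] := He y; first by rewrite /ball/= ltr_distlC; apply/andP; split; lra.
exists v; split => //.
apply: (lt_le_trans Hy1); rewrite /phi.
rewrite -(@ler_pM2l _ (expR (alpha * ((expR x - expR y) * v)))) ?expR_gt0//.
rewrite [expR _ * (expR _ * _)]mulrA -expRD subrr expR0 mul1r.
have -> : expR x * v = expR y * v + (expR x - expR y) * v by ring.
apply: l_inc; first exact: ltW.
by apply: mulr_ge0; [rewrite subr_ge0 ler_expR ltW|exact: le_trans V0v].
Qed.

(* Otherwise the interiors of the sets [E n] are dense, and Baire's theorem gives
   a single x at which l (e^x v) / l v is unbounded as v grows. *)
Lemma rv_bounded_on_some_interval : exists n : nat, exists p q : R, p < q /\
  forall v y : R, n%:R <= v -> V0 <= v -> p <= y <= q -> V0 < expR y * v ->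
    l (expR y * v) <= n%:R * l v.
Proof.
apply: contrapT => H.
have Edense n : open ((E n)^°) /\ dense ((E n)^°).
  split; first exact: open_interior.
  move=> O [x0 Ox0] oO; apply: contrapT => OE; apply: H.
  have : nbhs x0 O by exact: open_nbhs_nbhs.
  move=> /nbhs_ballP[r /= r0 Hr].
  exists n, (x0 - r / 2), (x0 + r / 2); split; first by lra.
  move=> v y nv V0v /andP[y1 y2] V0y; rewrite leNgt; apply/negP => nl.
  have /E_left[e e0 He] : E n y by exists v.
  (* The interval of length d to the left of y lies in [E n]. Its midpoint is then interior to
     [E n], and d <= r / 2 keeps that midpoint in the ball inside O. *)
  pose d := Num.min e (r / 2).
  have d0 : 0 < d by rewrite lt_min e0 divr_gt0.
  have de : d <= e by rewrite ge_min lexx.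
  have dr : d <= r / 2 by rewrite ge_min lexx orbT.
  apply: OE; exists (y - d / 2); split.
    by apply: Hr; rewrite /ball/= ltr_distlC; apply/andP; split; lra.
  apply/nbhs_ballP; exists (d / 2) => /=; first by rewrite divr_gt0.
  move=> z; rewrite /ball/= ltr_distlC => /andP[z1 z2].
  by apply: He; apply/andP; split; lra.
have /(_ setT) [||x [_ Fx]] := @Baire R R^o (fun n => (E n)^°) Edense.
- by exists 0.
- exact: openT.
have [V HV] := rv_ratio_near (expR x) (expR_gt0 x) 1 ltr01.
(* [n.+1] exceeds both V and the eventual bound on the ratio at x, so x cannot belong to
   [E n.+1]. *)
pose n := Num.truncn (Num.max V (expR x `^ g + 1)).
have /interior_subset[v [nv V0v V0xv nl]] := Fx n.+1 I.
have hn := truncnS_gt (Num.max V (expR x `^ g + 1)).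
have Vv : V <= v by rewrite (le_trans _ nv)// (le_trans _ (ltW hn))// le_max lexx.
have [lv /andP[_ h]] := HV v Vv.
have : n.+1%:R * l v < (expR x `^ g + 1) * l v by exact: lt_le_trans h.
by rewrite ltr_pM2r// ltNge (le_trans _ (ltW hn))// le_max lexx orbT.
Qed.

(** The bound known on one interval [p, q] spreads over [A, B] by strips of length q - p: on each
    strip the ratio factors through [l (expR z * v)] for one fixed shift z, and pointwise
    convergence at z controls the second factor. *)
Lemma rv_uniform_bound (A B : R) : exists C V : R, [/\ 0 < C, V0 <= V & forall v y : R,
  V <= v -> A <= y <= B -> l (expR y * v) <= C * l v].
Proof.
have [n [p [q [pq Hn]]]] := rv_bounded_on_some_interval.
suff H k : exists C V : R, [/\ 0 < C, V0 <= V & forall v y : R,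
    V <= v -> A <= y <= A + k%:R * (q - p) -> l (expR y * v) <= C * l v].
  have := truncnS_gt ((B - A) / (q - p)); set k := Num.truncn _ => hk.
  have [C [V [C0 V0V HC]]] := H k.+1.
  exists C, V; split => // v y Vv /andP[Ay yB]; apply: HC => //.
  rewrite Ay/= (le_trans yB)// -lerBlDl -ler_pdivrMr ?subr_gt0//.
  exact: ltW.
elim: k => [|k [C [V [C0 V0V IH]]]].
  have [V HV] := rv_ratio_near (expR A) (expR_gt0 A) 1 ltr01.
  exists (expR A `^ g + 1), (Num.max V V0); split.
  - by rewrite ltr_wpDl// powR_ge0.
  - by rewrite le_max lexx orbT.
  - move=> v y; rewrite ge_max => /andP[Vv V0v].
    rewrite mul0r addr0 => yA; have -> : y = A by apply/eqP; rewrite eq_le andbC.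
    by have [_ /andP[]] := HV v Vv.
(* Translation by z carries [p, q] onto the next strip, from A + k (q - p) to A + (k + 1) (q -
   p). *)
pose z := A + k%:R * (q - p) - p.
have [Vz HVz] := rv_ratio_near (expR z) (expR_gt0 z) 1 ltr01.
pose Cz := expR z `^ g + 1.
have Cz0 : 0 < Cz by rewrite /Cz ltr_wpDl// powR_ge0.
(* The last three bounds make [expR z * v] at least n and at least V0, as [Hn] requires, and keep
   [expR y * v] strictly above V0 on the new strip. *)
pose V' := Num.max V (Num.max Vz (Num.max (n%:R / expR z)
  (Num.max (V0 / expR z) ((V0 + 1) / expR (A + k%:R * (q - p)))))).
exists (C + n%:R * Cz), V'; split.
- by rewrite ltr_wpDr// mulr_ge0// ltW.
- by rewrite /V' le_max V0V.
- move=> v y; rewrite /V' !ge_max => /and5P[Vv Vzv nv V0v V1v] /andP[Ay yA].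
  have lv : 0 < l v by apply: l_gt0; exact: le_trans Vv.
  have [yk|ky] := leP y (A + k%:R * (q - p)).
    apply: le_trans (IH v y Vv _) _; first by rewrite Ay yk.
    by rewrite ler_pM2r// lerDl mulr_ge0// ltW.
  have -> : expR y * v = expR (y - z) * (expR z * v).
    by rewrite mulrA -expRD subrK.
  have v0 : 0 <= v by rewrite (le_trans V0_ge0)// (le_trans V0V).
  apply: le_trans (Hn _ _ _ _ _ _) _.
  + by rewrite mulrC -ler_pdivrMr ?expR_gt0.
  + by rewrite mulrC -ler_pdivrMr ?expR_gt0.
  + rewrite /z; move: ky yA; rewrite -natr1 => ky yA; apply/andP; split; lra.
  + rewrite mulrA -expRD subrK.
    rewrite (@lt_le_trans _ _ (V0 + 1)) ?ltrDl//.
    rewrite (@le_trans _ _ (expR (A + k%:R * (q - p)) * v))//.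
      by rewrite mulrC -ler_pdivrMr ?expR_gt0.
    by rewrite ler_wpM2r// ler_expR ltW.
  + have [_ /andP[_ h]] := HVz v Vzv.
    apply: (@le_trans _ _ (n%:R * (Cz * l v))); first by rewrite ler_wpM2l.
    by rewrite mulrA ler_pM2r// lerDr ltW.
Qed.

End slowly_increasing.

(** * Sums over integer intervals *)

Lemma sum_nat_le_const (R : numDomainType) (m n : nat) (F : nat -> R) (c : R) :
  (forall i, (m <= i < n)%N -> F i <= c) ->
  \sum_(m <= i < n) F i <= (n - m)%:R * c.
Proof.
by move=> Fc; rewrite mulr_natl -sumr_const_nat; exact: ler_sum_nat.
Qed.

Lemma sum_nat_ge_const (R : numDomainType) (m n : nat) (F : nat -> R) (c : R) :
  (forall i, (m <= i < n)%N -> c <= F i) ->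
  (n - m)%:R * c <= \sum_(m <= i < n) F i.
Proof.
by move=> Fc; rewrite mulr_natl -sumr_const_nat; exact: ler_sum_nat.
Qed.

Lemma sum_nat_ge0 (R : numDomainType) (m n : nat) (F : nat -> R) :
  (forall i, (m <= i)%N -> 0 <= F i) -> 0 <= \sum_(m <= i < n) F i.
Proof. by move=> F0; rewrite big_nat sumr_ge0// => i /andP[/F0]. Qed.

Lemma le_sum_nat_r (R : numDomainType) (m n p : nat) (F : nat -> R) :
  (forall i, (m <= i)%N -> 0 <= F i) -> (n <= p)%N ->
  \sum_(m <= i < n) F i <= \sum_(m <= i < p) F i.
Proof.
move=> F0 np; have [mn|nm] := leqP m n.
  rewrite (big_cat_nat mn np)//= lerDl; apply: sum_nat_ge0 => i ni.
  by apply: F0; exact: leq_trans ni.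
by rewrite big_geq ?(ltnW nm)//; exact: sum_nat_ge0.
Qed.

Lemma le_sum_nat_l (R : numDomainType) (m m' n : nat) (F : nat -> R) :
  (forall i, (m <= i)%N -> 0 <= F i) -> (m <= m')%N ->
  \sum_(m' <= i < n) F i <= \sum_(m <= i < n) F i.
Proof.
move=> F0 mm; have [mn|nm] := leqP m' n.
  by rewrite (big_cat_nat mm mn)//= lerDr sum_nat_ge0.
by rewrite [leLHS]big_geq ?(ltnW nm)//; exact: sum_nat_ge0.
Qed.

(** Some partial sum is within e of the supremum of all of them, so the terms after it add at most
    e, whatever the upper end. *)
Lemma bounded_sum_tail (R : realType) (u : nat -> R) (m : nat) (B : R) :
  (forall j, (m <= j)%N -> 0 <= u j) ->
  (forall n, \sum_(m <= j < n) u j <= B) ->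
  forall e : R, 0 < e -> exists2 k, (m <= k)%N &
    forall k' n, (k <= k')%N -> \sum_(k' <= j < n) u j <= e.
Proof.
move=> u0 uB e e0.
pose S : set R := [set \sum_(m <= j < n) u j | n in setT].
have hS : has_sup S.
  by split; [exists (\sum_(m <= j < 0) u j); exists 0%N
            |exists B => _ [n _ <-]; exact: uB].
have [_ [n0 _ <-] hn0] := sup_adherent e0 hS.
pose k := maxn m n0; exists k; first exact: leq_maxl.
move=> k' n kk'; apply: (@le_trans _ _ (\sum_(k <= j < n) u j)).
  by apply: le_sum_nat_l => // i ki; rewrite u0// (leq_trans _ ki)// leq_maxl.
have [kn|nk] := leqP k n; last by rewrite big_geq ?(ltnW nk)// ltW.
have : \sum_(m <= j < n) u j <= sup S by apply: ub_le_sup; [exact: hS.2|exists n].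
rewrite (big_cat_nat (leq_maxl m n0) kn)/= => h.
have : \sum_(m <= j < n0) u j <= \sum_(m <= j < k) u j.
  by apply: le_sum_nat_r => //; exact: leq_maxr.
lra.
Qed.

(** Telescoping: [u j * (1 - q) <= u j - u j.+1]. *)
Lemma ratio_sum_bounded (R : realType) (u : nat -> R) (m : nat) (q : R) :
  q < 1 -> (forall j, (m <= j)%N -> 0 <= u j) ->
  (forall j, (m <= j)%N -> u j.+1 <= q * u j) ->
  forall n, \sum_(m <= j < n) u j <= u m / (1 - q).
Proof.
move=> q1 u0 uq n.
have H k : \sum_(m <= j < m + k) u j * (1 - q) <= u m - u (m + k)%N.
  elim: k => [|k IH]; first by rewrite addn0 big_geq// subrr.
  rewrite addnS big_nat_recr/= ?leq_addr//.
  have := uq (m + k)%N (leq_addr _ _); lra.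
rewrite ler_pdivlMr ?subr_gt0// mulr_suml.
apply: (le_trans _ (le_trans (H n) _)); last first.
  by rewrite lerBlDr lerDl u0// leq_addr.
apply: le_sum_nat_r; last exact: leq_addl.
by move=> i mi; rewrite mulr_ge0 ?u0// subr_ge0 ltW.
Qed.

Lemma gt1_ltr_powR (R : realType) (a x y : R) :
  1 < a -> x < y -> a `^ x < a `^ y.
Proof.
move=> a1 xy; rewrite /powR gt_eqF ?(lt_trans ltr01)//.
by rewrite ltr_expR ltr_pM2r// ln_gt0.
Qed.

(** * Comparison on windows and Karamata-type bounds *)

Section window.
Context {R : realType} (l : R -> R) (alpha g V0 : R).
Hypothesis V0_ge0 : 0 <= V0.
Hypothesis l_gt0 : forall v : R, V0 <= v -> 0 < l v.
Hypothesis l_inc : forall w h : R, V0 <= w -> 0 <= h ->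
  l (w + h) <= expR (alpha * h) * l w.
Hypothesis l_rv : forall a : R, 0 < a -> l (a * v) / l v @[v --> +oo] --> a `^ g.

(** The window is wider than a factor 2 on each side to absorb integer parts: the integer part of v
    / 2 exceeds v / 2 - 1, which is at least v / 4 as soon as v >= 4. *)
Lemma rv_window_bound : exists C V : R, [/\ 0 < C, V0 <= V, 4 <= V &
  forall v w : R, V <= v -> v / 4 <= w <= 4 * v -> l w <= C * l v].
Proof.
have [C [V [C0 V0V HC]]] :=
  @rv_uniform_bound R l alpha g V0 V0_ge0 l_gt0 l_inc l_rv (ln (1 / 4)) (ln 4).
exists C, (Num.max V 4); split => //.
- by rewrite le_max V0V.
- by rewrite le_max lexx orbT.
move=> v w; rewrite ge_max => /andP[Vv v4] /andP[w1 w2].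
have v0 : 0 < v by lra.
have w0 : 0 < w by rewrite (lt_le_trans _ w1)// divr_gt0.
have wv0 : 0 < w / v by rewrite divr_gt0.
have -> : w = expR (ln (w / v)) * v by rewrite lnK ?posrE// divfK// gt_eqF.
apply: HC => //; rewrite !ler_ln ?posrE//.
by rewrite ler_pdivlMr// ler_pdivrMr//; apply/andP; split; lra.
Qed.

(** Dyadic condensation: for g < -1 the quantity n l(n) shrinks by a factor below 1 each time n
    doubles, and the block [n, 2n) contributes at most a constant times its value at 2n. *)
Lemma rv_lt_sum_bounded : g < -1 -> exists B : R, exists m : nat,
  V0 <= m%:R /\ forall n, \sum_(m <= j < n) l j%:R <= B.
Proof.
move=> g1; have [C [V [C0 V0V V4 HC]]] := rv_window_bound.
have t2 : 2 `^ g < 2^-1 :> R.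
  have -> : 2^-1 = 2 `^ (-1) :> R by rewrite powR_inv1.
  by apply: gt1_ltr_powR => //; rewrite ltr1n.
(* Twice the midpoint between 2^g and 1/2, hence below 1; it bounds U (2n) / U n once l (2n) / l n
   is below that midpoint. *)
pose th : R := 2 `^ g + 2^-1.
have th1 : th < 1 by rewrite /th; lra.
have th0 : 0 < th by rewrite /th ltr_wpDl// powR_ge0.
have e0 : (0 : R) < (2^-1 - 2 `^ g) / 2 by lra.
have [W HW] := @rv_ratio_near R l g V0 l_gt0 l_rv 2 (ltr0Sn _ 1) _ e0.
pose m := (Num.truncn (Num.max V W)).+1.
have Mm : Num.max V W < m%:R by exact: truncnS_gt.
have Vm : V <= m%:R by rewrite (le_trans _ (ltW Mm))// le_max lexx.
have Wm : W <= m%:R by rewrite (le_trans _ (ltW Mm))// le_max lexx orbT.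
have V0m : V0 <= m%:R by exact: le_trans Vm.
have l0 j : (m <= j)%N -> 0 <= l j%:R.
  by move=> mj; rewrite ltW// l_gt0// (le_trans V0m)// ler_nat.
(* The solution of (C + D) th = D. With it, [S n + D * U n] does not increase when n doubles. *)
pose D := C * th / (1 - th).
have D0 : 0 < D by rewrite divr_gt0 ?mulr_gt0// subr_gt0.
have DE : (C + D) * th <= D.
  rewrite /D; have h : 1 - th != 0 by rewrite subr_eq0 gt_eqF.
  suff -> : (C + C * th / (1 - th)) * th = C * th / (1 - th) by [].
  by field.
pose U (n : nat) := n%:R * l n%:R.
pose S (n : nat) := \sum_(m <= j < n) l j%:R.
have step k : S (m * 2 ^ k)%N + D * U (m * 2 ^ k)%N <= D * U m.
  elim: k => [|k IH]; first by rewrite expn0 muln1 /S big_geq// add0r.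
  apply: le_trans IH; set n := (m * 2 ^ k)%N.
  have mn : (m <= n)%N by rewrite leq_pmulr// expn_gt0.
  have -> : (m * 2 ^ k.+1 = n.*2)%N by rewrite expnS mulnCA -mul2n.
  have nn : (n <= n.*2)%N by rewrite -addnn leq_addr.
  have Wn : W <= n%:R by rewrite (le_trans Wm)// ler_nat.
  have Vn : V <= n%:R by rewrite (le_trans Vm)// ler_nat.
  have n0 : 0 <= n%:R :> R by [].
  have n2 : n.*2%:R = 2 * n%:R :> R by rewrite -mul2n natrM.
  have SS : S n.*2 <= S n + C * U n.*2.
    rewrite /S (big_cat_nat mn nn)/= lerD2l.
    apply: (@le_trans _ _ ((n.*2 - n)%:R * (C * l n.*2%:R))).
      apply: sum_nat_le_const => j /andP[nj jn]; apply: HC.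
        by rewrite (le_trans Vn)// ler_nat.
      rewrite n2; have : n%:R <= j%:R :> R by rewrite ler_nat.
      have : j%:R <= n.*2%:R :> R by rewrite ler_nat ltnW.
      by rewrite n2 => h1 h2; apply/andP; split; lra.
    have ln2 : 0 <= l n.*2%:R by apply: l0; exact: leq_trans nn.
    rewrite /U -addnn addnK addnn mulrCA ler_wpM2l ?(ltW C0)// ler_wpM2r//.
    by rewrite ler_nat.
  have UU : U n.*2 <= th * U n.
    have [ln /andP[_ h]] := HW n%:R Wn.
    rewrite /U n2; apply: (@le_trans _ _ (2 * n%:R * ((2 `^ g + (2^-1 - 2 `^ g) / 2) * l n%:R))).
      by rewrite ler_wpM2l// mulr_ge0.
    by rewrite /th; lra.
  have Un0 : 0 <= U n by rewrite mulr_ge0// l0.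
  have := ler_wpM2l (ltW (addr_gt0 C0 D0)) UU.
  have := ler_wpM2r Un0 DE.
  lra.
exists (D * U m), m; split => // n.
have : S n <= S (m * 2 ^ n)%N.
  apply: le_sum_nat_r => //; apply: (leq_trans (ltnW (ltn_expl n (ltnSn 1)))).
  by rewrite leq_pmull.
move/le_trans; apply; apply: le_trans (step n); rewrite lerDl.
rewrite mulr_ge0 ?(ltW D0)// mulr_ge0// l0//.
by rewrite leq_pmulr// expn_gt0.
Qed.

(* Karamata's theorem: the sum over the upper half of [0, v] is O(v l(v)), and
   v l(v) grows by a factor bounded away from 1 when v doubles. *)
Lemma rv_gt_sum_le : - 1 < g -> exists D V : R, exists m : nat,
  [/\ 0 < D, V0 <= m%:R, m%:R <= V & forall v, V <= v ->
  \sum_(m <= j < Num.truncn v) l j%:R <= D * (v * l v)].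
Proof.
move=> g1; have [C [V [C0 V0V V4 HC]]] := rv_window_bound.
have t2 : 2^-1 `^ g < 2 :> R.
  have -> : 2^-1 `^ g = 2 `^ (- g) :> R by rewrite -powR_inv1// -powRrM mulN1r.
  rewrite -[ltRHS]powRr1//; apply: gt1_ltr_powR; last lra.
  by rewrite ltr1n.
(* Half the midpoint between (1/2)^g and 2: it bounds the ratio of (v / 2) l(v / 2) to v l(v) for
   large v, and is below 1 because g > -1. *)
pose th : R := (2^-1 `^ g + 2) / 4.
have th1 : th < 1 by rewrite /th; lra.
have e0 : (0 : R) < (2 - 2^-1 `^ g) / 2 by lra.
have i20 : (0 : R) < 2^-1 by rewrite invr_gt0.
have [W HW] := @rv_ratio_near R l g V0 l_gt0 l_rv 2^-1 i20 _ e0.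
pose m := (Num.truncn V).+1.
have Vm : V <= m%:R by rewrite ltW// truncnS_gt.
have V0m : V0 <= m%:R by exact: le_trans Vm.
have l0 j : (m <= j)%N -> 0 <= l j%:R.
  by move=> mj; rewrite ltW// l_gt0// (le_trans V0m)// ler_nat.
pose S (v : R) := \sum_(m <= j < Num.truncn v) l j%:R.
pose X := Num.max (m%:R + 1) (2 * W).
have mX : m%:R + 1 <= X by rewrite le_max lexx.
have WX : 2 * W <= X by rewrite le_max lexx orbT.
clearbody X.
have m0 : (0 : R) <= m%:R by [].
have VX : V <= X by lra.
have X0 : 0 < X by lra.
have lX : 0 < l (2 * X) by apply: l_gt0; lra.
have SX : 0 <= S (2 * X) by exact: sum_nat_ge0.
(* The first summand settles the base range X <= v <= 2X, where S v <= S (2X) and l (2X) <= C l v.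
   The second gives D th + C <= D, which is what passing from v / 2 to v consumes. *)
pose D := C * S (2 * X) / (X * l (2 * X)) + C / (1 - th).
have th1' : 0 < 1 - th by rewrite subr_gt0.
have D1 : 0 <= C * S (2 * X) / (X * l (2 * X)).
  by rewrite divr_ge0// mulr_ge0// ltW.
have D2 : 0 < C / (1 - th) by rewrite divr_gt0.
have D0 : 0 < D by rewrite /D; lra.
have Dth : D * th + C <= D.
  suff : C <= D * (1 - th) by rewrite mulrBr mulr1; lra.
  rewrite -ler_pdivrMr//; rewrite /D; lra.
have DS : C * S (2 * X) / (X * l (2 * X)) <= D by rewrite /D lerDl ltW.
clearbody D.
exists D, X, m; split => //; first by lra.
(* Induction on the number of halvings that bring v down to the base range; [(Num.truncn v).+1] of
   them always suffice, since v < 2^k for that k and 2X >= 1. *)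
suff H k v : X <= v -> v <= 2 ^+ k * (2 * X) -> S v <= D * (v * l v).
  move=> v Xv; apply: (H (Num.truncn v).+1) => //.
  have h : v < (Num.truncn v).+1%:R by exact: truncnS_gt.
  have h2 : ((Num.truncn v).+1%:R : R) <= 2 ^+ (Num.truncn v).+1.
    by rewrite -natrX ler_nat ltnW// ltn_expl.
  rewrite (le_trans (ltW h))// (le_trans h2)// ler_peMr ?exprn_ge0//; lra.
elim: k v => [|k IH] v Xv.
  rewrite expr0 mul1r => vX.
  have lv : l (2 * X) <= C * l v by apply: HC; [lra|apply/andP; split; lra].
  have lv0 : 0 < l v by apply: l_gt0; lra.
  have SS : S v <= S (2 * X).
    by apply: le_sum_nat_r => //; apply: le_truncn.
  apply: le_trans SS _.
  apply: (@le_trans _ _ (C * S (2 * X) / (X * l (2 * X)) * (v * l v))).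
    rewrite mulrAC ler_pdivlMr ?mulr_gt0//.
    rewrite [C * _]mulrC -mulrA ler_wpM2l//.
    rewrite mulrCA; apply: ler_pM => //; exact: ltW.
  by rewrite ler_pM2r// mulr_gt0//; lra.
have [vX _|Xv2] := leP v (2 * X).
  by apply: IH => //; rewrite (le_trans vX)// ler_peMl ?exprn_ege1//; lra.
rewrite exprS => vk.
have v0 : 0 < v by lra.
have lv0 : 0 < l v by apply: l_gt0; lra.
have IHv : S (v / 2) <= D * (v / 2 * l (v / 2)) by apply: IH; lra.
have Wv : W <= v by lra.
have [_ /andP[_ h]] := HW v Wv.
have mv : (m <= Num.truncn (v / 2))%N by rewrite truncn_ge_nat; lra.
have vv : (Num.truncn (v / 2) <= Num.truncn v)%N by apply: le_truncn; lra.
rewrite /S (big_cat_nat mv vv)/= -/(S (v / 2)).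
have block : \sum_(Num.truncn (v / 2) <= j < Num.truncn v) l j%:R <= v * (C * l v).
  apply: (@le_trans _ _ ((Num.truncn v - Num.truncn (v / 2))%:R * (C * l v))).
    apply: sum_nat_le_const => j /andP[j1 j2]; apply: HC; first lra.
    have h1 : v / 2 < j%:R + 1.
      by rewrite natr1 (lt_le_trans (truncnS_gt _))// ler_nat ltnS.
    have h2 : j%:R <= v.
      have jt : (j%:R : R) <= (Num.truncn v)%:R by rewrite ler_nat ltnW.
      by apply: (le_trans jt); rewrite truncn_le ltW.
    by apply/andP; split; lra.
  apply: ler_wpM2r; first by rewrite mulr_ge0// ltW.
  apply: (@le_trans _ _ (Num.truncn v)%:R); first by rewrite ler_nat leq_subr.
  by rewrite truncn_le ltW.
have : v / 2 * l (v / 2) <= th * (v * l v).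
  have -> : v / 2 * l (v / 2) = v / 2 * l (2^-1 * v) by rewrite [2^-1 * v]mulrC.
  apply: (@le_trans _ _ (v / 2 * ((2^-1 `^ g + (2 - 2^-1 `^ g) / 2) * l v))).
    by rewrite ler_wpM2l// divr_ge0// ltW.
  by rewrite /th; lra.
move=> /(ler_wpM2l (ltW D0)) h3.
have := ler_wpM2r (ltW (mulr_gt0 v0 lv0)) Dth.
rewrite mulrDl -mulrA; apply: le_trans; apply: lerD; first exact: le_trans h3.
by rewrite mulrCA.
Qed.

(** With t the integer part of v, the block [t, 2t) has t terms, each at least l(v) / C, and its sum
    is a remainder of a convergent series; v <= 2t concludes. *)
Lemma rv_cvg_mul0 (m : nat) (B : R) :
  V0 <= m%:R -> (forall n, \sum_(m <= j < n) l j%:R <= B) ->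
  forall e : R, 0 < e -> exists V : R, forall v, V <= v -> v * l v <= e.
Proof.
move=> V0m lB e e0; have [C [V [C0 V0V V4 HC]]] := rv_window_bound.
have l0 j : (m <= j)%N -> 0 <= l j%:R.
  by move=> mj; rewrite ltW// l_gt0// (le_trans V0m)// ler_nat.
have [k mk Hk] := @bounded_sum_tail R (fun j => l j%:R) m B l0 lB
  (e / (2 * C)) (divr_gt0 e0 (mulr_gt0 (ltr0Sn _ 1) C0)).
exists (Num.max (V + 1) k%:R) => v; rewrite ge_max => /andP[Vv kv].
pose t := Num.truncn v.
have v0 : 0 <= v by lra.
have kt : (k <= t)%N by rewrite truncn_ge_nat.
have tv : t%:R <= v by rewrite truncn_le.
have vt : v < t%:R + 1 by rewrite natr1 truncnS_gt.
have := Hk t (t + t)%N kt.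
have : (t + t - t)%:R * (l v / C) <= \sum_(t <= j < t + t) l j%:R.
  apply: sum_nat_ge_const => j /andP[tj jt].
  have tj' : (t%:R : R) <= j%:R by rewrite ler_nat.
  have jt' : (j%:R : R) <= t%:R + t%:R by rewrite -natrD ler_nat ltnW.
  by rewrite ler_pdivrMr// mulrC; apply: HC; [lra|apply/andP; split; lra].
rewrite addnK => h1 h2; have {h1 h2} := le_trans h1 h2.
rewrite mulrA ler_pdivrMr//.
have -> : e / (2 * C) * C = e / 2 by field; rewrite gt_eqF.
have lv : 0 <= l v by rewrite ltW// l_gt0//; lra.
have : v * l v <= (2 * t%:R) * l v by apply: ler_wpM2r => //; lra.
lra.
Qed.

End window.

(** * Sums over the staircase *)

Section distinct_indices.
Context {R : realType} (g h : R -> R) (b c v0 : R).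
Hypothesis bc : b < c.
Hypothesis g_gt0 : forall v : R, 0 < g v.
Hypothesis h_ge0 : forall v : R, 0 <= h v.
Hypothesis g_ni : forall v w : R, v <= w -> g w <= g v.
Hypothesis h_ni : forall v w : R, v <= w -> h w <= h v.
Hypothesis g_step : forall v : R, v0 <= v -> g v <= expR b * g (v + 1).
Hypothesis h_step : forall v : R, v0 <= v -> h (v + 1) <= expR (- c) * h v.

Lemma slow_decay_iter (n : nat) (v : R) : v0 <= v -> g v <= expR (b * n%:R) * g (v + n%:R).
Proof.
move=> v0v; elim: n => [|n IH]; first by rewrite mulr0 expR0 mul1r addr0.
apply: (le_trans IH).
rewrite -[in leRHS]natr1 mulrDr mulr1 expRD -mulrA ler_wpM2l ?expR_ge0//.
by rewrite addrA; apply: g_step; rewrite (le_trans v0v)// lerDl.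
Qed.

Lemma fast_decay_iter (n : nat) (v : R) : v0 <= v -> h (v + n%:R) <= expR (- (c * n%:R)) * h v.
Proof.
move=> v0v; elim: n => [|n IH]; first by rewrite mulr0 oppr0 expR0 mul1r addr0.
rewrite -natr1 addrA; apply: (le_trans (h_step _ _)).
  by rewrite (le_trans v0v)// lerDl.
have -> : - (c * (n%:R + 1)) = - c + - (c * n%:R) by ring.
by rewrite expRD -mulrA ler_wpM2l ?expR_ge0.
Qed.

(** Iterating the one-step bounds from a point of [v0, v0 + 1] makes h / g decay at least like
    e^(-(c - b) n) after n steps. *)
Lemma tail_negligible (e : R) : 0 < e ->
  exists V : R, forall v : R, V <= v -> h v <= e * g v.
Proof.
move=> e0; pose r := h v0 / g (v0 + 1).
have r0 : 0 <= r by rewrite divr_ge0// ltW.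
(* From n >= r / (e (c - b)) follows r <= e expR ((c - b) n), because expR x >= x. *)
pose n0 := (Num.truncn (r / (e * (c - b)))).+1.
exists (v0 + n0%:R) => v Vv.
pose n := Num.truncn (v - v0); pose w := v - n%:R.
have vv0 : 0 <= v - v0 by rewrite subr_ge0 (le_trans _ Vv)// lerDl.
have nv : n%:R <= v - v0 by rewrite truncn_le.
have vn : v - v0 < n%:R + 1 by rewrite natr1 truncnS_gt.
have v0w : v0 <= w by rewrite /w; lra.
have wv0 : w <= v0 + 1 by rewrite /w; lra.
have n0n : (n0 <= n)%N by rewrite truncn_ge_nat// lerBrDl.
have wn : v = w + n%:R by rewrite /w subrK.
have h1 : h v <= expR (- (c * n%:R)) * h v0.
  rewrite wn; apply: le_trans (fast_decay_iter n w v0w) _.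
  by rewrite ler_wpM2l ?expR_ge0// h_ni.
have h2 : g (v0 + 1) <= expR (b * n%:R) * g v.
  by rewrite [in leRHS]wn; apply: le_trans (slow_decay_iter n w v0w); exact: g_ni.
have h3 : r <= e * expR ((c - b) * n%:R).
  have : r / (e * (c - b)) <= n%:R.
    by rewrite (le_trans (ltW (truncnS_gt _)))// ler_nat.
  have cb : 0 < c - b by rewrite subr_gt0.
  rewrite ler_pdivrMr ?mulr_gt0// => /le_trans; apply.
  rewrite mulrCA ler_wpM2l ?(ltW e0)// mulrC.
  by rewrite (le_trans _ (expR_ge1Dx _))// lerDr.
apply: (le_trans h1).
have -> : h v0 = r * g (v0 + 1) by rewrite divfK// gt_eqF.
apply: (@le_trans _ _ (expR (- (c * n%:R)) * ((e * expR ((c - b) * n%:R)) *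
    (expR (b * n%:R) * g v)))).
  by rewrite ler_wpM2l ?expR_ge0// ler_pM// ltW.
have -> : expR (- (c * n%:R)) * ((e * expR ((c - b) * n%:R)) * (expR (b * n%:R) * g v))
  = e * g v * (expR (- (c * n%:R)) * expR ((c - b) * n%:R) * expR (b * n%:R)) by ring.
rewrite -!expRD (_ : _ + _ + _ = 0) ?expR0 ?mulr1//; ring.
Qed.

(** Raising the threshold of the fast tail alone is enough. In the sum, g (v - j - 1) is at most
    expR (b (j + 1)) g v, and h j expR (b j) decays geometrically since b < c. The leftover
    rectangle g k h J has J within a bounded distance of v, where h is negligible against g. *)
Lemma both_large_distinct (e : R) : 0 < e -> exists (k : nat) (V : R), forall v : R, V <= v ->
  exists J : nat, (k <= J)%N /\
    \sum_(k <= j < J) h j%:R * g (v - j%:R - 1) + g k%:R * h J%:R <= e * g v.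
Proof.
move=> e0.
pose m := (Num.truncn v0).+1.
have v0m : v0 <= m%:R by rewrite ltW// truncnS_gt.
pose u (j : nat) := h j%:R * expR (b * j%:R).
have u0 j : (m <= j)%N -> 0 <= u j by move=> _; rewrite mulr_ge0// expR_ge0.
have u_ratio j : (m <= j)%N -> u j.+1 <= expR (b - c) * u j.
  move=> mj; rewrite /u -natr1 mulrDr mulr1 !expRD expRN.
  have v0j : v0 <= j%:R by rewrite (le_trans v0m)// ler_nat.
  have := ler_wpM2r (mulr_ge0 (expR_ge0 (b * j%:R)) (expR_ge0 b)) (h_step j%:R v0j).
  by rewrite expRN => /le_trans; apply; rewrite le_eqVlt; apply/orP; left; apply/eqP; ring.
have q1 : expR (b - c) < 1 by rewrite -expR0 ltr_expR subr_lt0.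
have uB := ratio_sum_bounded _ _ _ _ q1 u0 u_ratio.
have e1 : 0 < e / (2 * expR b) by rewrite divr_gt0// mulr_gt0// expR_gt0.
have [k mk Hk] := bounded_sum_tail _ _ _ _ u0 uB _ e1.
(* J > v - p, so h J <= h (v - p), and p steps of slow decay then lead from g (v - p) back to g
   v. *)
pose p := m.+1.
have e2 : 0 < e / (2 * g k%:R * expR (b * p%:R)).
  by rewrite divr_gt0// !mulr_gt0// expR_gt0.
have [W HW] := tail_negligible _ e2.
exists k, (Num.max (W + p%:R) (m%:R + 1 + k%:R)) => v; rewrite ge_max => /andP[Wv kv].
(* Stopping m short of v keeps v - j - 1 above v0 for every j < J, where the one-step bound on g is
   available. *)
pose J := Num.truncn (v - m%:R).
have vm : 0 <= v - m%:R by rewrite subr_ge0 (le_trans _ kv)// -addrA lerDl.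
have Jv : J%:R <= v - m%:R by rewrite truncn_le.
have vJ : v - m%:R < J%:R + 1 by rewrite natr1 truncnS_gt.
have kJ : (k <= J)%N by rewrite truncn_ge_nat//; lra.
exists J; split => //.
have mk' : (m%:R : R) <= k%:R by rewrite ler_nat.
have S1 : \sum_(k <= j < J) h j%:R * g (v - j%:R - 1) <= e / 2 * g v.
  apply: (@le_trans _ _ (\sum_(k <= j < J) u j * (expR b * g v))).
    apply: ler_sum_nat => j /andP[kj jJ].
    rewrite /u -mulrA ler_wpM2l// mulrA -expRD.
    have jJ' : (j.+1%:R : R) <= J%:R by rewrite ler_nat.
    have -> : b * j%:R + b = b * j.+1%:R by rewrite -natr1; ring.
    have -> : v - j%:R - 1 = v - j.+1%:R by rewrite -natr1; ring.
    have {2}-> : v = v - j.+1%:R + j.+1%:R by rewrite subrK.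
    by apply: slow_decay_iter; lra.
  rewrite -mulr_suml mulrA ler_pM2r//.
  have := Hk k J (leqnn k); rewrite ler_pdivlMr ?mulr_gt0 ?expR_gt0//; lra.
have S2 : g k%:R * h J%:R <= e / 2 * g v.
  have p1 : (p%:R : R) = m%:R + 1 by rewrite natr1.
  have hJ : h J%:R <= h (v - p%:R) by apply: h_ni; lra.
  have hW := HW (v - p%:R); have {}hW := hW ltac:(lra).
  have := slow_decay_iter p (v - p%:R); rewrite subrK => gp; have {}gp := gp ltac:(lra).
  apply: (@le_trans _ _ (g k%:R * (e / (2 * g k%:R * expR (b * p%:R)) * (expR (b * p%:R) * g v)))).
    rewrite ler_wpM2l ?(ltW (g_gt0 _))// (le_trans hJ)// (le_trans hW)//.
    by rewrite ler_wpM2l// ltW.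
  rewrite le_eqVlt; apply/orP; left; apply/eqP; field.
  by rewrite !gt_eqF// expR_gt0.
lra.
Qed.

End distinct_indices.

(* For j <= v/2 the point v - j - 1 stays in [v/4, 4v], so l2 may be replaced there
   by l2 v. *)
Lemma half_convolution_le (R : realType) (l1 l2 : R -> R) (m : nat) (B C V : R) :
  (forall j, (m <= j)%N -> 0 <= l1 j%:R) ->
  (forall n, \sum_(m <= j < n) l1 j%:R <= B) ->
  0 < C -> 4 <= V -> (forall v, V <= v -> 0 <= l2 v) ->
  (forall v w, V <= v -> v / 4 <= w <= 4 * v -> l2 w <= C * l2 v) ->
  forall e : R, 0 < e -> exists2 k, (m <= k)%N & forall k' v, (k <= k')%N -> V <= v ->
    \sum_(k' <= j < Num.truncn (v / 2)) l1 j%:R * l2 (v - j%:R - 1) <= e * l2 v.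
Proof.
move=> l10 l1B C0 V4 l20 l2C e e0.
have [k mk Hk] := bounded_sum_tail _ _ _ _ l10 l1B _ (divr_gt0 e0 C0).
exists k => // k' v kk' Vv.
apply: (@le_trans _ _ (\sum_(k' <= j < Num.truncn (v / 2)) l1 j%:R * (C * l2 v))).
  apply: ler_sum_nat => j /andP[kj jJ].
  apply: ler_wpM2l; first by apply: l10; exact: leq_trans (leq_trans mk kk') kj.
  have jJ' : (j%:R + 1 : R) <= v / 2.
    rewrite natr1 (@le_trans _ _ (Num.truncn (v / 2))%:R) ?ler_nat//.
    by rewrite truncn_le divr_ge0//; lra.
  have j0 : (0 : R) <= j%:R by [].
  by apply: l2C => //; apply/andP; split; lra.
rewrite -mulr_suml mulrA; apply: ler_wpM2r; first exact: l20.
by rewrite -ler_pdivlMr//; exact: Hk.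
Qed.

(* Properties of l v = e^(alpha v) P(X > e^v); the growth bound comes from the
   monotonicity of the tail. *)
Definition log_slow (R : realType) (alpha g V0 : R) (l : R -> R) : Prop :=
  [/\ 0 <= V0, forall v : R, V0 <= v -> 0 < l v,
    forall w h : R, V0 <= w -> 0 <= h -> l (w + h) <= expR (alpha * h) * l w &
    forall a : R, 0 < a -> l (a * v) / l v @[v --> +oo] --> a `^ g].

(** * Tails with equal indices *)

Section equal_indices.
Context {R : realType} (l1 l2 : R -> R) (alpha g1 g2 V1 V2 : R).
Hypothesis l1P : log_slow R alpha g1 V1 l1.
Hypothesis l2P : log_slow R alpha g2 V2 l2.

(** The point J is in the window of v, so l2 J is at most a multiple of l2 v, while l1 J <= J l1 J
    tends to 0 by summability. *)
Lemma summable_middle_term (m : nat) (B : R) :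
  V1 <= m%:R -> (forall n, \sum_(m <= j < n) l1 j%:R <= B) ->
  forall e : R, 0 < e -> exists V : R, forall v, V <= v ->
    l1 (Num.truncn (v / 2))%:R * l2 (Num.truncn (v / 2))%:R <= e * l2 v.
Proof.
move=> V1m l1B e e0.
have [V10 l10 l1i l1r] := l1P; have [V20 l20 l2i l2r] := l2P.
have [C [V [C0 V2V V4 HC]]] := rv_window_bound _ _ _ _ V20 l20 l2i l2r.
have [W HW] := rv_cvg_mul0 _ _ _ _ V10 l10 l1i l1r m B V1m l1B _ (divr_gt0 e0 C0).
exists (Num.max V (2 * (Num.max W V1 + 1))) => v.
rewrite ge_max => /andP[Vv]; set J := Num.truncn _ => Wv.
have v20 : 0 <= v / 2 by lra.
have Jv : J%:R <= v / 2 by rewrite truncn_le.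
have vJ : v / 2 < J%:R + 1 by rewrite natr1 truncnS_gt.
have mJ : Num.max W V1 <= J%:R by lra.
have WJ : W <= J%:R by rewrite (le_trans _ mJ)// le_max lexx.
have V1J : V1 <= J%:R by rewrite (le_trans _ mJ)// le_max lexx orbT.
have J1 : (1 : R) <= J%:R.
  have J0 : (0 : R) < J%:R by lra.
  by rewrite ler1n; rewrite ltr0n in J0.
have lJ : l1 J%:R <= e / C.
  apply: (le_trans _ (HW _ WJ)); rewrite ler_peMl// ltW//; exact: l10.
have l2J : l2 J%:R <= C * l2 v by apply: HC => //; apply/andP; split; lra.
have l2v : 0 < l2 v by apply: l20; exact: le_trans Vv.
have l1J : 0 <= l1 J%:R by rewrite ltW// l10.
apply: (@le_trans _ _ (l1 J%:R * (C * l2 v))); first exact: ler_wpM2l.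
rewrite mulrA ler_wpM2r ?(ltW l2v)//.
by rewrite -ler_pdivlMr.
Qed.

Lemma both_large_summable (m1 m2 : nat) (B1 B2 : R) :
  V1 <= m1%:R -> (forall n, \sum_(m1 <= j < n) l1 j%:R <= B1) ->
  V2 <= m2%:R -> (forall n, \sum_(m2 <= j < n) l2 j%:R <= B2) ->
  forall e : R, 0 < e -> exists (k : nat) (V : R), forall v, V <= v ->
    \sum_(k <= i < Num.truncn (v / 2)) l1 i%:R * l2 (v - i%:R - 1) +
    \sum_(k <= j < Num.truncn (v / 2)) l2 j%:R * l1 (v - j%:R - 1) +
    l1 (Num.truncn (v / 2))%:R * l2 (Num.truncn (v / 2))%:R <= e * (l1 v + l2 v).
Proof.
move=> V1m l1B V2m l2B e e0.
have [V10 l10 l1i l1r] := l1P; have [V20 l20 l2i l2r] := l2P.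
have [C1 [W1 [C10 VW1 W14 HC1]]] := rv_window_bound _ _ _ _ V10 l10 l1i l1r.
have [C2 [W2 [C20 VW2 W24 HC2]]] := rv_window_bound _ _ _ _ V20 l20 l2i l2r.
have l1n j : (m1 <= j)%N -> 0 <= l1 j%:R.
  by move=> mj; rewrite ltW// l10// (le_trans V1m)// ler_nat.
have l2n j : (m2 <= j)%N -> 0 <= l2 j%:R.
  by move=> mj; rewrite ltW// l20// (le_trans V2m)// ler_nat.
have l1v v : W1 <= v -> 0 <= l1 v by move=> Wv; rewrite ltW// l10// (le_trans VW1).
have l2v v : W2 <= v -> 0 <= l2 v by move=> Wv; rewrite ltW// l20// (le_trans VW2).
have e20 : 0 < e / 2 by rewrite divr_gt0.
have [k1 mk1 H1] := half_convolution_le _ l1 l2 m1 B1 C2 W2 l1n l1B C20 W24 l2v HC2 _ e20.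
have [k2 mk2 H2] := half_convolution_le _ l2 l1 m2 B2 C1 W1 l2n l2B C10 W14 l1v HC1 _ e0.
have [W3 H3] := summable_middle_term m1 B1 V1m l1B _ e20.
exists (maxn k1 k2), (Num.max W1 (Num.max W2 W3)) => v.
rewrite !ge_max => /and3P[Wv1 Wv2 Wv3].
have := H1 _ v (leq_maxl k1 k2) Wv2; have := H2 _ v (leq_maxr k1 k2) Wv1.
have := H3 v Wv3; lra.
Qed.

Section one_summable.
Variables (m : nat) (B : R).
Hypothesis V1m : V1 <= m%:R.
Hypothesis l1B : forall n, \sum_(m <= j < n) l1 j%:R <= B.
Hypothesis g2_gt : - 1 < g2.

(** v l1(v) tends to 0, whereas v l2(v) stays away from 0: by Karamata it dominates, up to a
    constant, partial sums of l2 that contain a fixed positive term. *)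
Lemma summable_negligible (e : R) : 0 < e ->
  exists V : R, forall v, V <= v -> l1 v <= e * l2 v.
Proof.
move=> e0.
have [V10 l10 l1i l1r] := l1P; have [V20 l20 l2i l2r] := l2P.
have [D [V [n [D0 Vn nV HD]]]] := rv_gt_sum_le _ _ _ _ V20 l20 l2i l2r g2_gt.
have l2n : 0 < l2 n%:R by exact: l20.
have [W HW] := rv_cvg_mul0 _ _ _ _ V10 l10 l1i l1r m B V1m l1B _
  (mulr_gt0 e0 (divr_gt0 l2n D0)).
exists (Num.max (V + 1) (Num.max W (n%:R + 1))) => v.
rewrite !ge_max => /and3P[Vv Wv nv].
have n0 : (0 : R) <= n%:R by [].
have v0 : 0 < v by lra.
have nt : (n < Num.truncn v)%N.
  by rewrite truncn_ge_nat ?(ltW v0)// -natr1.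
have h : l2 n%:R <= D * (v * l2 v).
  apply: le_trans (HD v _); last lra.
  rewrite big_ltn// lerDl; apply: sum_nat_ge0 => i ni.
  by rewrite ltW// l20// (le_trans Vn)// ler_nat ltnW.
rewrite -(ler_pM2l v0); apply: (le_trans (HW v Wv)).
rewrite [leRHS]mulrCA ler_wpM2l ?(ltW e0)// ler_pdivrMr//.
by rewrite mulrC.
Qed.

(** The delicate sum is the second one, where the partial sums of l2 may grow without bound. They
    are O(v l2(v)) by Karamata, and the other factor is at most a constant times l1(v), so v l1(v)
    -> 0 pays for the growth. *)
Lemma both_large_one_summable (e : R) : 0 < e ->
  exists (k : nat) (V : R), forall v, V <= v ->
    \sum_(k <= i < Num.truncn (v / 2)) l1 i%:R * l2 (v - i%:R - 1) +
    \sum_(k <= j < Num.truncn (v / 2)) l2 j%:R * l1 (v - j%:R - 1) +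
    l1 (Num.truncn (v / 2))%:R * l2 (Num.truncn (v / 2))%:R <= e * l2 v.
Proof.
move=> e0.
have [V10 l10 l1i l1r] := l1P; have [V20 l20 l2i l2r] := l2P.
have [C1 [W1 [C10 VW1 W14 HC1]]] := rv_window_bound _ _ _ _ V10 l10 l1i l1r.
have [C2 [W2 [C20 VW2 W24 HC2]]] := rv_window_bound _ _ _ _ V20 l20 l2i l2r.
have l1n j : (m <= j)%N -> 0 <= l1 j%:R.
  by move=> mj; rewrite ltW// l10// (le_trans V1m)// ler_nat.
have l2v v : W2 <= v -> 0 <= l2 v by move=> Wv; rewrite ltW// l20// (le_trans VW2).
have e30 : 0 < e / 3 by rewrite divr_gt0.
have [k1 mk1 H1] := half_convolution_le _ l1 l2 m B C2 W2 l1n l1B C20 W24 l2v HC2 _ e30.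
have [W3 H3] := summable_middle_term m B V1m l1B _ e30.
have [D [W4 [n [D0 Vn nW HD]]]] := rv_gt_sum_le _ _ _ _ V20 l20 l2i l2r g2_gt.
have CC : 0 < e / 3 / (C1 * D * C2) by rewrite divr_gt0// !mulr_gt0.
have [W5 H5] := rv_cvg_mul0 _ _ _ _ V10 l10 l1i l1r m B V1m l1B _ CC.
exists (maxn k1 n), (Num.max W1 (Num.max W2 (Num.max W3 (Num.max (2 * W4) W5)))) => v.
rewrite !ge_max => /and5P[Wv1 Wv2 Wv3 Wv4 Wv5].
set J := Num.truncn _.
have A1 := H1 _ v (leq_maxl k1 n) Wv2.
have A3 := H3 v Wv3.
have l1v : 0 < l1 v by apply: l10; exact: le_trans Wv1.
have l2v0 : 0 < l2 v by apply: l20; exact: le_trans Wv2.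
suff : \sum_(maxn k1 n <= j < J) l2 j%:R * l1 (v - j%:R - 1) <= e / 3 * l2 v
  by rewrite -/J in A1 A3; lra.
have l2n j : (n <= j)%N -> 0 <= l2 j%:R.
  by move=> mj; rewrite ltW// l20// (le_trans Vn)// ler_nat.
apply: (@le_trans _ _ (\sum_(maxn k1 n <= j < J) l2 j%:R * (C1 * l1 v))).
  apply: ler_sum_nat => j /andP[kj jJ].
  apply: ler_wpM2l; first by apply: l2n; exact: leq_trans (leq_maxr _ _) kj.
  have jJ' : (j%:R + 1 : R) <= v / 2.
    rewrite natr1 (@le_trans _ _ J%:R) ?ler_nat//.
    by rewrite truncn_le divr_ge0//; lra.
  have j0 : (0 : R) <= j%:R by [].
  by apply: HC1 => //; apply/andP; split; lra.
rewrite -mulr_suml.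
have S1 : \sum_(maxn k1 n <= j < J) l2 j%:R <= D * (v * (C2 * l2 v)).
  apply: (@le_trans _ _ (\sum_(n <= j < J) l2 j%:R)).
    by apply: le_sum_nat_l => //; exact: leq_maxr.
  have h4 : W4 <= v / 2 by lra.
  apply: (le_trans (HD _ h4)); rewrite ler_wpM2l ?(ltW D0)//.
  have n0 : (0 : R) <= n%:R by [].
  have l2h : 0 <= l2 (v / 2) by rewrite ltW// l20//; lra.
  apply: ler_pM => //; [lra|lra|].
  by apply: HC2 => //; apply/andP; split; lra.
apply: (@le_trans _ _ (D * (v * (C2 * l2 v)) * (C1 * l1 v))).
  by rewrite ler_wpM2r// mulr_ge0// ltW.
have -> : D * (v * (C2 * l2 v)) * (C1 * l1 v) = (v * l1 v) * (C1 * D * C2) * l2 v by ring.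
rewrite ler_pM2r// -ler_pdivlMr ?mulr_gt0//.
exact: H5.
Qed.

End one_summable.
End equal_indices.

(** * Integrals over the region x y > s *)

Definition prod_gt (R : realType) (s : R) : set (R * R) := [set z | s < z.1 * z.2].

Lemma measurable_prod_gt (R : realType) (s : R) : measurable (@prod_gt R s).
Proof.
have h : measurable_fun setT (fun z : R * R => s < z.1 * z.2).
  apply: measurable_fun_ltr => //; apply: measurable_funM.
    exact: measurable_fst.
  exact: measurable_snd.
rewrite /prod_gt.
have := h measurableT [set true]; rewrite setTI; apply.
by [].
Qed.

Section half_limit.
Context {R : realType} (nu : probability R R) (F : R * R -> R)
  (F1 : R -> R) (M p a : R) (s N : nat -> R).
Hypothesis mF : measurable_fun setT F.
Hypothesis F_ge0 : forall z, 0 <= F z.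
Hypothesis F_le : forall z, F z <= M.
Hypothesis F_lim : forall x : R, 0 < x -> F (x, y) @[y --> +oo] --> F1 x.
Hypothesis s_gt0 : forall n, 0 < s n.
Hypothesis s_oo : s n @[n --> \oo] --> +oo.
Hypothesis N_gt0 : forall n, 0 < N n.
Hypothesis tail : forall x : R, 0 < x ->
  fine (nu `]s n / x, +oo[%classic) / N n @[n --> \oo] --> p * x `^ a.

Let phi n (x : R) := (\int[nu]_y (F (x, y) * \1_(prod_gt R (s n)) (x, y))%:E)%E.
Let h n (x : R) := fine (nu `]s n / x, +oo[%classic).

Let hE n (x : R) : nu `]s n / x, +oo[%classic = (h n x)%:E.
Proof. by rewrite /h fineK// fin_num_measure. Qed.

Let h_ge0 n (x : R) : 0 <= h n x. Proof. by rewrite fine_ge0. Qed.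

Lemma upper_bound_ge0 : 0 <= M.
Proof. exact: le_trans (F_ge0 (0, 0)) (F_le (0, 0)). Qed.

Lemma measurable_prod_gt_integrand n :
  measurable_fun setT (fun z => (F z * \1_(prod_gt R (s n)) z)%:E).
Proof.
apply/measurable_EFinP; apply: measurable_funM => //.
by apply: measurable_indic; exact: measurable_prod_gt.
Qed.

Lemma prod_gt_integrand_ge0 n z : (0 <= (F z * \1_(prod_gt R (s n)) z)%:E)%E.
Proof. by rewrite lee_fin mulr_ge0. Qed.

Let measurable_slice n (x : R) :
  measurable_fun setT (fun y => (F (x, y) * \1_(prod_gt R (s n)) (x, y))%:E).
Proof.
apply: (measurableT_comp (measurable_prod_gt_integrand n)).
exact: measurable_pair1.
Qed.

Let slice n (x y : R) : 0 < x ->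
  \1_(prod_gt R (s n)) (x, y) = \1_(`]s n / x, +oo[%classic) y :> R.
Proof.
move=> x0; rewrite !indicE; congr ((nat_of_bool _)%:R).
by apply/idP/idP; rewrite !inE /prod_gt/= in_itv/= andbT ltr_pdivrMr// mulrC.
Qed.

Let mphi n : measurable_fun setT (phi n).
Proof.
exact: (measurable_fun_fubini_tonelli_F _ (measurable_prod_gt_integrand n)
  (prod_gt_integrand_ge0 n)).
Qed.

Let mI n (x : R) :
  measurable_fun setT (fun y => (\1_(`]s n / x, +oo[%classic) y)%:E : \bar R).
Proof. by apply/measurable_EFinP; exact: measurable_indic. Qed.

Let cst_int n (x c : R) : 0 <= c ->
  (\int[nu]_y (c%:E * (\1_(`]s n / x, +oo[%classic) y)%:E) = (c * h n x)%:E)%E.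
Proof.
move=> c0; rewrite (ge0_integralZl _ _ (mI n x))//.
by rewrite integral_indic// setIT EFinM; congr (_ * _)%E; exact: hE.
Qed.

Let phi_le n (x c : R) : 0 < x -> (forall y, s n / x < y -> F (x, y) <= c) ->
  0 <= c -> (phi n x <= (c * h n x)%:E)%E.
Proof.
move=> x0 Fc c0; rewrite -cst_int//; apply: ge0_le_integral => //.
- by move=> y _; exact: prod_gt_integrand_ge0.
- by apply: measurable_funeM; exact: mI.
- move=> y _; rewrite slice// -EFinM lee_fin indicE.
  have [|_] := boolP (y \in _); last by rewrite !mulr0.
  by rewrite inE/= in_itv/= andbT !mulr1 => /Fc.
Qed.

Let phi_fin n (x : R) : 0 < x -> phi n x \is a fin_num.
Proof.
move=> x0; rewrite ge0_fin_numE.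
  by apply: (le_lt_trans (phi_le n x M x0 _ upper_bound_ge0)) => //; rewrite ltry.
by apply: integral_ge0 => y _; exact: prod_gt_integrand_ge0.
Qed.

(** The error e is added on the right rather than subtracted from c, so that all integrands stay
    nonnegative. *)
Let phi_ge n (x c e : R) : 0 < x -> (forall y, s n / x < y -> c <= F (x, y) + e) ->
  0 <= c -> 0 <= e -> ((c * h n x)%:E <= phi n x + (e * h n x)%:E)%E.
Proof.
move=> x0 Fc c0 e0; rewrite -!cst_int// /phi -ge0_integralD//; last 3 first.
- by move=> y _; exact: prod_gt_integrand_ge0.
- by move=> y _; rewrite -EFinM lee_fin mulr_ge0.
- by apply: measurable_funeM; exact: mI.
apply: ge0_le_integral => //.
- by move=> y _; rewrite -EFinM lee_fin mulr_ge0.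
- by apply: measurable_funeM; exact: mI.
- apply: emeasurable_funD => //.
  by apply: measurable_funeM; exact: mI.
- move=> y _; rewrite slice// -!EFinM -EFinD lee_fin indicE.
  have [|_] := boolP (y \in _); last by rewrite !mulr0 addr0.
  by rewrite inE/= in_itv/= andbT !mulr1 => /Fc.
Qed.

Lemma lim_ge0_le (x : R) : 0 < x -> 0 <= F1 x <= M.
Proof.
move=> x0; have Fx := F_lim x x0; apply/andP; split.
  by apply: (cvgr_to_ge Fx); exact: nearW.
by apply: (cvgr_to_le Fx); exact: nearW.
Qed.

Lemma measurable_lim (K : R) : measurable_fun `]0, K]%classic F1.
Proof.
apply: (@measurable_fun_cvg _ _ _ _ (fun n x => F (x, n%:R))).
- move=> n; apply: measurable_funTS; apply: (measurableT_comp mF).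
  exact: measurable_pair2.
- move=> x /=; rewrite in_itv/= => /andP[x0 _].
  by have /cvg_pinftyP := F_lim x x0; apply; exact: cvgr_idn.
Qed.

(** The integral only sees y > s n / x, a threshold tending to +oo, beyond which F (x, y) is
    uniformly close to F1 x. So phi n x is h n x F1 x up to a small multiple of h n x, and h n x / N
    n is eventually at most B. *)
Let phi_cvg (x : R) : 0 < x ->
  fine (phi n x) / N n @[n --> \oo] --> p * x `^ a * F1 x.
Proof.
move=> x0; have /andP[f0 fM] := lim_ge0_le x x0.
have tx := tail x x0.
have : h n x / N n * F1 x @[n --> \oo] --> p * x `^ a * F1 x.
  by apply: cvgM => //; exact: cvg_cst.
move=> hF; rewrite -[X in _ --> X]addr0.
have -> : (fun n => fine (phi n x) / N n) = (fun n => h n x / N n * F1 x +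
    (fine (phi n x) / N n - h n x / N n * F1 x)).
  by apply/funext => n; rewrite addrC subrK.
apply: cvgD => //; apply/cvgr0Pnorm_le => e e0.
pose B := `|p * x `^ a| + 1.
have B0 : 0 < B by rewrite ltr_wpDl.
have eB : 0 < e / B by rewrite divr_gt0.
have /cvgrPdist_le/(_ _ eB)/near_pinfty_geP[Y HY] := F_lim x x0.
have sY : \forall n \near \oo, Y * x < s n.
  by move/cvgryPgt : s_oo; exact.
have hB : \forall n \near \oo, h n x / N n <= B.
  have := @cvgr_le _ _ _ _ _ _ tx B; apply.
  by rewrite /B (le_lt_trans (ler_norm _))// ltrDl.
near=> n.
have Ys : Y * x < s n by near: n.
have hnB : h n x / N n <= B by near: n.
have HF y : s n / x < y -> `|F1 x - F (x, y)| <= e / B.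
  move=> sy; apply: HY; rewrite ltW// (lt_trans _ sy)// ltr_pdivlMr//.
have U1 : (phi n x <= ((F1 x + e / B) * h n x)%:E)%E.
  apply: phi_le => //; last by rewrite addr_ge0// ltW.
  by move=> y /HF; rewrite ler_distlC => /andP[].
have U2 : ((F1 x * h n x)%:E <= phi n x + (e / B * h n x)%:E)%E.
  apply: phi_ge => //; last exact: ltW.
  by move=> y /HF; rewrite ler_distlC lerBlDr => /andP[].
move: U1 U2; rewrite -(fineK (phi_fin n x x0)) -EFinD !lee_fin => U1 U2.
have -> : fine (phi n x) / N n - h n x / N n * F1 x =
  (fine (phi n x) - F1 x * h n x) / N n by ring.
rewrite normrM normfV (gtr0_norm (N_gt0 n)) ler_pdivrMr//.
apply: (@le_trans _ _ (e / B * h n x)); first by rewrite ler_norml; apply/andP; split; lra.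
have -> : e * N n = e / B * (B * N n) by rewrite mulrA divfK// gt_eqF.
by rewrite ler_pM2l// -ler_pdivrMr.
Unshelve. all: by end_near. Qed.

(** The truncation x <= K provides the dominating constant: s n / x >= s n / K, hence h n x <= h n
    K, and h n K / N n is bounded because it converges. *)
Lemma half_limit (mu : probability R R) (K : R) : 0 < K ->
  ((N n)^-1%:E * \int[mu]_(x in `]0%R, K]%classic)
     \int[nu]_y (F (x, y) * \1_(prod_gt R (s n)) (x, y))%:E)%E @[n --> \oo] -->
  (\int[mu]_(x in `]0%R, K]%classic) (p * x `^ a * F1 x)%:E)%E.
Proof.
move=> K0.
have /pinfty_ex_gt0[C C0 /= HC] : bounded_fun (fun n => h n K / N n).
  by apply: cvg_seq_bounded; apply/cvg_ex; exists (p * K `^ a); exact: tail.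
have -> : (fun n => (N n)^-1%:E * \int[mu]_(x in `]0%R, K]%classic)
     \int[nu]_y (F (x, y) * \1_(prod_gt R (s n)) (x, y))%:E)%E =
  (fun n => \int[mu]_(x in `]0%R, K]%classic) ((N n)^-1%:E * phi n x))%E.
  apply/funext => n; rewrite ge0_integralZl//.
  - exact: measurable_funTS.
  - by move=> x _; apply: integral_ge0 => y _; exact: prod_gt_integrand_ge0.
  - by rewrite lee_fin invr_ge0 ltW.
have := @dominated_convergence _ _ _ mu `]0, K]%classic (measurable_itv _)
  (fun n x => ((N n)^-1%:E * phi n x)%E) (fun x => (p * x `^ a * F1 x)%:E)
  (fun x => (M * C)%:E).
case=> //.
- by move=> n; apply: measurable_funeM; exact: measurable_funTS.
- apply/measurable_EFinP; apply: measurable_funM; last exact: measurable_lim.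
  apply: measurable_funM => //; apply: measurable_funTS; exact: measurable_powR.
- apply: aeW => x /=; rewrite in_itv/= => /andP[x0 _].
  apply/fine_cvgP; split.
    by apply: nearW => n; rewrite fin_numM// phi_fin.
  apply: cvg_trans (phi_cvg x x0); apply: near_eq_cvg; apply: nearW => n /=.
  by rewrite fineM ?phi_fin//= mulrC.
- exact: finite_measure_integrable_cst.
- apply: aeW => x n /=; rewrite in_itv/= => /andP[x0 xK].
  have p0 : (0 <= phi n x)%E by apply: integral_ge0 => y _; exact: prod_gt_integrand_ge0.
  rewrite gee0_abs; last by rewrite mule_ge0// lee_fin invr_ge0 ltW.
  apply: (@le_trans _ _ ((N n)^-1%:E * (M * h n x)%:E)%E).
    apply: lee_wpmul2l; first by rewrite lee_fin invr_ge0 ltW.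
    by apply: phi_le => //; exact: upper_bound_ge0.
  rewrite -EFinM lee_fin mulrCA ler_wpM2l ?upper_bound_ge0//.
  apply: (@le_trans _ _ (h n K / N n)); last first.
    by apply: le_trans (ler_norm _) _; exact: HC.
  rewrite mulrC ler_pM2r ?invr_gt0//.
  rewrite /h fine_le ?fin_num_measure// le_measure ?inE// => y /=.
  rewrite !in_itv/= !andbT; apply: le_lt_trans.
  by rewrite ler_pM2l// lef_pV2 ?posrE.
Qed.
End half_limit.

Section half_block.
Context {R : realType} (mu nu : probability R R) (F : R * R -> R)
  (F1 : R -> R) (M p a : R) (s N : nat -> R).
Hypothesis mF : measurable_fun setT F.
Hypothesis F_ge0 : forall z, 0 <= F z.
Hypothesis F_le : forall z, F z <= M.
Hypothesis F_lim : forall x : R, 0 < x -> F (x, y) @[y --> +oo] --> F1 x.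
Hypothesis s_gt0 : forall n, 0 < s n.
Hypothesis s_oo : s n @[n --> \oo] --> +oo.
Hypothesis N_gt0 : forall n, 0 < N n.
Hypothesis tail : forall x : R, 0 < x ->
  fine (nu `]s n / x, +oo[%classic) / N n @[n --> \oo] --> p * x `^ a.

Definition half_int (K : R) n : \bar R :=
  (\int[mu]_(x in `]0%R, K]%classic)
     \int[nu]_y (F (x, y) * \1_(prod_gt R (s n)) (x, y))%:E)%E.

Definition half_lim (K : R) : \bar R :=
  (\int[mu]_(x in `]0%R, K]%classic) (p * x `^ a * F1 x)%:E)%E.

(* Limit of the contribution of {x bounded, y large}; [half_lim] is its part on
   {x <= K}. *)
Definition full_lim : \bar R :=
  (\int[mu]_(x in `]0%R, +oo[%classic) (p * x `^ a * F1 x)%:E)%E.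

Hypothesis full_lim_fin : (full_lim < +oo)%E.

Lemma tail_limit_ge0 : 0 <= p.
Proof.
have := tail 1 ltr01; rewrite powR1 mulr1 => h.
apply: (cvgr_to_ge h); apply: nearW => n.
by rewrite divr_ge0 ?fine_ge0// ltW.
Qed.

Let f_ge0 (x : R) : 0 < x -> 0 <= p * x `^ a * F1 x.
Proof.
move=> x0; have /andP[h _] := lim_ge0_le F F1 M F_ge0 F_le F_lim x x0.
by rewrite !mulr_ge0 ?tail_limit_ge0 ?powR_ge0.
Qed.

Let mf (K : R) : measurable_fun (`]0, K]%classic : set R) (fun x => (p * x `^ a * F1 x)%:E).
Proof.
apply/measurable_EFinP; apply: measurable_funM; last exact: (measurable_lim F F1 mF F_lim).
apply: measurable_funM => //; apply: measurable_funTS; exact: measurable_powR.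
Qed.

Lemma bigcup_itv_oc : \bigcup_k `]0, k%:R]%classic = `]0, +oo[%classic :> set R.
Proof.
apply/seteqP; split=> x /=; rewrite in_itv/= ?andbT.
  by move=> [k _ /=]; rewrite in_itv/= => /andP[].
move=> x0; exists (Num.truncn x).+1 => //=.
by rewrite in_itv/= x0 ltW// truncnS_gt.
Qed.

Let measurable_full_integrand :
  measurable_fun (`]0, +oo[%classic : set R) (fun x => (p * x `^ a * F1 x)%:E).
Proof.
rewrite -bigcup_itv_oc; apply/measurable_fun_bigcup => //.
Qed.

Lemma half_lim_le (K K' : R) : K <= K' -> (half_lim K <= half_lim K')%E.
Proof.
move=> KK; apply: ge0_subset_integral => //.
- by move=> x /=; rewrite in_itv/= lee_fin => /andP[x0 _]; exact: f_ge0.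
- by move=> x /=; rewrite !in_itv/= => /andP[-> xK]; exact: le_trans KK.
Qed.

Lemma half_lim_le_full (K : R) : (half_lim K <= full_lim)%E.
Proof.
apply: ge0_subset_integral => //.
- by move=> x /=; rewrite in_itv/= lee_fin andbT => x0; exact: f_ge0.
- by move=> x /=; rewrite !in_itv/= => /andP[-> xK].
Qed.

Lemma half_lim_ge0 (K : R) : (0 <= half_lim K)%E.
Proof.
apply: integral_ge0 => x /=; rewrite in_itv/= lee_fin => /andP[x0 _].
exact: f_ge0.
Qed.

Lemma half_lim_fin (K : R) : half_lim K \is a fin_num.
Proof.
by rewrite ge0_fin_numE ?half_lim_ge0// (le_lt_trans (half_lim_le_full K)).
Qed.

Let full_lim_ge0 : (0 <= full_lim)%E.
Proof. exact: le_trans (half_lim_ge0 0) (half_lim_le_full 0). Qed.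

Lemma full_lim_fin_num : full_lim \is a fin_num.
Proof. by rewrite ge0_fin_numE ?full_lim_ge0. Qed.

Lemma half_lim_cvg : fine (half_lim k%:R) @[k --> \oo] --> fine full_lim.
Proof.
apply: fine_cvg; rewrite fineK ?full_lim_fin_num//.
rewrite /full_lim -bigcup_itv_oc.
apply: ge0_nondecreasing_set_cvg_integral => //.
- move=> m n mn; apply/subsetPset => x /=; rewrite !in_itv/= => /andP[-> xm].
  by rewrite (le_trans xm)// ler_nat.
- by move=> i x /=; rewrite in_itv/= lee_fin => /andP[x0 _]; exact: f_ge0.
Qed.

Lemma half_lim_close (e : R) : 0 < e -> exists k : nat, forall K, k%:R <= K ->
  fine full_lim - e <= fine (half_lim K) <= fine full_lim.
Proof.
move=> e0; have /cvgrPdist_le/(_ _ e0)[k _ Hk] := half_lim_cvg.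
exists k => K kK; apply/andP; split.
  have := Hk k (leqnn k); rewrite /= ler_distlC => /andP[_ h].
  have : fine (half_lim k%:R) <= fine (half_lim K).
    by apply: fine_le; [exact: half_lim_fin|exact: half_lim_fin|exact: half_lim_le].
  move: (Hk k (leqnn k)); rewrite /= ler_norml => /andP[_ h2]; lra.
by apply: fine_le; [exact: half_lim_fin|exact: full_lim_fin_num|exact: half_lim_le_full].
Qed.

Lemma half_int_fin (K : R) n : half_int K n \is a fin_num.
Proof.
have M0 := upper_bound_ge0 F M F_ge0 F_le.
have mG := measurable_prod_gt_integrand F s mF n.
have G0 := prod_gt_integrand_ge0 F s F_ge0 n.
have inner_ge0 x : (0 <= \int[nu]_y (F (x, y) * \1_(prod_gt R (s n)) (x, y))%:E)%E.
  by apply: integral_ge0 => y _; exact: G0.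
rewrite ge0_fin_numE; last by apply: integral_ge0.
apply: (@le_lt_trans _ _ (\int[mu]_(x in `]0%R, K]%classic) M%:E)%E); last first.
  rewrite integral_cst// -ge0_fin_numE ?mule_ge0//.
  by rewrite fin_numM// fin_num_measure.
apply: ge0_le_integral => //.
- apply: measurable_funTS.
  exact: (measurable_fun_fubini_tonelli_F _ mG G0).
- move=> x _; apply: (@le_trans _ _ (\int[nu]_y M%:E)%E).
    apply: ge0_le_integral => //.
    + by apply: (measurableT_comp mG); exact: measurable_pair1.
    + move=> y _; rewrite lee_fin indicE.
      by case: (_ \in _); rewrite ?mulr1 ?mulr0.
  rewrite integral_cst// -[leRHS]mule1; apply: lee_wpmul2l => //.
  exact: probability_le1.
Qed.

Lemma half_int_cvg (K : R) : 0 < K ->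
  fine (half_int K n) / N n @[n --> \oo] --> fine (half_lim K).
Proof.
move=> K0.
have := half_limit nu F F1 M p a s N mF F_ge0 F_le F_lim s_gt0 s_oo N_gt0 tail mu K K0.
rewrite -/(half_lim K) -(fineK (half_lim_fin K)) => /fine_cvg.
apply: cvg_trans; apply: near_eq_cvg; apply: nearW => n /=.
by rewrite fineM ?half_int_fin//= mulrC.
Qed.

End half_block.

Definition both_large (R : realType) (K s : R) : set (R * R) :=
  [set z | [/\ K < z.1, K < z.2 & s < z.1 * z.2]].

Lemma measurable_both_large (R : realType) (K s : R) :
  measurable (both_large R K s).
Proof.
have -> : both_large R K s =
    (`]K, +oo[%classic `*` `]K, +oo[%classic) `&` prod_gt R s.
  apply/seteqP; split=> -[x y]; rewrite /both_large/prod_gt/= !in_itv/= !andbT.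
    by case.
  by move=> [[]].
apply: measurableI; last exact: measurable_prod_gt.
by apply: measurableX; exact: measurable_itv.
Qed.

Section product_limit.
Context {R : realType} (mu nu : probability R R) (F : R * R -> R)
  (F1 F2 : R -> R) (M p r a : R) (s N : nat -> R).
Hypothesis mF : measurable_fun setT F.
Hypothesis F_ge0 : forall z, 0 <= F z.
Hypothesis F_le : forall z, F z <= M.
Hypothesis F_pos : forall x y, ~~ ((0 < x) && (0 < y)) -> F (x, y) = 0.
Hypothesis F_lim1 : forall x : R, 0 < x -> F (x, y) @[y --> +oo] --> F1 x.
Hypothesis F_lim2 : forall y : R, 0 < y -> F (x, y) @[x --> +oo] --> F2 y.
Hypothesis s_gt0 : forall n, 0 < s n.
Hypothesis s_oo : s n @[n --> \oo] --> +oo.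
Hypothesis N_gt0 : forall n, 0 < N n.
Hypothesis tail_nu : forall x : R, 0 < x ->
  fine (nu `]s n / x, +oo[%classic) / N n @[n --> \oo] --> p * x `^ a.
Hypothesis tail_mu : forall y : R, 0 < y ->
  fine (mu `]s n / y, +oo[%classic) / N n @[n --> \oo] --> r * y `^ a.
Hypothesis negligible : forall e : R, 0 < e -> exists K0, forall K, K0 <= K ->
  \forall n \near \oo, ((mu \x nu) (both_large R K (s n)) <= (e * N n)%:E)%E.

Let Fs (z : R * R) := F (z.2, z.1).
Let L1 := full_lim mu F1 p a.
Let L2 := full_lim nu F2 r a.
Hypothesis L1_fin : (L1 < +oo)%E.
Hypothesis L2_fin : (L2 < +oo)%E.

Let I3 K n : \bar R :=
  (\int[mu \x nu]_z (F z * \1_(prod_gt R (s n)) z * \1_(both_large R K (s n)) z)%:E)%E.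

Let mFs : measurable_fun setT Fs.
Proof.
apply: (measurableT_comp mF); apply/measurable_fun_pairP; split => /=.
  exact: measurable_snd.
exact: measurable_fst.
Qed.

Let m_ind n (U : set (R * R)) : measurable U ->
  measurable_fun setT (fun z => (F z * \1_(prod_gt R (s n)) z * \1_U z)%:E).
Proof.
move=> mU; apply/measurable_EFinP; apply: measurable_funM.
  apply: measurable_funM => //.
  by apply: measurable_indic; exact: measurable_prod_gt.
exact: measurable_indic.
Qed.

Let ind_ge0 n (U : set (R * R)) z : (0 <= (F z * \1_(prod_gt R (s n)) z * \1_U z)%:E)%E.
Proof. by rewrite lee_fin !mulr_ge0. Qed.

Let block1 (K : R) n : (\int[mu \x nu]_z (F z * \1_(prod_gt R (s n)) z *
  \1_(`]-oo, K]%classic `*` setT) z)%:E = half_int mu nu F s K n)%E.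
Proof.
have mU : measurable (`]-oo, K]%classic `*` setT : set (R * R)) by exact: measurableX.
rewrite (fubini_tonelli1 _ (m_ind n _ mU) (ind_ge0 n _)).
rewrite /half_int [RHS]integral_mkcond; apply: eq_integral => x _.
rewrite /fubini_F/= patchE; case: ifPn.
  rewrite inE/= in_itv/= => /andP[x0 xK]; apply: eq_integral => y _.
  have xU : (`]-oo, K]%classic `*` setT) (x, y) by split => //=; rewrite in_itv/=.
  by rewrite [X in _ * X]indicE (mem_set xU) mulr1.
move=> xK; apply: integral0_eq => y _; congr EFin.
have [x0|x0] := ltP 0 x; last by rewrite F_pos ?mul0r// negb_and -leNgt x0.
rewrite [X in _ * X]indicE memNset ?mulr0//= => -[/=]; rewrite in_itv/= => h _.
by move/negP: xK; apply; rewrite inE/= in_itv/= x0 h.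
Qed.

Let block2 (K : R) n : (\int[mu \x nu]_z (F z * \1_(prod_gt R (s n)) z *
  \1_(setT `*` `]-oo, K]%classic) z)%:E = half_int nu mu Fs s K n)%E.
Proof.
have mU : measurable (setT `*` `]-oo, K]%classic : set (R * R)) by exact: measurableX.
rewrite (fubini_tonelli2 _ (m_ind n _ mU) (ind_ge0 n _)).
rewrite /half_int [RHS]integral_mkcond; apply: eq_integral => y _.
rewrite /fubini_G/= patchE; case: ifPn.
  rewrite inE/= in_itv/= => /andP[y0 yK]; apply: eq_integral => x _.
  have yU : (setT `*` `]-oo, K]%classic) (x, y) by split => //=; rewrite in_itv/=.
  rewrite [X in _ * X]indicE (mem_set yU) mulr1.
  rewrite /Fs/= !indicE; congr ((_ * (nat_of_bool _)%:R)%:E).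
  by apply/idP/idP; rewrite !inE /prod_gt/= mulrC.
move=> yK; apply: integral0_eq => x _; congr EFin.
have [y0|y0] := ltP 0 y; last by rewrite F_pos ?mul0r// negb_and -!leNgt y0 orbT.
rewrite [X in _ * X]indicE memNset ?mulr0//= => -[/= _]; rewrite in_itv/= => h.
by move/negP: yK; apply; rewrite inE/= in_itv/= y0 h.
Qed.

(** When K * K <= s n, the strips x <= K and y <= K do not meet inside the positive part of {x y > s
    n}, so the three indicators add up to 1 there; elsewhere both sides vanish, by [F_pos] or by the
    indicator of [prod_gt]. *)
Let decomp (K : R) n : 0 < K -> K * K <= s n ->
  (\int[mu \x nu]_z (F z * \1_(prod_gt R (s n)) z)%:E =
   half_int mu nu F s K n + half_int nu mu Fs s K n + I3 K n)%E.
Proof.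
move=> K0 KK; rewrite -block1 -block2 /I3.
have mU1 : measurable (`]-oo, K]%classic `*` setT : set (R * R)) by exact: measurableX.
have mU2 : measurable (setT `*` `]-oo, K]%classic : set (R * R)) by exact: measurableX.
have mU3 := measurable_both_large R K (s n).
have i0 U z : [set: R * R] z -> (0 <= (F z * \1_(prod_gt R (s n)) z * \1_U z)%:E)%E.
  by move=> _; exact: ind_ge0.
rewrite -(ge0_integralD _ measurableT (i0 _) (m_ind n _ mU1) (i0 _) (m_ind n _ mU2)).
rewrite -(ge0_integralD _ measurableT (fun z zT => adde_ge0 (i0 _ z zT) (i0 _ z zT))
  (emeasurable_funD (m_ind n _ mU1) (m_ind n _ mU2)) (i0 _) (m_ind n _ mU3)).
apply: eq_integral => -[x y] _; rewrite -!EFinD; congr EFin.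
have [/andP[x0 y0]|/F_pos ->] := boolP ((0 < x) && (0 < y)); last by rewrite !mul0r !addr0.
rewrite ![\1_(prod_gt R (s n)) _]indicE.
have [|_] := boolP ((x, y) \in _); last by rewrite !mulr0 !mul0r !addr0.
rewrite inE /prod_gt/= => sxy; rewrite mulr1 -!mulrDr -[LHS]mulr1; congr (_ * _).
rewrite !indicE.
have [xK|Kx] := leP x K.
  rewrite mem_set; last by split => //=; rewrite in_itv/=.
  rewrite memNset; last first.
    move=> [/= _]; rewrite in_itv/= => yK.
    have : x * y <= K * K by apply: ler_pM => //; exact: ltW.
    by move=> h; have := le_lt_trans (le_trans h KK) sxy; rewrite ltxx.
  by rewrite memNset ?addr0// => -[/=]; rewrite ltNge xK.
rewrite memNset; last by move=> [/=]; rewrite in_itv/= leNgt Kx.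
rewrite add0r; have [yK|Ky] := leP y K.
  rewrite mem_set; last by split => //=; rewrite in_itv/=.
  by rewrite memNset ?addr0// => -[/= _]; rewrite ltNge yK.
rewrite memNset; last by move=> [/= _]; rewrite in_itv/= leNgt Ky.
by rewrite mem_set ?add0r.
Qed.

Let I3_le K n : (I3 K n <= M%:E * (mu \x nu) (both_large R K (s n)))%E.
Proof.
have M0 := upper_bound_ge0 F M F_ge0 F_le.
have mU3 := measurable_both_large R K (s n).
rewrite -[X in (_ * (mu \x nu) X)%E]setIT -integral_indic// -ge0_integralZl//.
- apply: ge0_le_integral => //.
  + exact: m_ind.
  + by apply: measurable_funeM; apply/measurable_EFinP; exact: measurable_indic.
  + move=> z _; rewrite -EFinM lee_fin ler_wpM2r// indicE.
    by case: (_ \in _); rewrite ?mulr1 ?mulr0.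
- by apply/measurable_EFinP; exact: measurable_indic.
Qed.

Lemma product_limit :
  fine (\int[mu \x nu]_z (F z * \1_(prod_gt R (s n)) z)%:E)%E / N n @[n --> \oo]
  --> fine L1 + fine L2.
Proof.
have M0 := upper_bound_ge0 F M F_ge0 F_le.
have Fs_ge0 z : 0 <= Fs z by exact: F_ge0.
have Fs_le z : Fs z <= M by exact: F_le.
apply/cvgrPdist_le => e e0.
(* Five errors: for each half, truncation at K and convergence in n; then the event that both
   coordinates are large. *)
have e5 : 0 < e / 5 by rewrite divr_gt0.
have [k1 Hk1] := half_lim_close mu nu F F1 M p a s N mF F_ge0 F_le F_lim1 N_gt0 tail_nu L1_fin _ e5.
have [k2 Hk2] := half_lim_close nu mu Fs F2 M r a s N mFs Fs_ge0
  Fs_le F_lim2 N_gt0 tail_mu L2_fin _ e5.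
(* M may be 0, so the bound on the last region is divided by M + 1. *)
have M1 : 0 < M + 1 by rewrite ltr_wpDl.
have [K0 HK0] := negligible (e / 5 / (M + 1)) (divr_gt0 e5 M1).
pose K := Num.max (Num.max k1%:R k2%:R) (Num.max K0 1).
have kK1 : k1%:R <= K by rewrite /K !le_max lexx.
have kK2 : k2%:R <= K by rewrite /K !le_max lexx orbT.
have kK0 : K0 <= K by rewrite /K !le_max lexx !orbT.
have K_gt0 : 0 < K by rewrite /K !lt_max ltr01 !orbT.
have /andP[A1 A2] := Hk1 K kK1; have /andP[B1 B2] := Hk2 K kK2.
have /cvgrPdist_le/(_ _ e5) C1 := half_int_cvg mu nu F F1 M p a s N mF F_ge0 F_le
  F_lim1 s_gt0 s_oo N_gt0 tail_nu L1_fin K K_gt0.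
have /cvgrPdist_le/(_ _ e5) C2 := half_int_cvg nu mu Fs F2 M r a s N mFs Fs_ge0 Fs_le
  F_lim2 s_gt0 s_oo N_gt0 tail_mu L2_fin K K_gt0.
have C3 := HK0 K kK0.
have C4 : \forall n \near \oo, K * K <= s n by move/cvgryPge : s_oo; exact.
near=> n.
have KKs : K * K <= s n by near: n.
rewrite (decomp K)//.
have D1 : `|fine (half_lim mu F1 p a K) - fine (half_int mu nu F s K n) / N n| <= e / 5 by near: n.
have D2 : `|fine (half_lim nu F2 r a K) - fine (half_int nu mu Fs s K n) / N n| <= e / 5 by near: n.
have D3 : ((mu \x nu) (both_large R K (s n)) <= (e / 5 / (M + 1) * N n)%:E)%E by near: n.
have I30 : (0 <= I3 K n)%E by apply: integral_ge0 => z _; exact: ind_ge0.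
have I3e : (I3 K n <= (e / 5 * N n)%:E)%E.
  apply: (le_trans (I3_le K n)).
  apply: (@le_trans _ _ (M%:E * (e / 5 / (M + 1) * N n)%:E)%E).
    by apply: lee_wpmul2l; rewrite ?lee_fin.
  rewrite -EFinM lee_fin mulrA ler_pM2r// mulrCA ler_piMr ?(ltW e5)//.
  by rewrite ler_pdivrMr// mul1r lerDl.
have I3f : I3 K n \is a fin_num.
  by rewrite ge0_fin_numE// (le_lt_trans I3e)// ltry.
have f1 := half_int_fin mu nu F M s mF F_ge0 F_le K n.
have f2 := half_int_fin nu mu Fs M s mFs Fs_ge0 Fs_le K n.
have -> : fine (half_int mu nu F s K n + half_int nu mu Fs s K n + I3 K n)%E =
    fine (half_int mu nu F s K n) + fine (half_int nu mu Fs s K n) + fine (I3 K n).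
  have f12 : (half_int mu nu F s K n + half_int nu mu Fs s K n)%E \is a fin_num.
    by rewrite fin_numD f1 f2.
  by rewrite (fineD f12 I3f) (fineD f1 f2).
move: I30 I3e; rewrite -(fineK I3f) !lee_fin => I30.
rewrite -ler_pdivrMr// => I3e.
have I30' : 0 <= fine (I3 K n) / N n by rewrite divr_ge0// ltW.
move: D1 D2; rewrite !ler_norml !mulrDl => /andP[D1 D1'] /andP[D2 D2'].
rewrite -/L1 in A1 A2; rewrite -/L2 in B1 B2.
by apply/andP; split; lra.
Unshelve. all: by end_near. Qed.

End product_limit.

(** * Probabilities with regularly varying tails *)

Definition tail (R : realType) (mu : set R -> \bar R) (s : R) : R :=
  fine (mu `]s, +oo[%classic).

Section tail_lemmas.
Context {R : realType} (mu : probability R R).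

Lemma tailE (s : R) : mu `]s, +oo[%classic = (tail R mu s)%:E.
Proof. by rewrite /tail fineK// fin_num_measure. Qed.

Lemma tail_ge0 (s : R) : 0 <= tail R mu s.
Proof. by rewrite fine_ge0. Qed.

Lemma tail_ni (s t : R) : s <= t -> tail R mu t <= tail R mu s.
Proof.
move=> st; rewrite -lee_fin -!tailE le_measure ?inE//.
by move=> x /=; rewrite !in_itv/= !andbT; exact: le_lt_trans.
Qed.

Let m_ind_itv (j : nat) (D : set R) :
  measurable_fun D (fun y => (\1_(`]expR j%:R, +oo[%classic) y)%:E : \bar R).
Proof. by apply/measurable_EFinP; exact: measurable_indic. Qed.

(** Integrating over x > 0 leaves out negative x, where [powR] is a mere default value. For a
    positive random variable this is the usual moment. *)
Definition moment_pos (a : R) : \bar R :=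
  (\int[mu]_(x in `]0%R, +oo[%classic) (x `^ a)%:E)%E.

Let geom_sum (a : R) (n : nat) : 0 < a ->
  \sum_(0 <= j < n.+1) expR (a * j%:R) <= (1 - expR (- a))^-1 * expR (a * n%:R).
Proof.
move=> a0; have c0 : 0 < 1 - expR (- a).
  by rewrite subr_gt0 -expR0 ltr_expR oppr_lt0.
rewrite mulrC ler_pdivlMr//; elim: n => [|n IH].
  by rewrite big_nat1 mulr0 expR0 mul1r gerBl expR_ge0.
rewrite big_nat_recr//= mulrDl; apply: (le_trans (lerD IH (lexx _))).
have -> : expR (a * n%:R) = expR (a * n.+1%:R) * expR (- a).
  by rewrite -expRD -natr1; congr expR; ring.
by rewrite le_eqVlt; apply/orP; left; apply/eqP; ring.
Qed.

Let sum_ind_le (a y : R) (n : nat) : 0 < a -> 0 < y ->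
  \sum_(0 <= j < n) expR (a * j%:R) * \1_(`]expR j%:R, +oo[%classic) y
  <= (1 - expR (- a))^-1 * y `^ a.
Proof.
move=> a0 y0; have c0 : 0 < 1 - expR (- a).
  by rewrite subr_gt0 -expR0 ltr_expR oppr_lt0.
elim: n => [|n IH].
  by rewrite big_geq// mulr_ge0 ?powR_ge0// invr_ge0 ltW.
have [ny|yn] := ltP (expR n%:R) y; last first.
  rewrite big_nat_recr//= [X in _ + _ * X]indicE memNset ?mulr0 ?addr0//.
  by rewrite /= in_itv/= andbT; apply/negP; rewrite -leNgt.
apply: (@le_trans _ _ (\sum_(0 <= j < n.+1) expR (a * j%:R))).
  by apply: ler_sum => j _; rewrite indicE ler_piMr ?expR_ge0// lern1 leq_b1.
apply: (le_trans (geom_sum a n a0)); rewrite ler_pM2l ?invr_gt0//.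
rewrite /powR gt_eqF// ler_expR ler_pM2l// -ler_expR lnK ?posrE//.
exact: ltW.
Qed.

(** Pointwise, the sum of e^(a j) over the j with e^j < y is geometric, hence at most a constant
    times y^a; integrating exchanges the indicators for tails. *)
Lemma moment_sum_bounded (a : R) : 0 < a -> (moment_pos a < +oo)%E ->
  exists B, forall n, \sum_(0 <= j < n) expR (a * j%:R) * tail R mu (expR j%:R) <= B.
Proof.
move=> a0 fin; have c0 : 0 < 1 - expR (- a).
  by rewrite subr_gt0 -expR0 ltr_expR oppr_lt0.
have m0 : (0 <= moment_pos a)%E by apply: integral_ge0 => x _; rewrite lee_fin powR_ge0.
have mf : moment_pos a \is a fin_num by rewrite ge0_fin_numE.
exists ((1 - expR (- a))^-1 * fine (moment_pos a)) => n.
rewrite -lee_fin EFinM fineK//.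
have mI j : measurable_fun (`]0, +oo[%classic : set R)
    (fun y => (expR (a * j%:R) * \1_(`]expR j%:R, +oo[%classic) y)%:E).
  by apply/measurable_EFinP; apply: measurable_funM => //; exact: measurable_indic.
have -> : ((\sum_(0 <= j < n) expR (a * j%:R) * tail R mu (expR j%:R))%:E =
  \int[mu]_(y in `]0%R, +oo[%classic)
    \sum_(0 <= j < n) (expR (a * j%:R) * \1_(`]expR j%:R, +oo[%classic) y)%:E)%E.
  rewrite ge0_integral_sum//.
  rewrite -sumEFin; apply: eq_bigr => j _.
  under eq_integral do rewrite EFinM.
  rewrite (ge0_integralZl _ _ (m_ind_itv j _)) ?lee_fin ?expR_ge0//.
  rewrite integral_indic// EFinM -tailE; congr (_ * mu _)%E.
  apply/seteqP; split=> x /=; rewrite !in_itv/= !andbT; last by case.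
  by move=> jx; split => //; rewrite (lt_trans (expR_gt0 _) jx).
rewrite -ge0_integralZl//.
- apply: ge0_le_integral => //.
  + by move=> x _; apply: sume_ge0 => j _; rewrite lee_fin mulr_ge0// expR_ge0.
  + exact: emeasurable_sum.
  + apply: measurable_funeM; apply/measurable_EFinP.
    by apply: measurable_funTS; exact: measurable_powR.
  + move=> x /=; rewrite in_itv/= andbT => x0.
    by rewrite sumEFin lee_fin; exact: sum_ind_le.
- by apply/measurable_EFinP; apply: measurable_funTS; exact: measurable_powR.
- by move=> x _; rewrite lee_fin powR_ge0.
- by rewrite lee_fin invr_ge0 ltW.
Qed.

Let powR_le_sum (a y : R) (m n : nat) : 0 < a -> 0 < y -> y <= expR n%:R ->
  y `^ a <= expR (a * m%:R) +
    \sum_(m <= j < n) expR (a * j.+1%:R) * \1_(`]expR j%:R, +oo[%classic) y.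
Proof.
move=> a0 y0; have yle k : y <= expR k%:R -> y `^ a <= expR (a * k%:R).
  move=> yk; rewrite /powR gt_eqF// ler_expR ler_pM2l// -ler_expR lnK ?posrE//.
elim: n => [|n IH] yn.
  apply: (le_trans (yle _ yn)); rewrite mulr0 expR0 big_geq// addr0.
  by rewrite -expR0 ler_expR mulr_ge0// ltW.
have [nm|mn] := leqP n.+1 m.
  rewrite big_geq// addr0; apply: (le_trans (yle _ yn)).
  by rewrite ler_expR ler_pM2l// ler_nat.
rewrite big_nat_recr//= addrA.
have [yn'|ny] := leP y (expR n%:R).
  by apply: (le_trans (IH yn')); rewrite lerDl mulr_ge0// expR_ge0.
rewrite [X in _ + _ * X]indicE mem_set; last by rewrite /= in_itv/= andbT.
rewrite mulr1; apply: (le_trans (yle _ yn)); rewrite lerDr addr_ge0 ?expR_ge0//.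
by apply: sumr_ge0 => j _; rewrite mulr_ge0// expR_ge0.
Qed.

(** If e^j < y <= e^(j+1), then y^a <= e^(a (j+1)), one of the terms of the sum. This bounds the
    moment truncated at e^n uniformly in n, and monotone convergence removes the truncation. *)
Lemma sum_bounded_moment (a : R) (m : nat) (B : R) : 0 < a ->
  (forall n, \sum_(m <= j < n) expR (a * j%:R) * tail R mu (expR j%:R) <= B) ->
  (moment_pos a < +oo)%E.
Proof.
move=> a0 HB.
pose S n : \bar R := (\int[mu]_(x in `]0%R, (expR n%:R)%R]%classic) (x `^ a)%:E)%E.
have mp (D : set R) : measurable_fun D (fun x => (x `^ a)%:E).
  by apply/measurable_EFinP; apply: measurable_funTS; exact: measurable_powR.
have mI n j : measurable_fun (`]0, expR n%:R]%classic : set R)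
    (fun y => (expR (a * j.+1%:R) * \1_(`]expR j%:R, +oo[%classic) y)%:E).
  by apply/measurable_EFinP; apply: measurable_funM => //; exact: measurable_indic.
have S_le n : (S n <= (expR (a * m%:R) + expR a * B)%:E)%E.
  apply: (@le_trans _ _ (\int[mu]_(x in `]0%R, (expR n%:R)%R]%classic)
     ((expR (a * m%:R))%:E +
    \sum_(m <= j < n) (expR (a * j.+1%:R) * \1_(`]expR j%:R, +oo[%classic) x)%:E))%E).
    apply: ge0_le_integral => //.
    - by move=> x _; rewrite lee_fin powR_ge0.
    - by apply: emeasurable_funD => //; exact: emeasurable_sum.
    - move=> x /=; rewrite in_itv/= => /andP[x0 xn].
      by rewrite sumEFin -EFinD lee_fin; exact: powR_le_sum.
  rewrite ge0_integralD//; last 2 first.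
  - by move=> x _; apply: sume_ge0 => j _; rewrite lee_fin mulr_ge0// expR_ge0.
  - exact: emeasurable_sum.
  rewrite EFinD; apply: leeD.
    rewrite integral_cst// -[leRHS]mule1; apply: lee_wpmul2l.
      by rewrite lee_fin expR_ge0.
    exact: probability_le1.
  rewrite ge0_integral_sum//.
  apply: (@le_trans _ _ (\sum_(m <= j < n) expR a * (expR (a * j%:R) * tail R mu (expR j%:R)))%:E).
    rewrite -sumEFin; apply: lee_sum => j _.
    under eq_integral do rewrite EFinM.
    rewrite (ge0_integralZl _ _ (m_ind_itv j _)) ?lee_fin ?expR_ge0//.
    rewrite integral_indic// mulrA EFinM -expRD -tailE.
    have -> : a + a * j%:R = a * j.+1%:R by rewrite -natr1; ring.
    apply: lee_wpmul2l; first by rewrite lee_fin expR_ge0.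
    apply: le_measure; rewrite ?inE//; exact: measurableI.
  by rewrite lee_fin -mulr_sumr ler_pM2l ?expR_gt0.
have : S n @[n --> \oo] --> moment_pos a.
  have -> : moment_pos a = (\int[mu]_(x in \bigcup_n `]0%R, (expR n%:R)%R]%classic) (x `^ a)%:E)%E.
    congr (integral _ _ _); apply/seteqP; split=> x /=; rewrite in_itv/= ?andbT.
      move=> x0; exists (Num.truncn x).+1 => //=; rewrite in_itv/= x0/=.
      rewrite (le_trans (ltW (truncnS_gt x)))// (le_trans _ (expR_ge1Dx _))//.
      by rewrite lerDr.
    by move=> [n _ /=]; rewrite in_itv/= => /andP[].
  apply: ge0_nondecreasing_set_cvg_integral => //.
  - move=> k n kn; apply/subsetPset => x /=; rewrite !in_itv/= => /andP[-> xm].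
    by rewrite (le_trans xm)// ler_expR ler_nat.
  - by move=> n x _; rewrite lee_fin powR_ge0.
move=> Scvg; apply: (@le_lt_trans _ _ (expR (a * m%:R) + expR a * B)%:E); last by rewrite ltry.
by apply: (cvge_to_le Scvg); exact: nearW.
Qed.

End tail_lemmas.

(** * Covering by a staircase of rectangles *)

Lemma le_telescope (R : realType) (a : nat -> \bar R) (b : nat -> R) (k m : nat) :
  (forall i, a i <= a i.+1 + (b i)%:E)%E -> (k <= m)%N ->
  (a k <= a m + (\sum_(k <= i < m) b i)%:E)%E.
Proof.
move=> ab; elim: m => [|m IH].
  by rewrite leqn0 => /eqP ->; rewrite big_geq// adde0.
rewrite leq_eqVlt => /predU1P[->|]; first by rewrite big_geq// adde0.
rewrite ltnS => km; apply: (le_trans (IH km)).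
rewrite big_nat_recr//= EFinD [X in (_ <= _ + X)%E]addeC addeA.
by apply: leeD.
Qed.

(* Starting from both coordinates above e^k, each step raises one threshold from e^i
   to e^(i+1); what is lost lies in a rectangle {x > e^i, y > e^(v-i-1)}. *)
Section union_bound.
Context {R : realType} (mu nu : probability R R) (v : R).

Let g (x : R) := tail R mu (expR x).
Let h (x : R) := tail R nu (expR x).

Let D (x y : R) : set (R * R) :=
  (`]expR x, +oo[%classic `*` `]expR y, +oo[%classic) `&` prod_gt R (expR v).

Let mD (x y : R) : measurable (D x y).
Proof.
apply: measurableI; last exact: measurable_prod_gt.
by apply: measurableX; exact: measurable_itv.
Qed.

Let rect (x y : R) :
  ((mu \x nu) (`]expR x, +oo[%classic `*` `]expR y, +oo[%classic) = (g x * h y)%:E)%E.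
Proof. by rewrite product_measure1E// EFinM -!tailE. Qed.

Let staircase_stepx (i : nat) (y : R) :
  ((mu \x nu) (D i%:R y) <= (mu \x nu) (D i.+1%:R y) + (g i%:R * h (v - i%:R - 1))%:E)%E.
Proof.
have mR : measurable
    (`]expR i%:R, +oo[%classic `*` `]expR (v - i%:R - 1), +oo[%classic : set (R * R)).
  by apply: measurableX; exact: measurable_itv.
rewrite -rect; apply: (le_trans _ (measureU2 _ (mD _ _) mR)).
apply: le_measure; rewrite ?inE//; first exact: measurableU.
move=> [a b] []/=; rewrite !in_itv/= !andbT => -[ia yb] vab.
have a0 : 0 < a by rewrite (lt_trans _ ia)// expR_gt0.
have [ia1|ai] := ltP (expR i.+1%:R) a.
  by left; split; [split; rewrite /= ?in_itv/= ?andbT|exact: vab].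
right; split; rewrite /= ?in_itv/= ?andbT//.
rewrite -(@ltr_pM2l _ (expR i.+1%:R)) ?expR_gt0// -expRD.
have -> : i.+1%:R + (v - i%:R - 1) = v by rewrite -natr1; ring.
apply: (lt_le_trans vab); rewrite /= ler_wpM2r//.
by rewrite ltW// (lt_trans _ yb)// expR_gt0.
Qed.

Let staircase_stepy (x : R) (j : nat) :
  ((mu \x nu) (D x j%:R) <= (mu \x nu) (D x j.+1%:R) + (h j%:R * g (v - j%:R - 1))%:E)%E.
Proof.
have mR : measurable
    (`]expR (v - j%:R - 1), +oo[%classic `*` `]expR j%:R, +oo[%classic : set (R * R)).
  by apply: measurableX; exact: measurable_itv.
rewrite mulrC -rect; apply: (le_trans _ (measureU2 _ (mD _ _) mR)).
apply: le_measure; rewrite ?inE//; first exact: measurableU.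
move=> [a b] []/=; rewrite !in_itv/= !andbT => -[xa jb] vab.
have b0 : 0 < b by rewrite (lt_trans _ jb)// expR_gt0.
have [jb1|bj] := ltP (expR j.+1%:R) b.
  by left; split; [split; rewrite /= ?in_itv/= ?andbT|exact: vab].
right; split; rewrite /= ?in_itv/= ?andbT//.
rewrite -(@ltr_pM2r _ (expR j.+1%:R)) ?expR_gt0// -expRD.
have -> : v - j%:R - 1 + j.+1%:R = v by rewrite -natr1; ring.
apply: (lt_le_trans vab); rewrite /= ler_wpM2l//.
by rewrite ltW// (lt_trans _ xa)// expR_gt0.
Qed.

Lemma both_large_le (k I J : nat) : (k <= I)%N -> (k <= J)%N ->
  ((mu \x nu) (both_large R (expR k%:R) (expR v)) <=
   (\sum_(k <= i < I) g i%:R * h (v - i%:R - 1) +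
    \sum_(k <= j < J) h j%:R * g (v - j%:R - 1) + g I%:R * h J%:R)%:E)%E.
Proof.
move=> kI kJ.
have -> : both_large R (expR k%:R) (expR v) = D k%:R k%:R.
  apply/seteqP; split=> -[a b]; rewrite /both_large /D /prod_gt/= !in_itv/= !andbT.
    by case.
  by move=> [[]].
have HI := @le_telescope R (fun i => (mu \x nu)%E (D i%:R k%:R)) _ k I
  (fun i => staircase_stepx i k%:R) kI.
have HJ := @le_telescope R (fun j => (mu \x nu)%E (D I%:R j%:R)) _ k J
  (fun j => staircase_stepy I%:R j) kJ.
apply: (le_trans HI); rewrite -[X in (_ <= X%:E)%E]addrA [X in (_ <= X%:E)%E]addrC EFinD.
apply: leeD; last exact: lexx.
apply: (le_trans HJ); rewrite [X in (_ <= X%:E)%E]addrC EFinD; apply: leeD; last exact: lexx.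
rewrite -rect; apply: le_measure; rewrite ?inE//; last exact: subIsetl.
by apply: measurableX; exact: measurable_itv.
Qed.

End union_bound.

Lemma negligible_both_large (R : realType) (mu nu : probability R R)
    (s N : nat -> R) (N' : R -> R) :
  (forall n, 0 < s n) -> s n @[n --> \oo] --> +oo ->
  (\forall n \near \oo, N' (ln (s n)) <= N n) ->
  (forall e : R, 0 < e -> exists (k : nat) (V : R), forall v, V <= v ->
    exists I J : nat, [/\ (k <= I)%N, (k <= J)%N &
    \sum_(k <= i < I) tail R mu (expR i%:R) * tail R nu (expR (v - i%:R - 1)) +
    \sum_(k <= j < J) tail R nu (expR j%:R) * tail R mu (expR (v - j%:R - 1)) +
    tail R mu (expR I%:R) * tail R nu (expR J%:R) <= e * N' v]) ->
  forall e : R, 0 < e -> exists K0, forall K, K0 <= K ->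
  \forall n \near \oo, ((mu \x nu) (both_large R K (s n)) <= (e * N n)%:E)%E.
Proof.
move=> s0 soo NN H e e0; have [k [V HV]] := H e e0.
exists (expR k%:R) => K kK.
have sV : \forall n \near \oo, expR V <= s n by move/cvgryPge : soo; exact.
near=> n.
have snV : expR V <= s n by near: n.
have Vs : V <= ln (s n) by rewrite -ler_expR lnK ?posrE.
have [I [J [kI kJ HIJ]]] := HV _ Vs.
apply: (@le_trans _ _ ((mu \x nu)%E (both_large R (expR k%:R) (s n)))).
  apply: le_measure; rewrite ?inE; [exact: measurable_both_large..|].
  move=> z [z1 z2 z3]; split => //; exact: le_lt_trans kK _.
have {1}<- : expR (ln (s n)) = s n by rewrite lnK ?posrE.
apply: (le_trans (both_large_le mu nu (ln (s n)) k I J kI kJ)).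
rewrite lee_fin (le_trans HIJ)// ler_pM2l//.
by near: n.
Unshelve. all: by end_near. Qed.

(** * Laws of a given tail index and normalisation of the product tail *)

Record rv_tail (R : realType) (mu : probability R R) (L : R -> R) (a : R) : Prop := {
  rv_tail_slow : slowly_varying L;
  rv_tail_gt0 : 0 < a;
  rv_tail_eq : forall t, 1 < t -> tail R mu t = L t * t `^ (- a) }.

Section rv_tail_theory.
Context {R : realType} (mu : probability R R) (L : R -> R) (a : R).
Hypothesis muP : rv_tail R mu L a.

Lemma rv_tail_pos (s : R) : 0 < tail R mu s.
Proof.
have [[[X [_ XL]] _] _ tE] := muP.
pose t := Num.max (Num.max X 2) s.
have Xt : X <= t by rewrite /t !le_max lexx.
have t2 : 2 <= t by rewrite /t !le_max lexx orbT.
have st : s <= t by rewrite /t !le_max lexx !orbT.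
have t1 : 1 < t by lra.
apply: (lt_le_trans _ (tail_ni mu s t st)).
by rewrite tE// mulr_gt0 ?XL// powR_gt0//; lra.
Qed.

Lemma rv_tail_ratio (y : R) : 0 < y ->
  tail R mu (s / y) / tail R mu s @[s --> +oo] --> y `^ a.
Proof.
move=> y0; have [[[X [_ XL]] Lr] a0 tE] := muP.
have iy0 : 0 < y^-1 by rewrite invr_gt0.
have := Lr _ iy0; rewrite powRr0 => h.
have : L (y^-1 * s) / L s * y `^ a @[s --> +oo] --> 1 * y `^ a.
  by apply: cvgM => //; exact: cvg_cst.
rewrite mul1r; apply: cvg_trans; apply: near_eq_cvg.
apply/near_pinfty_geP; exists (Num.max (Num.max X 2) (2 * y)) => s.
rewrite !ge_max => /andP[/andP[Xs s2] ys].
have s0 : 0 < s by lra.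
have sy1 : 1 < s / y by rewrite ltr_pdivlMr//; lra.
have s1 : 1 < s by lra.
rewrite !tE// [y^-1 * s]mulrC.
have -> : (s / y) `^ (- a) = s `^ (- a) * y `^ a.
  by rewrite powRM ?ltW// -powR_inv1 ?ltW// -powRrM mulN1r opprK.
have Ls : L s != 0 by rewrite gt_eqF// XL.
have sa : s `^ (- a) != 0 by rewrite gt_eqF// powR_gt0.
by field; rewrite Ls sa.
Qed.

(** This is [L (expR v)] for v > 0. Going through the tail gives positivity everywhere and the
    growth bound of [log_slow], neither of which is immediate from [L]. *)
Definition log_tail (v : R) : R := tail R mu (expR v) * expR (a * v).

Lemma tail_log (v : R) : tail R mu (expR v) = log_tail v * expR (- (a * v)).
Proof. by rewrite /log_tail -mulrA -expRD subrr expR0 mulr1. Qed.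

Lemma log_tailE (v : R) : 0 < v -> log_tail v = L (expR v).
Proof.
move=> v0; have [_ _ tE] := muP.
rewrite /log_tail tE; last by rewrite -expR0 ltr_expR.
rewrite /powR gt_eqF ?expR_gt0// expRK mulNr -mulrA -expRD addrC subrr.
by rewrite expR0 mulr1.
Qed.

Lemma log_slow_tail (g : R) : regularly_varying g (fun v => L (expR v)) ->
  log_slow R a g 0 log_tail.
Proof.
move=> [_ Lg]; split => //.
- by move=> v _; rewrite mulr_gt0 ?rv_tail_pos ?expR_gt0.
- move=> w h w0 h0; rewrite /log_tail.
  rewrite [expR (a * (w + h))](_ : _ = expR (a * h) * expR (a * w)).
    rewrite [leLHS]mulrCA.
    rewrite ler_pM2l ?expR_gt0// ler_pM2r ?expR_gt0//.
    by apply: tail_ni; rewrite ler_expR lerDl.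
  by rewrite -expRD; congr expR; ring.
- move=> b b0; have := Lg b b0; apply: cvg_trans; apply: near_eq_cvg.
  apply/near_pinfty_geP; exists 1 => v v1.
  by rewrite !log_tailE ?mulr_gt0//; lra.
Qed.

(** A one-step Potter bound: the ratio of the tails at e^v and e^(v+1) tends to e^a, which is below
    e^b. *)
Lemma rv_tail_step_le (b : R) : a < b -> exists v0, forall v, v0 <= v ->
  tail R mu (expR v) <= expR b * tail R mu (expR (v + 1)).
Proof.
move=> ab.
have h := rv_tail_ratio (expR 1) (expR_gt0 1).
have eb : expR 1 `^ a < expR b.
  by rewrite /powR gt_eqF ?expR_gt0// expRK mulr1 ltr_expR.
have : \forall s \near +oo, tail R mu (s / expR 1) / tail R mu s <= expR b.
  exact: (@cvgr_le _ _ _ _ _ _ h _ eb).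
move=> /near_pinfty_geP[S HS].
exists `|S| => v Sv.
have Se : S <= expR (v + 1).
  rewrite (le_trans (ler_norm S))// (le_trans Sv)// (le_trans _ (expR_ge1Dx _))//; lra.
have := HS _ Se; rewrite ler_pdivrMr ?rv_tail_pos//.
by rewrite expRD mulfK// gt_eqF// expR_gt0.
Qed.

Lemma rv_tail_step_ge (c : R) : c < a -> exists v0, forall v, v0 <= v ->
  tail R mu (expR (v + 1)) <= expR (- c) * tail R mu (expR v).
Proof.
move=> ca.
have h := rv_tail_ratio (expR 1) (expR_gt0 1).
have ec : expR c < expR 1 `^ a.
  by rewrite /powR gt_eqF ?expR_gt0// expRK mulr1 ltr_expR.
have : \forall s \near +oo, expR c <= tail R mu (s / expR 1) / tail R mu s.
  exact: (@cvgr_ge _ _ _ _ _ _ h _ ec).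
move=> /near_pinfty_geP[S HS].
exists `|S| => v Sv.
have Se : S <= expR (v + 1).
  rewrite (le_trans (ler_norm S))// (le_trans Sv)// (le_trans _ (expR_ge1Dx _))//; lra.
have := HS _ Se; rewrite ler_pdivlMr ?rv_tail_pos//.
rewrite [expR (v + 1) / _](_ : _ = expR v); last by rewrite expRD mulfK// gt_eqF// expR_gt0.
by rewrite expRN ler_pdivlMl ?expR_gt0.
Qed.

Lemma lt_rv_tail_moment (b : R) : 0 < b -> b < a -> (moment_pos mu b < +oo)%E.
Proof.
move=> b0 ba; pose c := (a + b) / 2.
have ca : c < a by rewrite /c; lra.
have [v0 Hv0] := rv_tail_step_ge c ca.
pose m := (Num.truncn v0).+1.
pose u j := expR (b * j%:R) * tail R mu (expR j%:R).
have u0 j : (m <= j)%N -> 0 <= u j by move=> _; rewrite mulr_ge0 ?expR_ge0 ?tail_ge0.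
have q1 : expR (b - c) < 1 by rewrite -expR0 ltr_expR /c; lra.
have uq j : (m <= j)%N -> u j.+1 <= expR (b - c) * u j.
  move=> mj; have vj : v0 <= j%:R.
    by rewrite (le_trans (ltW (truncnS_gt v0)))// ler_nat.
  have := ler_wpM2l (expR_ge0 (b * j.+1%:R)) (Hv0 _ vj); rewrite natr1 => /le_trans; apply.
  rewrite /u !mulrA -!expRD.
  by have -> : b * j.+1%:R - c = b - c + b * j%:R by rewrite -natr1; ring.
exact: (sum_bounded_moment mu b m _ b0 (ratio_sum_bounded _ _ _ _ q1 u0 uq)).
Qed.

End rv_tail_theory.

(* N s is a normalisation of the order of P(XY > s); p and r are the weights of the
   events {Y large} and {X large}; [asymp_neg] is the staircase bound for the event
   that both are large. *)
Record asymp (R : realType) (mu nu : probability R R) (a : R) (N : R -> R)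
    (p r : R) : Prop := {
  asymp_pos : \forall s \near +oo, 0 < N s ;
  asymp_nu : forall x, 0 < x -> tail R nu (s / x) / N s @[s --> +oo] --> p * x `^ a ;
  asymp_mu : forall y, 0 < y -> tail R mu (s / y) / N s @[s --> +oo] --> r * y `^ a ;
  asymp_neg : forall e, 0 < e -> exists (k : nat) (V : R), forall v, V <= v ->
    exists I J : nat, [/\ (k <= I)%N, (k <= J)%N &
    \sum_(k <= i < I) tail R mu (expR i%:R) * tail R nu (expR (v - i%:R - 1)) +
    \sum_(k <= j < J) tail R nu (expR j%:R) * tail R mu (expR (v - j%:R - 1)) +
    tail R mu (expR I%:R) * tail R nu (expR J%:R) <= e * N (expR v)] }.

Lemma asymp_sym (R : realType) (mu nu : probability R R) (a : R) (N : R -> R)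
  (p r : R) : asymp R mu nu a N p r -> asymp R nu mu a N r p.
Proof.
move=> [Npos Hnu Hmu Hneg]; split => // e e0.
have [k [V HV]] := Hneg e e0; exists k, V => v Vv.
have [I [J [kI kJ HIJ]]] := HV v Vv; exists J, I; split => //.
by rewrite [X in X + _]addrC [X in _ + X <= _]mulrC.
Qed.

Lemma tail_ratio_cvg0 (R : realType) (mu nu : probability R R) :
  (forall s, 0 < tail R mu s) ->
  (forall e : R, 0 < e -> exists V : R, forall v : R, V <= v ->
    tail R nu (expR v) <= e * tail R mu (expR v)) ->
  tail R nu s / tail R mu s @[s --> +oo] --> 0.
Proof.
move=> mu0 H; apply/cvgr0Pnorm_le => e e0.
have [V HV] := H e e0.
apply/near_pinfty_geP; exists (expR V) => s Vs.
have s0 : 0 < s by rewrite (lt_le_trans _ Vs)// expR_gt0.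
rewrite ger0_norm ?divr_ge0 ?tail_ge0// ler_pdivrMr//.
have -> : s = expR (ln s) by rewrite lnK ?posrE.
by apply: HV; rewrite -ler_expR lnK ?posrE.
Qed.

Lemma tail_ratio_scaled (R : realType) (nu : probability R R) (L : R -> R) (b : R)
  (N : R -> R) (l x : R) : rv_tail R nu L b -> 0 < x ->
  tail R nu s / N s @[s --> +oo] --> l ->
  tail R nu (s / x) / N s @[s --> +oo] --> l * x `^ b.
Proof.
move=> nuP x0 H; rewrite mulrC.
have : tail R nu (s / x) / tail R nu s * (tail R nu s / N s) @[s --> +oo]
    --> x `^ b * l by apply: cvgM => //; exact: (rv_tail_ratio nu L b nuP).
apply: cvg_trans; apply: near_eq_cvg; apply: nearW => s.
by rewrite mulrA divfK// gt_eqF// (rv_tail_pos nu L b nuP).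
Qed.

(** The heavier tail, that of mu, fixes the normalisation. The constant c is meant to be the moment
    of nu, so that the limiting weight c^-1 times this moment is 1. *)
Lemma asymp_lt (R : realType) (mu nu : probability R R) (L1 L2 : R -> R)
    (a b c : R) : rv_tail R mu L1 a -> rv_tail R nu L2 b -> a < b -> 0 < c ->
  asymp R mu nu a (fun s => c * tail R mu s) 0 c^-1.
Proof.
move=> muP nuP ab c0.
have mu0 := rv_tail_pos mu L1 a muP.
(* Two exponents strictly between the indices: the gap b1 < b2 is the rate of the geometric sums,
   and the outer gaps leave room for the one-step bounds. *)
pose b1 := (2 * a + b) / 3; pose b2 := (a + 2 * b) / 3.
have ab1 : a < b1 by rewrite /b1; lra.
have b12 : b1 < b2 by rewrite /b1 /b2; lra.
have b2b : b2 < b by rewrite /b2; lra.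
have [v1 Hv1] := rv_tail_step_le mu L1 a muP b1 ab1.
have [v2 Hv2] := rv_tail_step_ge nu L2 b nuP b2 b2b.
pose v0 := Num.max v1 v2.
have gs v : v0 <= v -> tail R mu (expR v) <= expR b1 * tail R mu (expR (v + 1)).
  by rewrite ge_max => /andP[v1v _]; exact: Hv1.
have hs v : v0 <= v -> tail R nu (expR (v + 1)) <= expR (- b2) * tail R nu (expR v).
  by rewrite ge_max => /andP[_ v2v]; exact: Hv2.
have gni v w : v <= w -> tail R mu (expR w) <= tail R mu (expR v).
  by move=> vw; apply: tail_ni; rewrite ler_expR.
have hni v w : v <= w -> tail R nu (expR w) <= tail R nu (expR v).
  by move=> vw; apply: tail_ni; rewrite ler_expR.
have ratio0 : tail R nu s / tail R mu s @[s --> +oo] --> 0.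
  apply: tail_ratio_cvg0 => //.
  exact: (tail_negligible (fun v => tail R mu (expR v)) (fun v => tail R nu (expR v))
    b1 b2 v0 b12 (fun v => mu0 _) (fun v => tail_ge0 nu _) gni hni gs hs).
split.
- by apply: nearW => s; rewrite mulr_gt0.
(* The limit is 0 whatever the exponent, so the index b of nu, for which the scaling lemma holds,
   replaces a. *)
- move=> x x0; rewrite mul0r -(mul0r (x `^ b)).
  apply: (tail_ratio_scaled _ _ L2) => //.
  rewrite -[0](mulr0 c^-1).
  have : c^-1 * (tail R nu s / tail R mu s) @[s --> +oo] --> c^-1 * 0.
    by apply: cvgM => //; exact: cvg_cst.
  apply: cvg_trans; apply: near_eq_cvg; apply: nearW => s.
  by rewrite invfM mulrCA mulrA.
- move=> y y0; apply: (tail_ratio_scaled _ _ L1) => //.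
  have : (c^-1 : R) @[s --> (+oo : set_system R)] --> c^-1 by exact: cvg_cst.
  apply: cvg_trans; apply: near_eq_cvg; apply: nearW => s.
  by rewrite invfM mulrCA divff ?mulr1// gt_eqF.
- move=> e e0.
  have [k [V HV]] := both_large_distinct (fun v => tail R mu (expR v))
    (fun v => tail R nu (expR v))
    b1 b2 v0 b12 (fun v => mu0 _) (fun v => tail_ge0 nu _) gni hni gs hs
    (e * c) (mulr_gt0 e0 c0).
  exists k, V => v Vv; have [J [kJ HJ]] := HV v Vv.
  exists k, J; split => //; rewrite big_geq// add0r mulrA.
  exact: HJ.
Qed.

Section equal_index_cases.
Context {R : realType} (mu nu : probability R R) (L1 L2 : R -> R) (a g1 g2 : R).
Hypothesis muP : rv_tail R mu L1 a.
Hypothesis nuP : rv_tail R nu L2 a.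
Hypothesis L1P : regularly_varying g1 (fun v => L1 (expR v)).
Hypothesis L2P : regularly_varying g2 (fun v => L2 (expR v)).

Let l1 := log_tail mu a.
Let l2 := log_tail nu a.
Let mu0 := rv_tail_pos mu L1 a muP.
Let nu0 := rv_tail_pos nu L2 a nuP.
Let a0 : 0 < a := rv_tail_gt0 _ _ _ _ muP.

Let ls1 : log_slow R a g1 0 l1 := log_slow_tail mu L1 a muP g1 L1P.
Let ls2 : log_slow R a g2 0 l2 := log_slow_tail nu L2 a nuP g2 L2P.

Lemma log_tail_sum_bounded (m : probability R R) : (moment_pos m a < +oo)%E ->
  exists B, forall n, \sum_(0 <= j < n) log_tail m a j%:R <= B.
Proof.
move=> fin; have [B HB] := moment_sum_bounded m a a0 fin.
exists B => n; apply: le_trans (HB n); rewrite le_eqVlt; apply/orP; left.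
by apply/eqP/eq_bigr => j _; rewrite /log_tail mulrC.
Qed.

Lemma index_gt_of_infinite_moment : moment_pos nu a = +oo%E -> g2 != -1 -> - 1 < g2.
Proof.
move=> inf g2n; rewrite lt_neqAle eq_sym g2n/= leNgt; apply/negP => g2lt.
have [V20 l20 l2i l2r] := ls2.
have [B [m [_ HB]]] := rv_lt_sum_bounded _ _ _ _ V20 l20 l2i l2r g2lt.
have : (moment_pos nu a < +oo)%E.
  apply: (sum_bounded_moment nu a m B a0) => n.
  apply: le_trans (HB n); rewrite le_eqVlt; apply/orP; left.
  by apply/eqP/eq_bigr => j _; rewrite /l2 /log_tail mulrC.
by rewrite inf ltxx.
Qed.

(** The exponential factors multiply to e^(-a (v - 1)) on each step of the staircase and to e^(-2 a
    J) on the last rectangle. Since J > v / 2 - 1, all are at most e^(2a) e^(-a v). *)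
Lemma tail_sums_of_log (k : nat) (v e : R) : 0 <= v -> let J := Num.truncn (v / 2) in
  \sum_(k <= i < J) l1 i%:R * l2 (v - i%:R - 1) +
  \sum_(k <= j < J) l2 j%:R * l1 (v - j%:R - 1) + l1 J%:R * l2 J%:R <= e ->
  \sum_(k <= i < J) tail R mu (expR i%:R) * tail R nu (expR (v - i%:R - 1)) +
  \sum_(k <= j < J) tail R nu (expR j%:R) * tail R mu (expR (v - j%:R - 1)) +
  tail R mu (expR J%:R) * tail R nu (expR J%:R)
  <= expR (2 * a) * expR (- (a * v)) * e.
Proof.
move=> v0 J He.
have C0 : 0 <= expR (2 * a) * expR (- (a * v)) by rewrite mulr_ge0// expR_ge0.
apply: (le_trans _ (ler_wpM2l C0 He)); rewrite !mulrDr.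
have l10 x : 0 <= l1 x by rewrite mulr_ge0 ?expR_ge0 ?tail_ge0.
have l20 x : 0 <= l2 x by rewrite mulr_ge0 ?expR_ge0 ?tail_ge0.
apply: lerD; first apply: lerD.
- rewrite mulr_sumr; apply: ler_sum => i _.
  rewrite !(tail_log _ a) mulrACA -expRD [leRHS]mulrC -expRD.
  apply: ler_wpM2l; [by rewrite mulr_ge0|rewrite ler_expR].
  by have := a0; lra.
- rewrite mulr_sumr; apply: ler_sum => i _.
  rewrite !(tail_log _ a) mulrACA -expRD [leRHS]mulrC -expRD.
  apply: ler_wpM2l; [by rewrite mulr_ge0|rewrite ler_expR].
  by have := a0; lra.
- rewrite !(tail_log _ a) mulrACA -expRD [leRHS]mulrC -expRD.
  apply: ler_wpM2l; [by rewrite mulr_ge0|rewrite ler_expR].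
  have vJ : v / 2 < J%:R + 1 by rewrite natr1 truncnS_gt.
  have : a * (v / 2) <= a * (J%:R + 1) by rewrite ler_pM2l// ltW.
  lra.
Qed.

Lemma asymp_one (c : R) : 0 < c -> (moment_pos mu a < +oo)%E -> - 1 < g2 ->
  asymp R mu nu a (fun s => c * tail R nu s) c^-1 0.
Proof.
move=> c0 fin g2gt.
have [B HB] := log_tail_sum_bounded mu fin.
have ratio0 : tail R mu s / tail R nu s @[s --> +oo] --> 0.
  apply: tail_ratio_cvg0 => // e e0.
  have [V HV] := summable_negligible l1 l2 a g1 g2 0 0 ls1 ls2 0 B (lexx _) HB g2gt e e0.
  exists V => v Vv; rewrite !(tail_log _ a) mulrA ler_pM2r ?expR_gt0//.
  exact: HV.
split.
- by apply: nearW => s; rewrite mulr_gt0.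
- move=> x x0; apply: (tail_ratio_scaled _ _ L2) => //.
  have : (c^-1 : R) @[s --> (+oo : set_system R)] --> c^-1 by exact: cvg_cst.
  apply: cvg_trans; apply: near_eq_cvg; apply: nearW => s.
  by rewrite invfM mulrCA divff ?mulr1// gt_eqF.
- move=> y y0; apply: (tail_ratio_scaled _ _ L1) => //.
  rewrite -[0](mulr0 c^-1).
  have : c^-1 * (tail R mu s / tail R nu s) @[s --> +oo] --> c^-1 * 0.
    by apply: cvgM => //; exact: cvg_cst.
  apply: cvg_trans; apply: near_eq_cvg; apply: nearW => s.
  by rewrite invfM mulrCA mulrA.
- move=> e e0.
  (* Compensates the loss e^(2a) of [tail_sums_of_log] and supplies the factor c of the
     normalisation. *)
  have e1 : 0 < e * c / expR (2 * a) by rewrite divr_gt0 ?expR_gt0// mulr_gt0.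
  have [k [V HV]] := both_large_one_summable l1 l2 a g1 g2 0 0 ls1 ls2 0 B
    (lexx _) HB g2gt _ e1.
  exists k, (Num.max V (2 * k%:R)) => v; rewrite ge_max => /andP[Vv kv].
  have k0 : (0 : R) <= k%:R by [].
  have v0 : 0 <= v by lra.
  have kJ : (k <= Num.truncn (v / 2))%N by rewrite truncn_ge_nat; lra.
  exists (Num.truncn (v / 2)), (Num.truncn (v / 2)); split => //.
  apply: (le_trans (tail_sums_of_log k v _ v0 (HV v Vv))).
  rewrite (tail_log nu a) -/l2 le_eqVlt; apply/orP; left; apply/eqP.
  by field; rewrite gt_eqF// expR_gt0.
Qed.

(** For large s the power s^(-a) cancels between numerator and denominator, so the share of mu in
    the normalisation is [weight] itself; the share of nu is its complement. *)
Lemma asymp_both (cE cI q : R) : 0 < cE -> 0 < cI ->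
  (moment_pos mu a < +oo)%E -> (moment_pos nu a < +oo)%E ->
  weight cE cI L1 L2 t @[t --> +oo] --> q ->
  asymp R mu nu a (fun s => cE * tail R nu s + cI * tail R mu s) ((1 - q) / cE) (q / cI).
Proof.
move=> cE0 cI0 fin1 fin2 wq.
have [B1 HB1] := log_tail_sum_bounded mu fin1.
have [B2 HB2] := log_tail_sum_bounded nu fin2.
have N0 s : 0 < cE * tail R nu s + cI * tail R mu s.
  by rewrite addr_gt0// mulr_gt0.
have w : cI * tail R mu s / (cE * tail R nu s + cI * tail R mu s) @[s --> +oo] --> q.
  apply: cvg_trans wq; apply: near_eq_cvg.
  apply/near_pinfty_geP; exists 2 => s s2; rewrite /weight.
  have s1 : 1 < s by lra.
  have [_ _ E1] := muP; have [_ _ E2] := nuP.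
  have := N0 s; rewrite E1// E2//.
  have sa : 0 < s `^ (- a) by rewrite powR_gt0//; lra.
  rewrite !mulrA -mulrDl => h.
  have h' : 0 < cE * L2 s + cI * L1 s by rewrite pmulr_lgt0 in h.
  by field; rewrite !gt_eqF.
split.
- exact: nearW.
- move=> x x0; apply: (tail_ratio_scaled _ _ L2) => //.
  have : (1 - cI * tail R mu s / (cE * tail R nu s + cI * tail R mu s)) / cE @[s --> +oo]
      --> (1 - q) / cE.
    by apply: cvgM; [apply: cvgB => //; exact: cvg_cst|exact: cvg_cst].
  apply: cvg_trans; apply: near_eq_cvg; apply: nearW => s.
  by field; rewrite !gt_eqF.
- move=> y y0; apply: (tail_ratio_scaled _ _ L1) => //.
  have : cI * tail R mu s / (cE * tail R nu s + cI * tail R mu s) / cI @[s --> +oo]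
      --> q / cI.
    by apply: cvgM => //; exact: cvg_cst.
  apply: cvg_trans; apply: near_eq_cvg; apply: nearW => s.
  by field; rewrite !gt_eqF.
- move=> e e0.
  (* The sums are bounded by a multiple of the plain sum of the two tails, and c times that sum is
     at most the normalisation. *)
  pose c := Num.min cE cI.
  have c0 : 0 < c by rewrite lt_min cE0.
  have e1 : 0 < e * c / expR (2 * a) by rewrite divr_gt0 ?expR_gt0// mulr_gt0.
  have [k [V HV]] := both_large_summable l1 l2 a g1 g2 0 0 ls1 ls2 0 0 B1 B2
    (lexx _) HB1 (lexx _) HB2 _ e1.
  exists k, (Num.max V (2 * k%:R)) => v; rewrite ge_max => /andP[Vv kv].
  have k0 : (0 : R) <= k%:R by [].
  have v0 : 0 <= v by lra.
  have kJ : (k <= Num.truncn (v / 2))%N by rewrite truncn_ge_nat; lra.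
  exists (Num.truncn (v / 2)), (Num.truncn (v / 2)); split => //.
  apply: (le_trans (tail_sums_of_log k v _ v0 (HV v Vv))).
  apply: (@le_trans _ _ (e * (c * tail R nu (expR v) + c * tail R mu (expR v)))).
    rewrite (tail_log nu a) (tail_log mu a) -/l2 le_eqVlt; apply/orP; left; apply/eqP.
    by rewrite -/l1; field; rewrite gt_eqF// expR_gt0.
  rewrite ler_pM2l//; apply: lerD; rewrite ler_pM2r// ge_min lexx ?orbT//.
Qed.

End equal_index_cases.

(** * Functions on the quadrant *)

Lemma within_continuous_cvg (T : topologicalType) (U : topologicalType)
    (A : set T) (f : T -> U) (I : Type) (F : set_system I) (u : I -> T) (p : T) :
  Filter F -> {within A, continuous f} -> A p -> (\forall i \near F, A (u i)) ->
  u i @[i --> F] --> p -> f (u i) @[i --> F] --> f p.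
Proof.
move=> FF /subspace_continuousP fc Ap Au up V /(fc p Ap) fV.
have : \forall i \near F, A (u i) -> V (f (u i)) by exact: (up _ fV).
by move=> h; apply: filterS2 Au h => i Ai /(_ Ai).
Qed.

Lemma measurable_fun_nat2 d (U : measurableType d) (h : nat * nat -> U) :
  measurable_fun setT h.
Proof.
move=> _ Y mY; rewrite setTI.
have -> : h @^-1` Y = \bigcup_a \bigcup_(b in [set b | Y (h (a, b))]) ([set a] `*` [set b]).
  apply/seteqP; split => [[a b] /= Yab|]; first by exists a => //; exists b.
  by move=> [a b] [a' _ [b' /= Yb [/= -> ->]]].
apply: bigcupT_measurable => a; apply: bigcup_measurable => b _.
exact: measurableX.
Qed.

Lemma measurable_fun_natP d (T : measurableType d) (k : T -> nat) :
  (forall n, measurable [set x | k x = n]) -> measurable_fun setT k.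
Proof.
move=> mk _ Y _; rewrite setTI.
have -> : k @^-1` Y = \bigcup_(n in Y) [set x | k x = n].
  by apply/seteqP; split => [x /= Yx|x [n Yn /= ->]//]; exists (k x).
exact: bigcup_measurable.
Qed.

Lemma measurable_truncn (R : realType) : measurable_fun setT (@Num.truncn R).
Proof.
have mge n : measurable [set x : R | (n < Num.truncn x)%N].
  have -> : [set x : R | (n < Num.truncn x)%N] = `[n.+1%:R, +oo[%classic.
    apply/seteqP; split => x /=; rewrite in_itv/= andbT.
      move=> nx; rewrite (@le_trans _ _ (Num.truncn x)%:R) ?ler_nat// truncn_le.
      have : (0 < Num.truncn x)%N by exact: leq_ltn_trans nx.
      by rewrite truncn_gt0; exact: le_trans.
    by move=> nx; rewrite truncn_ge_nat// (le_trans _ nx).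
  exact: measurable_itv.
apply: measurable_fun_natP => -[|n].
  have -> : [set x : R | Num.truncn x = 0%N] = ~` [set x : R | (0 < Num.truncn x)%N].
    by apply/seteqP; split => x /=; [move=> ->|move/negP; rewrite -leqNgt leqn0 => /eqP].
  exact: measurableC.
have -> : [set x : R | Num.truncn x = n.+1] =
    [set x : R | (n < Num.truncn x)%N] `\` [set x : R | (n.+1 < Num.truncn x)%N].
  apply/seteqP; split => x /=; first by move=> ->; split => //; rewrite ltnn.
  by move=> [h1 /negP]; rewrite -leqNgt => h2; apply/eqP; rewrite eqn_leq h2.
exact: measurableD.
Qed.

Section quadrant_measurable.
Context {R : realType}.

(* Index and value of the point just above x in the grid of mesh 1/(n+1),
   index 0 standing for the point at infinity. *)
Definition grid_idx (n : nat) (x : \bar R) : nat :=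
  if x == +oo%E then 0%N else (Num.truncn (fine x * n.+1%:R)).+1.

Definition grid_val (n k : nat) : \bar R :=
  if k is 0%N then +oo%E else (k%:R / n.+1%:R)%:E.

Lemma measurable_grid_idx n : measurable_fun setT (grid_idx n).
Proof.
apply: measurable_fun_ifT.
- apply: (measurable_fun_bool true); rewrite setTI.
  rewrite (_ : _ @^-1` _ = [set +oo%E]); first exact: emeasurable_set1.
  by apply/seteqP; split => x /= /eqP.
- exact: measurable_cst.
- have h : measurable_fun setT (fun x : \bar R => Num.truncn (fine x * n.+1%:R)).
    apply: (measurableT_comp (@measurable_truncn R)).
    by apply: measurable_funM => //; exact: measurable_fine.
  exact: (measurableT_comp _ h).
Qed.

Lemma grid_val_gt0 n x : (0 < x)%E -> (0 < grid_val n (grid_idx n x))%E.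
Proof.
move=> x0; rewrite /grid_idx; case: ifPn => _; first exact: ltry.
by rewrite /grid_val lte_fin divr_gt0.
Qed.

Lemma grid_cvg (x : \bar R) : (0 < x)%E -> grid_val n (grid_idx n x) @[n --> \oo] --> x.
Proof.
case: x => [x| |//]; last by rewrite /grid_idx/= => _; exact: cvg_cst.
rewrite lte_fin => x0; apply: cvg_EFin; first exact: nearW.
apply/cvgrPdist_le => e e0.
exists (Num.truncn e^-1) => // n /= en.
have n0 : (0 : R) < n.+1%:R by [].
have h0 : 0 <= x * n.+1%:R by rewrite mulr_ge0// ltW.
have h1 : (Num.truncn (x * n.+1%:R))%:R <= x * n.+1%:R by rewrite truncn_le.
have h2 := truncnS_gt (x * n.+1%:R).
have h3 : e^-1 <= n.+1%:R by rewrite (le_trans (ltW (truncnS_gt _)))// ler_nat.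
have h4 : 1 / n.+1%:R <= e by rewrite div1r -[e]invrK lef_pV2 ?posrE ?invr_gt0.
have h5 : x < (Num.truncn (x * n.+1%:R)).+1%:R / n.+1%:R by rewrite ltr_pdivlMr.
have h6 : (Num.truncn (x * n.+1%:R)).+1%:R / n.+1%:R <= x + 1 / n.+1%:R.
  by rewrite ler_pdivrMr// mulrDl divfK// ?gt_eqF// -natr1 lerD2r.
have dist (v : R) : x < v -> v <= x + 1 / n.+1%:R -> `|x - v| <= e.
  move=> xv vx; rewrite ler_distlC; apply/andP; split.
    by rewrite lerBlDr (le_trans (ltW xv))// lerDl ltW.
  by rewrite (le_trans vx)// lerD2l.
exact: dist.
Qed.

Lemma measurable_quadrant : measurable (@quadrant R).
Proof.
have -> : @quadrant R = `]0%E, +oo[%classic `*` `]0%E, +oo[%classic.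
  by apply/seteqP; split => -[x y]; rewrite /quadrant/= !in_itv/= !andbT => -[].
by apply: measurableX; exact: emeasurable_itv.
Qed.

(** f is the pointwise limit of its values at grid points, each approximation factoring through a
    countable discrete set. The grid point lies above its argument because rounding down could reach
    0, which is outside the quadrant where f is continuous. *)
Lemma measurable_fun_quadrant (f : \bar R * \bar R -> R) :
  {within @quadrant R, continuous f} -> measurable_fun (@quadrant R) f.
Proof.
move=> fc.
pose k n (z : \bar R * \bar R) := (grid_idx n z.1, grid_idx n z.2).
pose h n (ab : nat * nat) := f (grid_val n ab.1, grid_val n ab.2).
apply: (@measurable_fun_cvg _ _ _ _ (fun n z => h n (k n z))).
- move=> n; apply: measurable_funTS; apply: (measurableT_comp (measurable_fun_nat2 _ _ (h n))).
  apply/measurable_fun_pairP; split => /=.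
    exact: (measurableT_comp (measurable_grid_idx n) measurable_fst).
  exact: (measurableT_comp (measurable_grid_idx n) measurable_snd).
- move=> [x y] [/= x0 y0].
  apply: (within_continuous_cvg _ _ _ f _ _ _ (x, y) _ fc) => //.
    by apply: nearW => n; split => /=; exact: grid_val_gt0.
  by apply: cvg_pair => /=; exact: grid_cvg.
Qed.

End quadrant_measurable.

(** * Measures with a density *)

Definition density d (T : measurableType d) (R : realType)
  (mu : {measure set T -> \bar R}) (w : T -> R) : set T -> \bar R :=
  fun A => (\int[mu]_(x in A) (w x)%:E)%E.

Section ge0_integral_density.
Local Open Scope ereal_scope.
Context d (T : measurableType d) (R : realType).
Variables (mu m : {measure set T -> \bar R}) (w : T -> R).
Hypothesis mw : measurable_fun setT w.
Hypothesis w0 : forall x, (0 <= w x)%R.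
Hypothesis mE : forall A, measurable A -> m A = density _ _ _ mu w A.

Import HBNNSimple.

Let mwE D : measurable_fun D (EFin \o w).
Proof. by apply/measurable_EFinP; exact: measurable_funTS. Qed.

Let indic_density E : measurable E ->
  \int[m]_x (\1_E x)%:E = \int[mu]_x ((\1_E x)%:E * (w x)%:E).
Proof.
move=> mE'; rewrite integral_indic// setIT mE// /density integral_mkcond.
apply: eq_integral => x _; rewrite patchE indicE.
by case: ifPn => xE; rewrite ?mul1e ?mul0e.
Qed.

Let nnsfun_density (h : {nnsfun T >-> R}) :
  \int[m]_x (h x)%:E = \int[mu]_x ((h x)%:E * (w x)%:E).
Proof.
under [LHS]eq_integral do rewrite fimfunE -fsumEFin//.
rewrite [LHS]ge0_integral_fsum//; last 2 first.
  - by move=> r; exact/measurable_EFinP/measurableT_comp.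
  - by move=> n x _; rewrite EFinM nnfun_muleindic_ge0.
under [RHS]eq_integral.
  move=> x xD; rewrite fimfunE -fsumEFin// muleC ge0_mule_fsumr; last first.
    by move=> r; rewrite EFinM nnfun_muleindic_ge0.
  over.
rewrite [RHS]ge0_integral_fsum//; last 2 first.
  - move=> r; apply: emeasurable_funM; first exact: mwE.
    by apply/measurable_EFinP; apply/measurableT_comp.
  - move=> n x _; apply: mule_ge0; first by rewrite lee_fin.
    by rewrite EFinM nnfun_muleindic_ge0.
apply: eq_fsbigr => r /[!inE] -[t _ htr].
have r0 : (0 <= r)%R by rewrite -htr.
have mE' : measurable (h @^-1` [set r]) by exact: measurable_funPTI.
have mI : measurable_fun setT (fun x => (\1_(h @^-1` [set r]) x)%:E : \bar R).
  by apply/measurable_EFinP; exact: measurable_indic.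
rewrite (eq_integral (fun x => r%:E * (\1_(h @^-1` [set r]) x)%:E)); last first.
  by move=> x _; rewrite EFinM.
rewrite [RHS](eq_integral (fun x => r%:E * ((\1_(h @^-1` [set r]) x)%:E * (w x)%:E))); last first.
  by move=> x _; rewrite muleC EFinM muleA.
rewrite !ge0_integralZl ?lee_fin//.
- by rewrite indic_density.
- by apply: emeasurable_funM => //; exact: mwE.
- by move=> x _; rewrite mule_ge0// lee_fin.
Qed.

(** The usual passage from indicators to simple functions to monotone limits. Here m is any measure
    agreeing with the density on measurable sets, so that laws and restrictions qualify as they
    are. *)
Lemma ge0_integral_density (f : T -> \bar R) : measurable_fun setT f ->
  (forall x, 0 <= f x) -> \int[m]_x f x = \int[mu]_x (f x * (w x)%:E).
Proof.
move=> mf f0; pose f_ := nnsfun_approx measurableT mf.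
have f_cvg x : (f_ n x)%:E @[n --> \oo] --> f x by exact: cvg_nnsfun_approx.
transitivity (limn (fun n => \int[m]_x (f_ n x)%:E)).
  rewrite -monotone_convergence//=.
  - by apply: eq_integral => x _; apply/esym/cvg_lim => //; exact: f_cvg.
  - by move=> n; exact/measurable_EFinP.
  - by move=> n x _; rewrite lee_fin.
  - by move=> x _ a b ab; rewrite lee_fin//; exact/lefP/nd_nnsfun_approx.
transitivity (limn (fun n => \int[mu]_x ((f_ n x)%:E * (w x)%:E))).
  by congr (limn _); apply/funext => n; exact: nnsfun_density.
rewrite -monotone_convergence//=.
- apply: eq_integral => x _; apply/cvg_lim => //.
  by apply: cvgeZr; [by []|exact: f_cvg].
- move=> n; apply: emeasurable_funM; last exact: mwE.
  exact/measurable_EFinP.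
- by move=> n x _; rewrite mule_ge0 ?lee_fin.
- move=> x _ a b ab; rewrite lee_wpmul2r ?lee_fin//; exact/lefP/nd_nnsfun_approx.
Qed.

End ge0_integral_density.

Section density_measure.
Local Open Scope ereal_scope.
Context d (T : measurableType d) (R : realType).
Variables (mu : {measure set T -> \bar R}) (w : T -> R).
Hypothesis mw : measurable_fun setT w.
Hypothesis w0 : forall x, (0 <= w x)%R.

Let density0 : density _ _ _ mu w set0 = 0.
Proof. by rewrite /density integral_set0. Qed.

Let density_ge0 A : 0 <= density _ _ _ mu w A.
Proof. by apply: integral_ge0 => x _; rewrite lee_fin. Qed.

Let density_sigma_additive : semi_sigma_additive (density _ _ _ mu w).
Proof.
move=> F mF tF mUF; rewrite /density ge0_integral_bigcup//.
- apply: is_cvg_nneseries_cond => n _ _.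
  by apply: integral_ge0 => x _; rewrite lee_fin.
- by apply/measurable_EFinP; exact: measurable_funTS.
- by move=> x _; rewrite lee_fin.
Qed.

HB.instance Definition _ := isMeasure.Build _ _ _
  (density _ _ _ mu w) density0 density_ge0 density_sigma_additive.

Definition density_measure : {measure set T -> \bar R} := density _ _ _ mu w.

End density_measure.

Lemma eq_measure_itvoy (R : realType) (m1 m2 : {measure set R -> \bar R}) :
  (forall u : R, m1 `]u, +oo[%classic = m2 `]u, +oo[%classic) ->
  (forall u : R, m1 `]u, +oo[%classic < +oo)%E ->
  forall A, measurable A -> m1 A = m2 A.
Proof.
move=> m12 m1fin A mA.
apply: (measure_unique (@RGenOInfty.G R) (fun n => `]- n%:R, +oo[%classic)) => //.
- exact: RGenOInfty.measurableE.
- move=> _ _ [x ->] [y ->]; exists (Num.max x y).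
  apply/seteqP; split => z /=; rewrite !in_itv/= !andbT gt_max.
    by move=> [-> ->].
  by move=> /andP[].
- by move=> n; exists (- n%:R).
- apply/seteqP; split => // z _; exists (Num.truncn `|z|).+1 => //=.
  rewrite in_itv/= andbT ltrNl (le_lt_trans (ler_norm (- z)))// normrN.
  exact: truncnS_gt.
- by move=> _ [x ->].
Qed.

(** * Size-biased laws and mixtures *)

Section positive_law.
Context d (T : measurableType d) (R : realType) (P : probability T R).
Variable Y : {RV P >-> R}.
Hypothesis Y_gt0 : forall w, 0 < Y w.

Lemma moment_posE (a : R) : moment_pos (distribution P Y) a = moment P a Y.
Proof.
rewrite /moment_pos /moment unlock.
rewrite ge0_integral_pushforward//.
- have -> : Y @^-1` `]0, +oo[%classic = setT.
    by apply/seteqP; split => w //= _; rewrite in_itv/= Y_gt0.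
  by [].
- apply/measurable_EFinP; apply: measurable_funTS; exact: measurable_powR.
- by move=> x _; rewrite lee_fin powR_ge0.
Qed.

Let law_moment (a : R) : (\int[distribution P Y]_x (x `^ a)%:E = moment P a Y)%E.
Proof.
rewrite ge0_integral_distribution//; first by rewrite /moment unlock.
- by apply/measurable_EFinP; exact: measurable_powR.
- by move=> x; rewrite lee_fin powR_ge0.
Qed.

(** The hypothesis only describes the c.d.f. of X. Both measures have mass 1, so they agree on the
    complementary rays as well, hence on all measurable sets: the law of X has density x^a / E[Y^a]
    with respect to that of Y. *)
Lemma size_biased_integral d' (T' : measurableType d') (P' : probability T' R)
    (X : {RV P' >-> R}) (a : R) (g : R -> R) :
  (0 < moment P a Y)%E -> (moment P a Y < +oo)%E -> size_biased P a Y X ->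
  measurable_fun setT g -> (forall x, 0 <= g x) ->
  (\int[distribution P' X]_x (g x)%:E =
   ((fine (moment P a Y))^-1)%:E * \int[distribution P Y]_x (g x * x `^ a)%:E)%E.
Proof.
move=> m0 moo sb mg g0.
have mf : moment P a Y \is a fin_num by rewrite ge0_fin_numE// ltW.
set k := (fine (moment P a Y))^-1.
have k0 : 0 <= k by rewrite invr_ge0 fine_ge0// ltW.
have kM : (k%:E * moment P a Y = 1)%E.
  rewrite -(fineK mf) -EFinM mulVf// gt_eqF// fine_gt0// m0.
  by [].
pose w x := k * x `^ a.
have mw : measurable_fun setT w by apply: measurable_funM => //; exact: measurable_powR.
have w0 x : 0 <= w x by rewrite mulr_ge0 ?powR_ge0.
pose m2 := density_measure _ _ _ (distribution P Y) w mw w0.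
have m2E D : measurable D ->
    m2 D = (k%:E * \int[distribution P Y]_(x in D) (x `^ a)%:E)%E.
  move=> mD; rewrite /m2 /density_measure /density/= -ge0_integralZl//.
  - apply/measurable_EFinP; apply: measurable_funTS; exact: measurable_powR.
  - by move=> x _; rewrite lee_fin powR_ge0.
have m2T : m2 setT = 1%E by rewrite m2E// law_moment.
have eqNy u : distribution P' X `]-oo, u]%classic = m2 `]-oo, u]%classic.
  have := sb u; rewrite /cdf => ->; rewrite m2E//; congr (_ * _)%E.
  rewrite unlock ge0_integral_pushforward//; last 2 first.
  - apply/measurable_EFinP; apply: measurable_funTS; exact: measurable_powR.
  - by move=> x _; rewrite lee_fin powR_ge0.
  rewrite [RHS]integral_mkcond; apply: eq_integral => x _.
  rewrite patchE indicE.
  have -> : [set w | Y w <= u] = Y @^-1` `]-oo, u]%classic.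
    by apply/seteqP; split => t /=; rewrite in_itv.
  by case: ifPn => _; rewrite ?mulr1 ?mulr0.
have eqm D : measurable D -> distribution P' X D = m2 D.
  apply: eq_measure_itvoy => u; last first.
    by apply: (@le_lt_trans _ _ 1%E); [exact: probability_le1|exact: ltry].
  have split_m (m : {measure set R -> \bar R}) : m setT = 1%E ->
      (m `]-oo, u]%classic + m `]u, +oo[%classic = 1)%E.
    move=> <-; rewrite -measureU//.
    - congr (m _); apply/seteqP; split => // x _ /=; rewrite !in_itv/= andbT.
      by case: leP; [left|right].
    - apply/seteqP; split => // x /= []; rewrite !in_itv/= andbT => h1 h2.
      by have := le_lt_trans h1 h2; rewrite ltxx.
  have h1 := split_m (distribution P' X) (probability_setT _).
  have h2 := split_m m2 m2T.
  have f1 : distribution P' X `]-oo, u]%classic \is a fin_num by exact: fin_num_measure.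
  have -> : m2 `]u, +oo[%classic = (1 - m2 `]-oo, u]%classic)%E.
    by rewrite -h2 [X in (X - _)%E]addeC addeK// -eqNy.
  by rewrite -h1 -eqNy [X in (X - _)%E]addeC addeK.
rewrite (ge0_integral_density _ _ _ (distribution P Y) (distribution P' X) w mw w0 eqm)//.
- rewrite -ge0_integralZl//.
  + by apply: eq_integral => x _; rewrite -!EFinM /w; congr EFin; rewrite mulrCA.
  + by apply/measurable_EFinP; apply: measurable_funM => //; exact: measurable_powR.
  + by move=> x _; rewrite lee_fin mulr_ge0 ?powR_ge0.
exact/measurable_EFinP.
Qed.

End positive_law.

Section mixture_law.
Context d' (T' : measurableType d') (R : realType) (P' : probability T' R).
Variables (B : {RV P' >-> bool}) (cbar ibar : {RV P' >-> R}).
Hypothesis indep : independent_pair P' B (fun w => (cbar w, ibar w)).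

Let mB b : measurable (B @^-1` [set b]).
Proof. exact: measurable_funPTI. Qed.

(** By independence, restricting P' to {B = b} and pushing forward by X gives the law of X scaled by
    P'(B = b). *)
Lemma independent_integral (X : {RV P' >-> R}) (b : bool) (g : R -> R) :
  (forall A, measurable A ->
    P' (B @^-1` [set b] `&` X @^-1` A) = (P' (B @^-1` [set b]) * P' (X @^-1` A))%E) ->
  measurable_fun setT g -> (forall x, 0 <= g x) ->
  (\int[P']_w (g (X w) * \1_(B @^-1` [set b]) w)%:E =
   P' (B @^-1` [set b]) * \int[distribution P' X]_x (g x)%:E)%E.
Proof.
move=> ind mg g0; set Bb := B @^-1` [set b].
have mI : measurable_fun setT (\1_Bb : T' -> R) by apply: measurable_indic; exact: mB.
have I0 w : 0 <= \1_Bb w :> R by rewrite indicE ler0n.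
pose m1 := density_measure _ _ _ P' (\1_Bb : T' -> R) mI I0.
have mgX : measurable_fun setT (fun w => (g (X w))%:E).
  by apply/measurable_EFinP; exact: measurableT_comp.
transitivity (\int[m1]_w (g (X w))%:E)%E.
  rewrite (ge0_integral_density _ _ _ P' m1 \1_Bb mI I0 (fun _ _ => erefl) _ mgX)//.
  by move=> x; rewrite lee_fin.
have mgE : measurable_fun setT (EFin \o g) by exact/measurable_EFinP.
pose k := NngNum (fine_ge0 (measure_ge0 P' Bb)).
have kE : P' Bb = k%:num%:E.
  by apply/esym; apply: fineK; apply: fin_num_measure; exact: mB.
rewrite kE.
rewrite -[RHS](ge0_integral_mscale (distribution P' X) measurableT k mgE); last first.
  by move=> x _; rewrite lee_fin.
transitivity (\int[pushforward m1 X]_x (g x)%:E)%E.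
  by rewrite ge0_integral_pushforward// => y _; rewrite lee_fin.
apply: eq_measure_integral => A mA _.
have mXA : measurable (X @^-1` A) by exact: measurable_funPTI.
transitivity (P' Bb * P' (X @^-1` A))%E; last by rewrite kE.
rewrite -ind// /m1 /density_measure /pushforward /density.
exact: (integral_indic P' mXA (mB b)).
Qed.

Variables (q : R) (F : \bar R * \bar R -> R).
Hypothesis q01 : 0 <= q <= 1.
Hypothesis BE : forall A, distribution P' B A = bernoulli_prob q A.
Hypothesis mF : measurable_fun (@quadrant R) F.
Hypothesis F0 : forall z, quadrant z -> 0 <= F z.

(** Boundary values of F on the edges of the quadrant at infinity, where the limit law lives; they
    serve as the limits F1 and F2 in [product_limit]. *)
Definition edge1 (x : R) : R := if 0 < x then F (x%:E, +oo%E) else 0.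
Definition edge2 (y : R) : R := if 0 < y then F (+oo%E, y%:E) else 0.

Let BbE (b : bool) : P' (B @^-1` [set b]) = (if b then q else 1 - q)%:E.
Proof. by have := BE [set b]; rewrite /bernoulli_prob q01 fsbig_set1. Qed.

Lemma measurable_edge1 : measurable_fun setT edge1.
Proof.
have -> : edge1 = (fun x => F (x%:E, +oo%E)) \_ (`]0, +oo[%classic : set R).
  apply/funext => x; rewrite patchE /edge1.
  have -> : (x \in (`]0, +oo[%classic : set R)) = (0 < x).
    by apply/idP/idP; rewrite inE/= in_itv/= andbT.
  by [].
apply/(measurable_restrictT _ _).1; first exact: measurable_itv.
apply: (measurable_comp measurable_quadrant _ mF).
  by move=> _ [x /= + <-]; rewrite in_itv/= andbT => x0; split => //=; exact: ltry.
apply: measurable_funTS; apply/measurable_fun_pairP; split => /=;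
  [exact: EFin_measurable|exact: measurable_cst].
Qed.

Lemma measurable_edge2 : measurable_fun setT edge2.
Proof.
have -> : edge2 = (fun x => F (+oo%E, x%:E)) \_ (`]0, +oo[%classic : set R).
  apply/funext => x; rewrite patchE /edge2.
  have -> : (x \in (`]0, +oo[%classic : set R)) = (0 < x).
    by apply/idP/idP; rewrite inE/= in_itv/= andbT.
  by [].
apply/(measurable_restrictT _ _).1; first exact: measurable_itv.
apply: (measurable_comp measurable_quadrant _ mF).
  by move=> _ [x /= + <-]; rewrite in_itv/= andbT => x0; split => //=; exact: ltry.
apply: measurable_funTS; apply/measurable_fun_pairP; split => /=;
  [exact: measurable_cst|exact: EFin_measurable].
Qed.

Lemma edge1_ge0 x : 0 <= edge1 x.
Proof.
rewrite /edge1; case: ifPn => // x0; apply: F0; split => //=; exact: ltry.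
Qed.

Lemma edge2_ge0 x : 0 <= edge2 x.
Proof.
rewrite /edge2; case: ifPn => // x0; apply: F0; split => //=; exact: ltry.
Qed.

Lemma measurable_mixture : measurable_fun setT (mixture B cbar ibar).
Proof.
apply: measurable_fun_ifT => //; apply/measurable_fun_pairP; split => /=.
- exact: measurable_cst.
- by apply/measurable_EFinP.
- by apply/measurable_EFinP.
- exact: measurable_cst.
Qed.

Lemma mixture_integral :
  (\int[pushforward P' (mixture B cbar ibar)]_(x in @quadrant R) (F x)%:E =
   (1 - q)%:E * \int[distribution P' cbar]_x (edge1 x)%:E +
   q%:E * \int[distribution P' ibar]_x (edge2 x)%:E)%E.
Proof.
rewrite ge0_integral_pushforward//; first last.
- by move=> z /[!inE] /F0; rewrite lee_fin.
- by apply/measurable_EFinP.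
- exact: measurable_quadrant.
- exact: measurable_mixture.
have ind1 A : measurable A ->
    P' (B @^-1` [set false] `&` cbar @^-1` A) =
    (P' (B @^-1` [set false]) * P' (cbar @^-1` A))%E.
  move=> mA; have := @indep [set false] (A `*` setT) I (measurableX mA measurableT).
  have -> : (fun w => (cbar w, ibar w)) @^-1` (A `*` setT) = cbar @^-1` A.
    by apply/seteqP; split => w //= [].
  by [].
have ind2 A : measurable A ->
    P' (B @^-1` [set true] `&` ibar @^-1` A) =
    (P' (B @^-1` [set true]) * P' (ibar @^-1` A))%E.
  move=> mA; have := @indep [set true] (setT `*` A) I (measurableX measurableT mA).
  have -> : (fun w => (cbar w, ibar w)) @^-1` (setT `*` A) = ibar @^-1` A.
    by apply/seteqP; split => w //= [].
  by [].
have e1 := independent_integral cbar false edge1 ind1 measurable_edge1 edge1_ge0.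
have e2 := independent_integral ibar true edge2 ind2 measurable_edge2 edge2_ge0.
rewrite !BbE in e1 e2; rewrite -e1 -e2 integral_mkcond -ge0_integralD//.
- apply: eq_integral => w _; rewrite patchE !indicE.
  have -> : (w \in B @^-1` [set false]) = ~~ B w.
    by apply/idP/idP; rewrite inE/=; [move=> ->|move/negPf].
  have -> : (w \in B @^-1` [set true]) = B w by apply/idP/idP; rewrite inE/=.
  have -> : (w \in mixture B cbar ibar @^-1` @quadrant R) =
      if B w then 0 < ibar w else 0 < cbar w.
    apply/idP/idP; rewrite inE /quadrant /mixture/=.
      by case: (B w) => -[].
    by case: (B w) => /= h; split => //=; exact: ltry.
  rewrite /mixture/edge1/edge2/=; case: (B w); rewrite ?mulr0 ?mulr1 ?adde0 ?add0e//;
    by case: ifPn.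
- by move=> w _; rewrite lee_fin mulr_ge0// edge1_ge0.
- apply/measurable_EFinP; apply: measurable_funM; last exact: measurable_indic.
  exact: (measurableT_comp measurable_edge1).
- by move=> w _; rewrite lee_fin mulr_ge0// edge2_ge0.
- apply/measurable_EFinP; apply: measurable_funM; last exact: measurable_indic.
  exact: (measurableT_comp measurable_edge2).
Qed.

End mixture_law.

(** * Conditional laws *)

Section pushforward_as_measure.
Context d1 d2 (T1 : measurableType d1) (T2 : measurableType d2) (R : realType).
Variables (m : {measure set T1 -> \bar R}) (f : T1 -> T2).
Hypothesis mf : measurable_fun [set: T1] f.

Definition pushforward_measure : {measure set T2 -> \bar R}.
Proof. by refine (pushforward m f : {measure set T2 -> \bar R}); exact: mf. Defined.

End pushforward_as_measure.

Section measurable_fun_as_mfun.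
Context d1 d2 (T1 : measurableType d1) (T2 : measurableType d2) (f : T1 -> T2).
Hypothesis mf : measurable_fun [set: T1] f.

Let mixin := isMeasurableFun.Build _ _ _ _ _ mf.

Definition mfun_of_measurable : {mfun T1 >-> T2} := HB.pack f mixin.

End measurable_fun_as_mfun.

Section conditional_integral.
Context d (T : measurableType d) (R : realType) (P : probability T R).
Variables (X Y : {RV P >-> R}).
Hypothesis X_gt0 : forall w, 0 < X w.
Hypothesis Y_gt0 : forall w, 0 < Y w.
Hypothesis indep : forall A B, measurable A -> measurable B ->
  P (X @^-1` A `&` Y @^-1` B) = (P (X @^-1` A) * P (Y @^-1` B))%E.

Let XY w := (X w, Y w).

Let mXY : measurable_fun setT XY.
Proof. by apply/measurable_fun_pairP; split. Qed.

Lemma product_law D : measurable D ->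
  ((distribution P X \x distribution P Y) D = P (XY @^-1` D))%E.
Proof.
move=> mD.
pose m' := pushforward_measure _ _ _ _ _ P XY mXY.
have m'E A B : measurable A -> measurable B ->
    m' (A `*` B) = (distribution P X A * distribution P Y B)%E by exact: indep.
exact: (@product_measure_unique _ _ _ _ _ (distribution P X) (distribution P Y) m' m'E D mD).
Qed.

Definition quad_ext (F : \bar R * \bar R -> R) (z : R * R) : R :=
  if (0 < z.1) && (0 < z.2) then F (z.1%:E, z.2%:E) else 0.

Variable F : \bar R * \bar R -> R.
Hypothesis mF : measurable_fun (@quadrant R) F.
Hypothesis F0 : forall z, quadrant z -> 0 <= F z.

Lemma measurable_quad_ext : measurable_fun setT (quad_ext F).
Proof.
pose Q : set (R * R) := `]0, +oo[%classic `*` `]0, +oo[%classic.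
have mQ : measurable Q by apply: measurableX; exact: measurable_itv.
have -> : quad_ext F = (fun z => F (z.1%:E, z.2%:E)) \_ Q.
  apply/funext => z; rewrite patchE /quad_ext.
  have -> : (z \in Q) = (0 < z.1) && (0 < z.2).
    apply/idP/idP; rewrite inE /Q/= !in_itv/= !andbT; first by case=> -> ->.
    by move=> /andP.
  by [].
apply/(measurable_restrictT _ _).1; first exact: mQ.
apply: (measurable_comp measurable_quadrant _ mF).
  by move=> _ [z /= + <-]; rewrite /Q/= !in_itv/= !andbT.
apply: measurable_funTS; apply/measurable_fun_pairP; split => /=.
  by apply/measurable_EFinP; exact: measurable_fst.
by apply/measurable_EFinP; exact: measurable_snd.
Qed.

Lemma quad_ext_ge0 z : 0 <= quad_ext F z.
Proof. by rewrite /quad_ext; case: ifPn => // /andP[z1 z2]; exact: F0. Qed.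

Lemma conditional_integral (s : R) (H := [set w | s < X w * Y w]) :
  (\int[pushforward (conditional P H) (fun w => ((X w)%:E, (Y w)%:E))]_(z in @quadrant R) (F z)%:E
   = ((fine (P H))^-1)%:E *
     \int[distribution P X \x distribution P Y]_z
       (quad_ext F z * \1_(prod_gt R s) z)%:E)%E.
Proof.
have HE : H = XY @^-1` (prod_gt R s) by [].
have mH : measurable H.
  by rewrite HE -[X in measurable X]setTI; apply: mXY => //; exact: measurable_prod_gt.
have k0 : 0 <= (fine (P H))^-1 by rewrite invr_ge0 fine_ge0.
(* If P H = 0, then k = 0 by the convention on the inverse of 0, and [conditional P H] is the zero
   measure; the identity thus holds for every s. *)
pose k := NngNum k0.
have condE : conditional P H = mscale k (mrestr P mH).
  by apply/funext => A; rewrite /conditional muleC.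
have mphi : measurable_fun setT (fun w => ((X w)%:E, (Y w)%:E)).
  by apply/measurable_fun_pairP; split => /=; apply/measurable_EFinP.
have mFE : measurable_fun (@quadrant R) (fun z => (F z)%:E) by apply/measurable_EFinP.
rewrite condE ge0_integral_pushforward//; first last.
- by move=> z /[!inE] /F0; rewrite lee_fin.
- exact: measurable_quadrant.
have -> : (fun w => ((X w)%:E, (Y w)%:E)) @^-1` @quadrant R = setT.
  by apply/seteqP; split => // w _; split => /=; rewrite lte_fin.
have mI : measurable_fun setT (\1_H : T -> R) by exact: measurable_indic.
have mQE : measurable_fun setT (fun w => (quad_ext F (XY w))%:E).
  by apply/measurable_EFinP; exact: (measurableT_comp measurable_quad_ext).
have QE w : (F ((X w)%:E, (Y w)%:E))%:E = (quad_ext F (XY w))%:E.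
  by rewrite /quad_ext /= X_gt0 Y_gt0.
rewrite ge0_integral_mscale//; first last.
- by move=> w _; rewrite /= QE lee_fin quad_ext_ge0.
- by apply: (eq_measurable_fun _ _ mQE) => w _ /=; rewrite QE.
congr (_ * _)%E.
have I0 w : 0 <= \1_H w :> R by rewrite indicE ler0n.
have restrE A : measurable A -> mrestr P mH A = density _ _ _ P \1_H A.
  by move=> mA; rewrite /mrestr /density integral_indic// setIC.
transitivity (\int[mrestr P mH]_w (quad_ext F (XY w))%:E)%E.
  by apply: eq_integral => w _; rewrite /= QE.
rewrite (ge0_integral_density _ _ _ P _ \1_H mI I0 restrE _ mQE); last first.
  by move=> w; rewrite lee_fin quad_ext_ge0.
have mG : measurable_fun setT (fun z => (quad_ext F z * \1_(prod_gt R s) z)%:E).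
  apply/measurable_EFinP; apply: measurable_funM; first exact: measurable_quad_ext.
  by apply: measurable_indic; exact: measurable_prod_gt.
have G0 z : (0 <= (quad_ext F z * \1_(prod_gt R s) z)%:E)%E.
  by rewrite lee_fin mulr_ge0 ?quad_ext_ge0// indicE ler0n.
rewrite [RHS](eq_measure_integral (pushforward_measure _ _ _ _ _ P XY mXY)); last first.
  by move=> A mA _; exact: product_law.
rewrite ge0_integral_pushforward//.
Qed.

End conditional_integral.

Section product_probability.
Context d (T : measurableType d) (R : realType) (P : probability T R).
Variables (X Y : {RV P >-> R}).
Hypothesis X_gt0 : forall w, 0 < X w.
Hypothesis Y_gt0 : forall w, 0 < Y w.
Hypothesis indep : forall A B, measurable A -> measurable B ->
  P (X @^-1` A `&` Y @^-1` B) = (P (X @^-1` A) * P (Y @^-1` B))%E.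

(** The denominator of the conditional law is the numerator for the constant function 1, so a single
    limit theorem handles both. *)
Lemma prob_product_gt (s : R) :
  P [set w | s < X w * Y w] =
  (\int[distribution P X \x distribution P Y]_z
     (quad_ext R (cst 1) z * \1_(prod_gt R s) z)%:E)%E.
Proof.
have mXY : measurable_fun setT (fun w => (X w, Y w)).
  by apply/measurable_fun_pairP; split.
have m1 : measurable_fun (@quadrant R) (cst 1 : _ -> R) by exact: measurable_cst.
have q0 := quad_ext_ge0 R (cst 1) (fun _ _ => ler01).
have mG : measurable_fun setT (fun z => (quad_ext R (cst 1) z * \1_(prod_gt R s) z)%:E).
  apply/measurable_EFinP; apply: measurable_funM; first exact: measurable_quad_ext.
  by apply: measurable_indic; exact: measurable_prod_gt.
have G0 z : (0 <= (quad_ext R (cst 1) z * \1_(prod_gt R s) z)%:E)%E.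
  by rewrite lee_fin mulr_ge0// indicE ler0n.
rewrite [RHS](eq_measure_integral (pushforward_measure _ _ _ _ _ P _ mXY)); last first.
  by move=> A mA _; exact: product_law.
rewrite ge0_integral_pushforward//.
set H := [set w | _].
have mH : measurable H.
  have -> : H = (fun w => (X w, Y w)) @^-1` (prod_gt R s) by [].
  by rewrite -[X in measurable X]setTI; apply: mXY => //; exact: measurable_prod_gt.
rewrite -[in LHS](setIT H) -integral_indic//; apply: eq_integral => w _.
by rewrite /= /quad_ext /= X_gt0 Y_gt0 mul1r.
Qed.

End product_probability.

(** * Limits of the tail integrals *)

Section weak_limit.
Context {R : realType} (mu nu : probability R R) (N : R -> R) (a p r : R).
Hypothesis asy : asymp R mu nu a N p r.
Hypothesis p_fin : p = 0 \/ (moment_pos mu a < +oo)%E.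
Hypothesis r_fin : r = 0 \/ (moment_pos nu a < +oo)%E.

Definition tail_int (F : \bar R * \bar R -> R) (s : R) : \bar R :=
  (\int[mu \x nu]_z (quad_ext R F z * \1_(prod_gt R s) z)%:E)%E.

Lemma full_lim_lt_pinfty (m : probability R R) (G : R -> R) (M k : R) :
  k = 0 \/ (moment_pos m a < +oo)%E -> 0 <= k -> measurable_fun setT G ->
  (forall x, 0 <= G x <= M) -> (full_lim m G k a < +oo)%E.
Proof.
move=> [->|fin] k0 mG GM; rewrite /full_lim.
  by rewrite integral0_eq ?ltry// => x _; rewrite !mul0r.
have M0 : 0 <= M by have /andP[h1 h2] := GM 0; exact: le_trans h2.
apply: (@le_lt_trans _ _ ((k * M)%:E * moment_pos m a)%E); last first.
  by apply: lte_mul_pinfty => //; rewrite lee_fin mulr_ge0.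
rewrite /moment_pos -ge0_integralZl ?lee_fin ?mulr_ge0//.
- apply: ge0_le_integral => //.
  + move=> x _; rewrite lee_fin !mulr_ge0 ?powR_ge0//.
    by have /andP[] := GM x.
  + apply/measurable_EFinP; apply: measurable_funTS; apply: measurable_funM => //.
    by apply: measurable_funM => //; exact: measurable_powR.
  + apply: measurable_funeM; apply/measurable_EFinP; apply: measurable_funTS.
    exact: measurable_powR.
  + move=> x _; rewrite -EFinM lee_fin mulrAC ler_wpM2r ?powR_ge0// ler_wpM2l//.
    by have /andP[] := GM x.
- apply/measurable_EFinP; apply: measurable_funTS; exact: measurable_powR.
- by move=> x _; rewrite lee_fin powR_ge0.
Qed.

Variables (F : \bar R * \bar R -> R) (M : R).
Hypothesis F_cont : {within @quadrant R, continuous F}.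
Hypothesis F0 : forall z, quadrant z -> 0 <= F z.
Hypothesis FM : forall z, quadrant z -> F z <= M.

Lemma tail_int_cvg :
  fine (tail_int F s) / N s @[s --> +oo] -->
  fine (full_lim mu (edge1 _ F) p a) + fine (full_lim nu (edge2 _ F) r a).
Proof.
have mF := measurable_fun_quadrant F F_cont.
have [Npos Hnu Hmu Hneg] := asy.
have M0 : 0 <= M.
  have q : quadrant ((1%:E : \bar R), (1%:E : \bar R)) by split => /=; exact: lte01.
  exact: le_trans (F0 _ q) (FM _ q).
have e1M x : 0 <= edge1 _ F x <= M.
  rewrite edge1_ge0//= /edge1; case: ifPn => // x0.
  by apply: FM; split => //=; exact: ltry.
have e2M x : 0 <= edge2 _ F x <= M.
  rewrite edge2_ge0//= /edge2; case: ifPn => // x0.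
  by apply: FM; split => //=; exact: ltry.
have pos_near : \forall y \near +oo, (0 : R) < y.
  by apply/near_pinfty_geP; exists 1 => y; exact: lt_le_trans.
have EFin_cvg : (y%:E : \bar R) @[y --> (+oo : set_system R)] --> +oo%E.
  by apply/cvgeryP; exact: cvg_id.
(* Dominated convergence applies along sequences, so the limit is tested on every sequence tending
   to +oo. *)
apply/cvg_pinftyP => u uoo.
have upos : \forall n \near \oo, 0 < u n /\ 0 < N (u n).
  by apply: filterI; [move/cvgryPgt : uoo; exact|exact: (uoo _ Npos)].
have [n0 _ Hn0] := upos.
(* Dropping the first n0 terms makes s n and N (s n) positive for all n, as [product_limit]
   requires. *)
rewrite -(cvg_shiftn n0) /=.
pose s n := u (n + n0)%N.
have sN n : 0 < s n /\ 0 < N (s n) by apply: Hn0 => /=; exact: leq_addl.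
have soo : s n @[n --> \oo] --> +oo.
  by rewrite /s (cvg_shiftn n0 u).
have tnu x : 0 < x -> fine (nu `]s n / x, +oo[%classic) / N (s n) @[n --> \oo] --> p * x `^ a.
  by move=> x0; have /cvg_pinftyP := Hnu x x0; apply.
have tmu x : 0 < x -> fine (mu `]s n / x, +oo[%classic) / N (s n) @[n --> \oo] --> r * x `^ a.
  by move=> x0; have /cvg_pinftyP := Hmu x x0; apply.
have p0 : 0 <= p by exact: (tail_limit_ge0 nu p a s (fun n => N (s n)) (fun n => (sN n).2) tnu).
have r0 : 0 <= r by exact: (tail_limit_ge0 mu r a s (fun n => N (s n)) (fun n => (sN n).2) tmu).
have L1f := full_lim_lt_pinfty mu _ M p p_fin p0 (measurable_edge1 _ F mF) e1M.
have L2f := full_lim_lt_pinfty nu _ M r r_fin r0 (measurable_edge2 _ F mF) e2M.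
apply: (product_limit mu nu (quad_ext R F) (edge1 _ F) (edge2 _ F) M p r a s
  (fun n => N (s n))) => //.
- exact: measurable_quad_ext.
- exact: quad_ext_ge0.
- by move=> z; rewrite /quad_ext; case: ifPn => // /andP[z1 z2]; exact: FM.
- by move=> x y /negPf xy; rewrite /quad_ext /= xy.
- move=> x x0; rewrite /edge1 x0.
  have c : F (x%:E, y%:E) @[y --> +oo] --> F (x%:E, +oo%E).
    apply: (within_continuous_cvg _ _ _ F _ _ (fun y : R => (x%:E, y%:E)) (x%:E, +oo%E) _ F_cont).
    + by split => /=; rewrite ?ltry ?lte_fin.
    + near=> y; split => //=; rewrite lte_fin.
      by near: y; exact: pos_near.
    + exact: (cvg_pair (cvg_cst (x%:E : \bar R)) EFin_cvg).
  apply: cvg_trans c; apply: near_eq_cvg; near=> y.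
  suff y0 : 0 < y by rewrite /quad_ext /= x0 y0.
  by near: y; exact: pos_near.
- move=> y y0; rewrite /edge2 y0.
  have c : F (x%:E, y%:E) @[x --> +oo] --> F (+oo%E, y%:E).
    apply: (within_continuous_cvg _ _ _ F _ _ (fun x : R => (x%:E, y%:E)) (+oo%E, y%:E) _ F_cont).
    + by split => /=; rewrite ?ltry ?lte_fin.
    + near=> x; split => //=; rewrite lte_fin.
      by near: x; exact: pos_near.
    + exact: (cvg_pair EFin_cvg (cvg_cst (y%:E : \bar R))).
  apply: cvg_trans c; apply: near_eq_cvg; near=> x.
  suff x0 : 0 < x by rewrite /quad_ext /= x0 y0.
  by near: x; exact: pos_near.
- by move=> n; have [] := sN n.
- by move=> n; have [] := sN n.
- apply: (negligible_both_large _ _ _ s (fun n => N (s n)) (fun v => N (expR v))) => //.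
  + by move=> n; have [] := sN n.
  + by apply: nearW => n; rewrite lnK ?posrE//; have [] := sN n.
Unshelve. all: by end_near. Qed.

End weak_limit.

Lemma moment_pos_gt0 (R : realType) (mu : probability R R) (a : R) :
  0 <= a -> 0 < tail R mu 1 -> (0 < moment_pos mu a)%E.
Proof.
move=> a0 t0; apply: (@lt_le_trans _ _ (mu `]1, +oo[%classic)).
  by rewrite tailE lte_fin.
rewrite -[X in mu X]setIT -[X in mu X]setTI setICA setTI -integral_indic//.
rewrite /moment_pos [leRHS]integral_mkcond; apply: ge0_le_integral => //.
- by apply/measurable_EFinP; exact: measurable_indic.
- apply/(measurable_restrictT _ _).1; first exact: measurable_itv.
  by apply/measurable_EFinP; apply: measurable_funTS; exact: measurable_powR.
- move=> x _; rewrite patchE indicE; have [|_] := boolP (x \in `]1, +oo[%classic).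
    rewrite inE/= in_itv/= andbT => x1.
    rewrite mem_set; last by rewrite /= in_itv/= andbT (lt_trans ltr01).
    by rewrite lee_fin -(powRr0 x) ler_powR// ltW.
  by case: ifPn => // _; rewrite lee_fin powR_ge0.
Qed.

(** q is 1 if mu has the strictly smaller index, and 0 if nu has. At equal indices a single infinite
    moment decides, and two finite moments leave the limit of [weight]. Dividing by [fine] of an
    infinite moment does no harm, since the numerator 1 - q or q is then 0. *)
Lemma asymp_exists (R : realType) (mu nu : probability R R) (Loo L0 : R -> R)
    (aoo a0 : R) :
  rv_tail R mu Loo aoo -> rv_tail R nu L0 a0 ->
  (a0 = aoo -> exists goo g0 : R, [/\ goo != -1, g0 != -1,
     regularly_varying goo (fun v => Loo (expR v)) &
     regularly_varying g0 (fun v => L0 (expR v))]) ->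
  let alpha := trap_index aoo a0 in
  let Ec := moment_pos mu alpha in
  let Ei := moment_pos nu alpha in
  (Ec < +oo)%E \/ (Ei < +oo)%E ->
  (a0 = aoo -> (Ec < +oo)%E -> (Ei < +oo)%E ->
    cvg (weight (fine Ec) (fine Ei) Loo L0 t @[t --> +oo])) ->
  exists q : R, exists N : R -> R,
    [/\ 0 <= q <= 1, Ei = +oo%E -> q = 0, Ec = +oo%E -> q = 1,
      a0 = aoo -> (Ec < +oo)%E -> (Ei < +oo)%E ->
        q = lim (weight (fine Ec) (fine Ei) Loo L0 t @[t --> +oo]) &
      [/\ q != 1 -> (Ec < +oo)%E, q != 0 -> (Ei < +oo)%E &
        asymp R mu nu alpha N ((1 - q) / fine Ec) (q / fine Ei)]].
Proof.
move=> muP nuP idxP alpha Ec Ei fin wcvg.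
have aoo0 := rv_tail_gt0 _ _ _ _ muP; have a00 := rv_tail_gt0 _ _ _ _ nuP.
have alpha0 : 0 < alpha by rewrite /alpha /trap_index lt_min a00.
have Ec0 : (0 < Ec)%E by apply: moment_pos_gt0; [exact: ltW|exact: (rv_tail_pos mu Loo aoo muP)].
have Ei0 : (0 < Ei)%E by apply: moment_pos_gt0; [exact: ltW|exact: (rv_tail_pos nu L0 a0 nuP)].
have fc : (Ec < +oo)%E -> 0 < fine Ec by move=> h; rewrite fine_gt0// Ec0.
have fi : (Ei < +oo)%E -> 0 < fine Ei by move=> h; rewrite fine_gt0// Ei0.
have [aa|aa|aa] := ltgtP aoo a0.
- have alphaE : alpha = aoo by rewrite /alpha /trap_index; apply/min_idPr; exact: ltW.
  have Eifin : (Ei < +oo)%E.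
    by apply: (lt_rv_tail_moment nu L0 a0 nuP); rewrite ?alphaE.
  exists 1, (fun s => fine Ei * tail R mu s); split => //.
  + by rewrite ler01 lexx.
  + by move=> h; rewrite h ltxx in Eifin.
  + by move=> h; rewrite h ltxx in aa.
  + split => //; first by rewrite eqxx.
    rewrite subrr mul0r div1r alphaE.
    exact: (asymp_lt R mu nu Loo L0 aoo a0 _ muP nuP aa (fi Eifin)).
- have alphaE : alpha = a0 by rewrite /alpha /trap_index; apply/min_idPl; exact: ltW.
  have Ecfin : (Ec < +oo)%E.
    by apply: (lt_rv_tail_moment mu Loo aoo muP); rewrite ?alphaE.
  exists 0, (fun s => fine Ec * tail R nu s); split => //.
  + by rewrite ler01 lexx.
  + by move=> h; rewrite h ltxx in Ecfin.
  + by move=> h; rewrite h ltxx in aa.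
  + split => //; first by rewrite eqxx.
    rewrite subr0 mul0r div1r alphaE; apply: asymp_sym.
    exact: (asymp_lt R nu mu L0 Loo a0 aoo _ nuP muP aa (fc Ecfin)).
- have alphaE : alpha = aoo by rewrite /alpha /trap_index aa; apply/min_idPl.
  have [goo [g0 [goon g0n Loor L0r]]] := idxP (esym aa).
  have nuP' : rv_tail R nu L0 aoo by rewrite aa.
  have [Ecfin|Ecoo] := boolP (Ec < +oo)%E.
    have [Eifin|Eioo] := boolP (Ei < +oo)%E.
      have wc := wcvg (esym aa) Ecfin Eifin.
      set q := lim _ in wc; exists q.
      exists (fun s => fine Ec * tail R nu s + fine Ei * tail R mu s).
      have c0 := fc Ecfin; have i0 := fi Eifin.
      have [[[X1 [_ HX1]] _] _ _] := muP; have [[[X2 [_ HX2]] _] _ _] := nuP.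
      have w01 : \forall t \near +oo, 0 <= weight (fine Ec) (fine Ei) Loo L0 t <= 1.
        apply/near_pinfty_geP; exists (Num.max X1 X2) => t.
        rewrite ge_max => /andP[/HX1 L1 /HX2 L2]; rewrite /weight.
        have h1 : 0 < fine Ei * Loo t by rewrite mulr_gt0.
        have h2 : 0 < fine Ec * L0 t by rewrite mulr_gt0.
        have h3 := addr_gt0 h2 h1; apply/andP; split; first by rewrite divr_ge0// ltW.
        by rewrite ler_pdivrMr// mul1r lerDr ltW.
      split => //.
      + apply/andP; split.
          by apply: (cvgr_to_ge wc); apply: filterS w01 => t /andP[].
        by apply: (cvgr_to_le wc); apply: filterS w01 => t /andP[].
      + by move=> h; rewrite h ltxx in Eifin.
      + by move=> h; rewrite h ltxx in Ecfin.
      + split => //; rewrite alphaE.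
        by apply: (asymp_both mu nu Loo L0 aoo goo g0 muP nuP' Loor L0r) => //;
          rewrite -alphaE.
    have Eioo' : Ei = +oo%E by move: Eioo; rewrite ltey negbK => /eqP.
    exists 0, (fun s => fine Ec * tail R nu s); split => //.
    + by rewrite ler01 lexx.
    + by move=> h; rewrite h ltxx in Ecfin.
    + split => //; first by rewrite eqxx.
      rewrite subr0 mul0r div1r alphaE.
      apply: (asymp_one mu nu Loo L0 aoo goo g0 muP nuP' Loor L0r).
      * exact: fc.
      * by rewrite -alphaE.
      * by apply: (index_gt_of_infinite_moment mu nu Loo L0 aoo g0 muP nuP' L0r) => //;
        rewrite -alphaE.
  have Ecoo' : Ec = +oo%E by move: Ecoo; rewrite ltey negbK => /eqP.
  have Eifin : (Ei < +oo)%E by case: fin => // h; rewrite h in Ecoo.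
  exists 1, (fun s => fine Ei * tail R mu s); split => //.
  + by rewrite ler01 lexx.
  + by move=> h; rewrite h ltxx in Eifin.
  + split => //; first by rewrite eqxx.
    rewrite subrr mul0r div1r alphaE; apply: asymp_sym.
    apply: (asymp_one nu mu L0 Loo aoo g0 goo nuP' muP L0r Loor).
    * exact: fi.
    * by rewrite -alphaE.
    * by apply: (index_gt_of_infinite_moment nu mu L0 Loo aoo goo nuP' muP Loor) => //;
        rewrite -alphaE.
Qed.

(** * Weak convergence *)

(** Splitting f into positive and negative parts reduces to nonnegative test functions; finiteness
    of the limits is what allows subtracting them in the extended reals. *)
Lemma weak_cvg_ge0 (R : realType)
    (m : R -> {measure set (\bar R * \bar R) -> \bar R})
    (l : {measure set (\bar R * \bar R) -> \bar R}) :
  (forall (F : \bar R * \bar R -> R) (M : R), {within @quadrant R, continuous F} ->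
    (forall z, quadrant z -> 0 <= F z) -> (forall z, quadrant z -> F z <= M) ->
    (\int[l]_(z in @quadrant R) (F z)%:E)%E \is a fin_num /\
    (\int[m t]_(z in @quadrant R) (F z)%:E)%E @[t --> +oo] -->
      (\int[l]_(z in @quadrant R) (F z)%:E)%E) ->
  weak_cvg_quadrant (fun t => m t) l.
Proof.
move=> H f fc [M0 [_ /(_ (M0 + 1))]]; rewrite ltrDl ltr01 => /(_ isT) fM.
have bound z : quadrant z -> `|f z| <= M0 + 1 by exact: fM.
(* In this form, continuity of the positive part within the quadrant follows from that of sums and
   norms. *)
have maxE (h : \bar R * \bar R -> R) z : Num.max (h z) 0 = 2^-1 * (h z + `|h z|).
  case: (lerP (h z) 0) => hz; [rewrite ler0_norm//|rewrite gtr0_norm//]; lra.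
have half (h : \bar R * \bar R -> R) : {within @quadrant R, continuous h} ->
    (forall z : \bar R * \bar R, `|h z| = `|f z|) ->
    (\int[l]_(z in @quadrant R) (Num.max (h z) 0)%:E)%E \is a fin_num /\
    (\int[m t]_(z in @quadrant R) (Num.max (h z) 0)%:E)%E @[t --> +oo] -->
      (\int[l]_(z in @quadrant R) (Num.max (h z) 0)%:E)%E.
  move=> hc hf; apply: (H _ (M0 + 1)).
  - have -> : (fun z => Num.max (h z) 0) = (fun z => 2^-1 * (h z + `|h z|)).
      by apply/funext => z; exact: maxE.
    move=> z; apply: cvgM; first exact: cvg_cst.
    apply: cvgD; first exact: hc.
    by apply: cvg_norm; exact: hc.
  - by move=> z _; rewrite le_max lexx orbT.
  - move=> z /bound; rewrite -hf => hM; rewrite ge_max (le_trans (ler_norm _) hM)/=.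
    exact: le_trans (normr_ge0 _) hM.
have [lp cp] := half f fc (fun _ => erefl).
have [ln cn] := half (fun z => - f z) (fun z => cvgN (fc z)) (fun z => normrN _).
have split_int (n : {measure set (\bar R * \bar R) -> \bar R}) :
    (\int[n]_(z in @quadrant R) (f z)%:E = \int[n]_(z in @quadrant R) (Num.max (f z) 0)%:E
      - \int[n]_(z in @quadrant R) (Num.max (- f z) 0)%:E)%E.
  by rewrite integralE; congr (_ - _)%E; apply: eq_integral => z _;
    rewrite ?funeposE ?funenegE -?EFinN EFin_max.
rewrite split_int (_ : (fun t => _) = (fun t =>
  \int[m t]_(z in @quadrant R) (Num.max (f z) 0)%:E
      - \int[m t]_(z in @quadrant R) (Num.max (- f z) 0)%:E)%E); last first.
  by apply/funext => t; exact: split_int.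
by apply: cvgeB => //; rewrite fin_num_adde_defr// fin_numN.
Qed.

Lemma full_limE (R : realType) (mu : probability R R) (G : R -> R) (p a : R) :
  0 <= p -> measurable_fun setT G -> (forall x, 0 <= G x) ->
  (forall x, x <= 0 -> G x = 0) ->
  full_lim mu G p a = (p%:E * \int[mu]_x (G x * x `^ a)%:E)%E.
Proof.
move=> p0 mG G0 Gneg.
rewrite -ge0_integralZl ?lee_fin//; last 2 first.
- apply/measurable_EFinP; apply: measurable_funM => //; exact: measurable_powR.
- by move=> x _; rewrite lee_fin mulr_ge0// powR_ge0.
rewrite /full_lim [LHS]integral_mkcond; apply: eq_integral => x _; rewrite patchE.
have [|x0] := boolP (x \in _); first by rewrite -EFinM -mulrA [_ * G x]mulrC.
rewrite Gneg ?mul0r ?mule0//; rewrite leNgt; apply/negP => xpos.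
by move/negP: x0; apply; rewrite inE/= in_itv/= xpos.
Qed.

Lemma full_lim_ge0 (R : realType) (mu : probability R R) (G : R -> R) (p a : R) :
  0 <= p -> (forall x, 0 <= G x) -> (0 <= full_lim mu G p a)%E.
Proof.
move=> p0 G0; apply: integral_ge0 => x _.
by rewrite lee_fin !mulr_ge0 ?powR_ge0.
Qed.

Lemma full_lim_cst1 (R : realType) (mu : probability R R) (p a : R) :
  0 <= p -> full_lim mu (edge1 R (cst 1)) p a = (p%:E * moment_pos mu a)%E.
Proof.
move=> p0; rewrite /moment_pos -ge0_integralZl ?lee_fin//.
- by apply: eq_integral => x; rewrite inE/= in_itv/= andbT /edge1 => ->; rewrite mulr1.
- by apply/measurable_EFinP; apply: measurable_funTS; exact: measurable_powR.
- by move=> x _; rewrite lee_fin powR_ge0.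
Qed.

Lemma edge2_cst1 (R : realType) : edge2 R (cst 1) = edge1 R (cst 1).
Proof. by []. Qed.

Lemma tail_int_fin (R : realType) (mu nu : probability R R)
    (F : \bar R * \bar R -> R) (M s : R) :
  measurable_fun (@quadrant R) F -> (forall z, quadrant z -> 0 <= F z) ->
  (forall z, quadrant z -> F z <= M) -> tail_int mu nu F s \is a fin_num.
Proof.
move=> mF F0 FM.
have q0 := quad_ext_ge0 R F F0.
have M0 : 0 <= M.
  have q : quadrant ((1%:E : \bar R), (1%:E : \bar R)) by split => /=; exact: lte01.
  exact: le_trans (F0 _ q) (FM _ q).
have qM z : quad_ext R F z <= M.
  by rewrite /quad_ext; case: ifPn => // /andP[z1 z2]; exact: FM.
rewrite ge0_fin_numE; last first.
  by apply: integral_ge0 => z _; rewrite lee_fin mulr_ge0// indicE ler0n.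
have mQ := measurable_prod_gt.
apply: (@le_lt_trans _ _ (\int[mu \x nu]_z M%:E)%E).
  apply: ge0_le_integral => //.
  - by move=> z _; rewrite lee_fin mulr_ge0// indicE ler0n.
  - apply/measurable_EFinP; apply: measurable_funM; first exact: measurable_quad_ext.
    by apply: measurable_indic; exact: measurable_prod_gt.
  - move=> z _; rewrite lee_fin indicE.
    by case: (_ \in _); rewrite ?mulr1 ?mulr0.
have mass : ((mu \x nu) setT = 1)%E by rewrite probability_setT.
rewrite integral_cst//; apply: (@le_lt_trans _ _ (M%:E * 1)%E); last by rewrite mule1 ltry.
by rewrite le_eqVlt; apply/orP; left; apply/eqP; congr (_ * _)%E; exact: mass.
Qed.

Section weak_convergence.
Context d (T : measurableType d) (R : realType) (P : probability T R).
Variables (X Y : {RV P >-> R}).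
Hypothesis X_gt0 : forall w, 0 < X w.
Hypothesis Y_gt0 : forall w, 0 < Y w.
Hypothesis indep : forall A B, measurable A -> measurable B ->
  P (X @^-1` A `&` Y @^-1` B) = (P (X @^-1` A) * P (Y @^-1` B))%E.
Let mu : probability R R := distribution P X.
Let nu : probability R R := distribution P Y.
Let Ec := moment_pos mu.
Let Ei := moment_pos nu.
Variables (N : R -> R) (a q : R).
Hypothesis q01 : 0 <= q <= 1.
Hypothesis Ec_gt0 : (0 < Ec a)%E.
Hypothesis Ei_gt0 : (0 < Ei a)%E.
Hypothesis Ec_fin : q != 1 -> (Ec a < +oo)%E.
Hypothesis Ei_fin : q != 0 -> (Ei a < +oo)%E.
Hypothesis asy : asymp R mu nu a N ((1 - q) / fine (Ec a)) (q / fine (Ei a)).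

Let p := (1 - q) / fine (Ec a).
Let r := q / fine (Ei a).

Let p0 : 0 <= p.
Proof.
have /andP[_ q1] := q01; apply: divr_ge0; first by rewrite subr_ge0.
exact/fine_ge0/ltW.
Qed.

Let r0 : 0 <= r.
Proof.
have /andP[q0 _] := q01; apply: divr_ge0 => //; exact/fine_ge0/ltW.
Qed.

Let p_fin : p = 0 \/ (Ec a < +oo)%E.
Proof.
have [q1|/Ec_fin] := eqVneq q 1; last by right.
by left; rewrite /p q1 subrr mul0r.
Qed.

Let r_fin : r = 0 \/ (Ei a < +oo)%E.
Proof.
have [q1|/Ei_fin] := eqVneq q 0; last by right.
by left; rewrite /r q1 mul0r.
Qed.

(** For q = 1 the moment may be infinite, but then p = 0 and the convention 0 * +oo = 0 gives the
    right value. *)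
Let pE : (p%:E * Ec a = (1 - q)%:E)%E.
Proof.
have [q1|/Ec_fin h] := eqVneq q 1; first by rewrite /p q1 subrr mul0r mul0e.
have f : Ec a \is a fin_num by rewrite ge0_fin_numE// ltW.
by rewrite -(fineK f) -EFinM /p divfK// gt_eqF// fine_gt0// Ec_gt0.
Qed.

Let rE : (r%:E * Ei a = q%:E)%E.
Proof.
have [q1|/Ei_fin h] := eqVneq q 0; first by rewrite /r q1 mul0r mul0e.
have f : Ei a \is a fin_num by rewrite ge0_fin_numE// ltW.
by rewrite -(fineK f) -EFinM /r divfK// gt_eqF// fine_gt0// Ei_gt0.
Qed.

Let law (s : R) : set (\bar R * \bar R) -> \bar R :=
  pushforward (conditional P [set w | s < X w * Y w]) (fun w => ((X w)%:E, (Y w)%:E)).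

(** The integral is a quotient of two tail integrals in which N cancels. For the constant 1 the
    limit is p Ec + r Ei = (1 - q) + q = 1, so the denominator disappears in the limit. *)
Lemma law_cvg (F : \bar R * \bar R -> R) (M : R) :
  {within @quadrant R, continuous F} ->
  (forall z, quadrant z -> 0 <= F z) -> (forall z, quadrant z -> F z <= M) ->
  (\int[law s]_(z in @quadrant R) (F z)%:E)%E @[s --> +oo] -->
  (fine (full_lim mu (edge1 R F) p a) + fine (full_lim nu (edge2 R F) r a))%:E.
Proof.
move=> F_cont F0 FM; have mF := measurable_fun_quadrant F F_cont.
have c1 : {within @quadrant R, continuous (cst 1 : \bar R * \bar R -> R)}.
  by apply: continuous_subspaceT => z; exact: cvg_cst.
have JF := tail_int_cvg mu nu N a p r asy p_fin r_fin F M F_cont F0 FM.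
have J1 := tail_int_cvg mu nu N a p r asy p_fin r_fin (cst 1) 1 c1
  (fun _ _ => ler01) (fun _ _ => lexx _).
have L1 : fine (full_lim mu (edge1 R (cst 1)) p a) +
    fine (full_lim nu (edge2 R (cst 1)) r a) = 1.
  by rewrite edge2_cst1 !full_lim_cst1// pE rE/= subrK.
rewrite L1 in J1.
have ratio : fine (tail_int mu nu F s) / fine (tail_int mu nu (cst 1) s) @[s --> +oo] -->
    fine (full_lim mu (edge1 R F) p a) + fine (full_lim nu (edge2 R F) r a).
  rewrite -[X in _ --> X]divr1.
  have h := cvgM JF (cvgV (oner_neq0 R) J1).
  apply: (cvg_trans _ (h _ _)); apply: near_eq_cvg.
  apply: filterS (asymp_pos _ _ _ _ _ _ _ asy) => s Ns /=.
  by rewrite invfM invrK mulrACA [_^-1 * _]mulVf ?mulr1// gt_eqF.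
have -> : (fun s => \int[law s]_(z in @quadrant R) (F z)%:E)%E =
    (fun s => (fine (tail_int mu nu F s) / fine (tail_int mu nu (cst 1) s))%:E).
  apply/funext => s; rewrite /law conditional_integral// prob_product_gt//.
  rewrite -/(tail_int mu nu (cst 1) s) -/(tail_int mu nu F s).
  by rewrite EFinM fineK 1?muleC//; exact: (tail_int_fin _ mu nu F M).
by apply: cvg_EFin ratio; exact: nearW.
Qed.

Variables (d' : measure_display) (T' : measurableType d') (P' : probability T' R).
Variables (B : {RV P' >-> bool}) (cbar ibar : {RV P' >-> R}).
Hypothesis BE : forall A, distribution P' B A = bernoulli_prob q A.
Hypothesis indepB : independent_pair P' B (fun w => (cbar w, ibar w)).
Hypothesis cbarP : (Ec a < +oo)%E -> size_biased P a X cbar.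
Hypothesis ibarP : (Ei a < +oo)%E -> size_biased P a Y ibar.

Let limit_law := pushforward P' (mixture B cbar ibar).

Lemma limit_lawE (F : \bar R * \bar R -> R) : measurable_fun (@quadrant R) F ->
  (forall z, quadrant z -> 0 <= F z) ->
  (\int[limit_law]_(z in @quadrant R) (F z)%:E =
   full_lim mu (edge1 R F) p a + full_lim nu (edge2 R F) r a)%E.
Proof.
move=> mF F0; rewrite /limit_law (mixture_integral _ _ _ _ _ _ _ indepB q)//.
have me1 := measurable_edge1 R F mF; have me2 := measurable_edge2 R F mF.
have ge1 := edge1_ge0 R F F0; have ge2 := edge2_ge0 R F F0.
rewrite !full_limE//; last 2 first.
- by move=> x; rewrite /edge2 leNgt => /negPf ->.
- by move=> x; rewrite /edge1 leNgt => /negPf ->.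
have EcE : Ec a = moment P a X by exact: moment_posE.
have EiE : Ei a = moment P a Y by exact: moment_posE.
congr (_ + _)%E.
- have [q1|/Ec_fin h] := eqVneq q 1; first by rewrite /p q1 subrr mul0r !mul0e.
  rewrite (size_biased_integral _ _ _ P X _ _ P' cbar a (edge1 R F) _ _ (cbarP h) me1 ge1) -?EcE//.
  by rewrite muleA -EFinM.
- have [q1|/Ei_fin h] := eqVneq q 0; first by rewrite /r q1 mul0r !mul0e.
  rewrite (size_biased_integral _ _ _ P Y _ _ P' ibar a (edge2 R F) _ _ (ibarP h) me2 ge2) -?EiE//.
  by rewrite muleA -EFinM.
Qed.

Lemma law_weak_cvg : weak_cvg_quadrant law limit_law.
Proof.
have mH s : measurable [set w | s < X w * Y w].
  have -> : [set w | s < X w * Y w] = (fun w => (X w, Y w)) @^-1` (prod_gt R s) by [].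
  have mXY : measurable_fun setT (fun w => (X w, Y w)) by apply/measurable_fun_pairP; split.
  by rewrite -[X in measurable X]setTI; apply: mXY => //; exact: measurable_prod_gt.
have mphi : measurable_fun setT (fun w => ((X w)%:E, (Y w)%:E)).
  by apply/measurable_fun_pairP; split => /=; apply/measurable_EFinP.
have k0 s : 0 <= (fine (P [set w | s < X w * Y w]))^-1 by rewrite invr_ge0 fine_ge0.
(* [weak_cvg_ge0] needs genuine measures, so the conditional law is rebuilt as the image of a scaled
   restriction of P. *)
pose m s := pushforward_measure _ _ _ _ _ (mscale (NngNum (k0 s)) (mrestr P (mH s))) _ mphi.
have lawE : law = m.
  apply/funext => s; rewrite /law.
  have -> : conditional P [set w | s < X w * Y w] =
      mscale (NngNum (k0 s)) (mrestr P (mH s)).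
    by apply/funext => A; rewrite /conditional muleC.
  by [].
pose l := pushforward_measure _ _ _ _ _ P' _ (measurable_mixture _ _ _ _ B cbar ibar).
rewrite lawE -[limit_law]/(l : set _ -> \bar R); apply: weak_cvg_ge0 => F M Fc F0 FM.
have mF := measurable_fun_quadrant F Fc.
have M1 : 0 <= M.
  have z : quadrant ((1%:E : \bar R), (1%:E : \bar R)) by split => /=; exact: lte01.
  exact: le_trans (F0 _ z) (FM _ z).
have fin1 : full_lim mu (edge1 R F) p a \is a fin_num.
  rewrite ge0_fin_numE; last by exact: (full_lim_ge0 _ _ _ _ _ p0 (edge1_ge0 R F F0)).
  apply: (full_lim_lt_pinfty _ _ _ M) => //; first exact: measurable_edge1.
  move=> x; rewrite edge1_ge0//= /edge1; case: ifPn => // x0.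
  by apply: FM; split => //=; exact: ltry.
have fin2 : full_lim nu (edge2 R F) r a \is a fin_num.
  rewrite ge0_fin_numE; last by exact: (full_lim_ge0 _ _ _ _ _ r0 (edge2_ge0 R F F0)).
  apply: (full_lim_lt_pinfty _ _ _ M) => //; first exact: measurable_edge2.
  move=> x; rewrite edge2_ge0//= /edge2; case: ifPn => // x0.
  by apply: FM; split => //=; exact: ltry.
have := limit_lawE F mF F0; rewrite -[limit_law]/(l : set _ -> \bar R) => ->.
split; first by rewrite fin_numD fin1.
have := law_cvg F M Fc F0 FM; rewrite lawE EFinD !fineK//.
Qed.

End weak_convergence.

(** * From the assumptions on the traps to the two tails *)

Lemma rv_tail_distribution (d : measure_display) (T : measurableType d)
    (R : realType) (P : probability T R) (X : {RV P >-> R}) (L : R -> R) (a : R) :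
  slowly_varying L -> 0 < a ->
  (forall t : R, 1 < t -> P [set w | t < X w] = (L t * t `^ (- a))%:E) ->
  rv_tail R (distribution P X) L a.
Proof.
move=> sL a0 tE; split => // t t1.
transitivity (fine (P [set w | t < X w])); last by rewrite tE.
rewrite /tail /=; congr (fine (P _)).
by apply/seteqP; split => w /=; rewrite in_itv/= andbT.
Qed.

Lemma independent_pair_of_family (d : measure_display) (T : measurableType d)
    (R : realType) (P : probability T R) (I : choiceType) (X : I -> {RV P >-> R})
    (i j : I) :
  independent_family X -> i != j -> independent_pair P (X i) (X j).
Proof.
move=> indep ij A B mA mB.
pose S k := if k == i then A else B.
have mS k : measurable (S k) by rewrite /S; case: ifP.
have := indep [fset i; j]%fset S mS.
rewrite big_fsetU1 ?inE//= big_seq_fset1 {2 3}/S eqxx eq_sym (negPf ij) => <-.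
congr (P _); apply/seteqP; split => w /=.
- move=> [wA wB] k; rewrite /= !inE => /orP[] /eqP ->; rewrite /S ?eqxx//.
  by rewrite eq_sym (negPf ij).
- move=> H; split.
    by have := H i; rewrite /S eqxx; apply; rewrite /= !inE eqxx.
  by have := H j; rewrite /S eq_sym (negPf ij); apply; rewrite /= !inE eqxx orbT.
Qed.

Theorem proposition1p4 (R : realType) (d : measure_display)
    (T : measurableType d) (P : probability T R)
    (c : int -> {RV P >-> R}) (lambda : R)
    (Loo L0 : R -> R) (aoo a0 : R) :
  independent_family c ->
  identically_distributed c ->
  (forall x w, 0 < c x w) ->
  0 < lambda ->
  traps P (c 0) Loo L0 aoo a0 ->
  let alpha := trap_index aoo a0 in
  let Ec := moment P alpha (c 0) in
  let Ei := moment P alpha (fun w => (c 0 w)^-1) in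
  (Ec < +oo)%E \/ (Ei < +oo)%E ->
  (a0 = aoo -> (Ec < +oo)%E -> (Ei < +oo)%E ->
    cvg (weight (fine Ec) (fine Ei) Loo L0 t @[t --> +oo])) ->
  exists q : R,
    [/\ 0 <= q <= 1,
        Ei = +oo%E -> q = 0,
        Ec = +oo%E -> q = 1,
        a0 = aoo -> (Ec < +oo)%E -> (Ei < +oo)%E ->
          q = lim (weight (fine Ec) (fine Ei) Loo L0 t @[t --> +oo]) &
        forall (d' : measure_display) (T' : measurableType d')
            (P' : probability T' R)
            (B : {RV P' >-> bool}) (cbar ibar : {RV P' >-> R}),
          (forall A : set bool, distribution P' B A = bernoulli_prob q A) ->
          independent_pair P' B (fun w => (cbar w, ibar w)) ->
          ((Ec < +oo)%E -> size_biased P alpha (c (-1)) cbar) ->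
          ((Ei < +oo)%E -> size_biased P alpha (fun w => (c 0 w)^-1) ibar) ->
          weak_cvg_quadrant (cond_law lambda c)
            (pushforward P' (mixture B cbar ibar))].
Proof.
move=> indep ident c_gt0 _ tr alpha Ec Ei fin wcvg.
have [sLoo sL0 aoo0 a00 tailoo tail0 _ idxP] := tr.
(* The reciprocal is treated as the power -1, which is measurable on the whole line; the two agree
   at positive arguments, the only values taken by c 0. *)
have minv : measurable_fun setT (fun x : R => x `^ (-1)) by exact: measurable_powR.
have invE (x : R) : 0 < x -> x `^ (-1) = x^-1 by move=> /ltW; exact: powR_inv1.
have mY : measurable_fun setT (fun w => (c 0 w)^-1).
  have -> : (fun w => (c 0 w)^-1) = (fun x : R => x `^ (-1)) \o c 0.
    by apply/funext => w /=; rewrite invE.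
  exact: (measurableT_comp minv).
pose X := c (-1); pose Y := mfun_of_measurable _ _ _ _ _ mY : {RV P >-> R}.
pose mu : probability R R := distribution P X.
pose nu : probability R R := distribution P Y.
have Y_gt0 w : 0 < Y w by rewrite /= invr_gt0.
have indepXY A B : measurable A -> measurable B ->
    P (X @^-1` A `&` Y @^-1` B) = (P (X @^-1` A) * P (Y @^-1` B))%E.
  move=> mA mB.
  pose B' := (fun x : R => x `^ (-1)) @^-1` B.
  have mB' : measurable B' by rewrite -[B']setTI; exact: minv.
  have YB : Y @^-1` B = c 0 @^-1` B'.
    by apply/seteqP; split => w; rewrite /B' /= invE.
  by rewrite YB; exact: (independent_pair_of_family _ _ _ _ _ _ (-1) 0 indep).
have muP : rv_tail R mu Loo aoo.
  apply: rv_tail_distribution => // t t1; rewrite -tailoo//.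
  have := ident (-1) 0 `]t, +oo[%classic (measurable_itv _).
  rewrite /distribution /pushforward.
  have E x : c x @^-1` `]t, +oo[%classic = [set w | t < c x w].
    by apply/seteqP; split => w /=; rewrite in_itv/= andbT.
  by rewrite !E.
have nuP : rv_tail R nu L0 a0.
  apply: rv_tail_distribution => // t t1.
  have t0 : 0 < t by exact: lt_trans t1.
  have -> : [set w | t < Y w] = [set w | c 0 w < t^-1].
    by apply/seteqP; split => w /=; rewrite -[t in t < _]invrK ltf_pV2 ?posrE ?invr_gt0.
  rewrite tail0 ?invr_gt0 ?invf_lt1// invrK; congr (_ * _)%:E.
  by rewrite -powR_inv1 ?ltW// -powRrM mulN1r.
have EcE : moment_pos mu alpha = Ec.
  rewrite /Ec -(moment_posE _ _ _ P (c 0) (c_gt0 0)).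
  by apply: eq_measure_integral => A mA _; exact: ident.
have EiE : moment_pos nu alpha = Ei by exact: (moment_posE _ _ _ P Y).
have alpha_ge0 : 0 <= alpha by rewrite /alpha /trap_index le_min !ltW.
have Ec_gt0 : (0 < moment_pos mu alpha)%E.
  by apply: moment_pos_gt0 => //; exact: (rv_tail_pos _ _ _ muP).
have Ei_gt0 : (0 < moment_pos nu alpha)%E.
  by apply: moment_pos_gt0 => //; exact: (rv_tail_pos _ _ _ nuP).
have := asymp_exists R mu nu Loo L0 aoo a0 muP nuP idxP; rewrite /= -/alpha.
rewrite EcE EiE => /(_ fin wcvg) [q [N [q01 q0 q1 qlim [Ec_fin Ei_fin asy]]]].
exists q; split => // d' T' P' B cbar ibar BE indepB cbarP ibarP.
rewrite -EcE in cbarP Ec_fin asy; rewrite -EiE in ibarP Ei_fin asy.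
have W := law_weak_cvg _ _ _ P X Y (c_gt0 _) Y_gt0 indepXY N alpha q q01 Ec_gt0 Ei_gt0
  Ec_fin Ei_fin asy _ _ P' B cbar ibar BE indepB _ ibarP.
have cbarP' : (moment_pos mu alpha < +oo)%E -> size_biased P alpha X cbar.
  by exact: cbarP.
(* The event rho_0 > t is {XY > e^lambda t}, so the drift lambda only rescales the threshold. *)
have lawE : cond_law lambda c = fun t =>
    pushforward (conditional P [set w | expR lambda * t < X w * Y w])
      (fun w => ((X w)%:E, (Y w)%:E)).
  apply/funext => t; rewrite /cond_law; congr (pushforward (conditional P _) _).
  by apply/seteqP; split => w /=; rewrite /rho0 expRN -mulrA ltr_pdivlMl ?expR_gt0.
move=> f fc fb; rewrite lawE.
have soo : (expR lambda * t) @[t --> +oo] --> +oo.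
  apply/cvgryPge => A; apply/near_pinfty_geP; exists (expR (- lambda) * A) => t.
  by rewrite expRN ler_pdivrMl ?expR_gt0.
exact: (cvg_comp _ _ soo (W cbarP' f fc fb)).
Qed.
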